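(* Let $M$ be a smooth manifold equipped with a nowhere-vanishing smooth measure, $S\to M$ a smooth Hermitian complex vector bundle, and $K\subseteq M$ compact. Then there exist $\epsilon>0$ and, for all $0<t<\epsilon$, operators $F_t\colon\mathrm{L}^2(K;S)\to\mathrm{L}^2(M;S)$ which satisfy: (1) $\|F_t\|\le C$ for some constant $C$ and all $t$; (2) for all $u\in\mathrm{L}^2(K;S)$, $\lim_{t\to0}F_tu=u$ in $\mathrm{L}^2(M;S)$; (3) for all $u\in\mathrm{L}^2(K;S)$, $F_tu$ is smooth with compact support; (4) for any (first order linear) differential operator $D$ acting on the sections of $S$, the commutator $[D,F_t]$ extends to a bounded operator $\mathrm{L}^2(K;S)\to\mathrm{L}^2(M;S)$, and its norm is bounded independent of $t$.
   Context: Setting. $S\stackrel{\pi}{\to}M$ is a smooth complex vector bundle of rank $k$ over a smooth manifold $M$ of dimension $n$, with smoothly varying inner products $(\cdot|\cdot)^{S_p}$ on the fibres $S_p$. $\Gamma^\infty(M;S)$ (resp. $\Gamma_c^\infty(M;S)$) denotes the smooth (resp. smooth compactly supported) sections. A nowhere-vanishing smooth measure on $M$ is a Borel measure $\mu$ such that for every chart $(U,\varphi)$ there is a smooth $f\colon\varphi(U)\to(0,\infty)$ with $\mathrm{d}(\varphi_*\mu|_U)=f\,\mathrm{d}\lambda$, $\lambda$ being Lebesgue measure. Standing assumption: there is an atlas and a number $L$ such that for all charts of the atlas the density $f$ and $g=1/f$ satisfy $\|f\|_\infty,\|g\|_\infty\le L$. $\mathrm{L}^2(M;S)$ is the completion of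 $\Gamma_c^\infty(M;S)$ for $\langle u|v\rangle=\int_M(u(p)|v(p))^{S_p}\,\mathrm{d}\mu(p)$; for $U\subseteq M$, $\mathrm{L}^2(U;S)$ is the completion of the smooth sections whose compact support is contained in $U$. Differential operators. A (first order linear) differential operator acting on the sections of $S$ is a $\mathbb{C}$-linear map $D\colon\Gamma^\infty(M;S)\to\Gamma^\infty(M;S)$ such that (a) if $u,v$ agree on an open set $U$, then so do $Du,Dv$; and (b) for every chart $\varphi\colon U\to V\subseteq\mathbb{R}^n$ and trivialization $\Psi=(\pi,\psi)\colon S|_U\to U\times\mathbb{C}^k$ there are $A^1,\dots,A^n,B\in C^\infty(U,\mathrm{M}_k(\mathbb{C}))$ with $$(Du)(p)=\sum_{j=1}^n\Psi^{-1}\bigl(p,A^j(p)\,\partial_j(\psi\circ u\circ\varphi^{-1})|_{\varphi(p)}\bigr)+\Psi^{-1}\bigl(p,B(p)(\psi\circ u)(p)\bigr)$$ for all $p\in U$, $u\in\Gamma^\infty(M;S)$. The commutator $[D,F_t]u=DF_tu-F_tDu$ is initially defined for smooth sections $u$ supported in $K$. In (4) the bound on the norm may depend on $D$ but not on $t$. *)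

(* Defs.v *)
From HB Require Import structures.
From mathcomp Require Import all_boot all_order all_algebra.
From mathcomp Require Import all_classical all_reals all_analysis measurable_realfun.
From mathcomp Require Import complex.
Set Implicit Arguments.
Unset Strict Implicit.
Unset Printing Implicit Defensive.

Import Order.TTheory GRing.Theory Num.Theory.
Import numFieldNormedType.Exports.

Local Open Scope classical_set_scope.
Local Open Scope ring_scope.

Notation borel T := (g_sigma_algebraType (@open T)).

Section lebesgue_measure_rV.
Context {R : realType}.

Definition cons_pair_tuple n (p : n.-tuple (measurableTypeR R) * measurableTypeR R) :
  n.+1.-tuple (measurableTypeR R) := [tuple of p.2 :: p.1].

Lemma measurable_cons_tuple n : measurable_fun setT (@cons_pair_tuple n).
Proof. exact: measurable_cons. Qed.

Definition row_of_tuple n (t : n.-tuple (measurableTypeR R)) :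
  borel 'rV[R]_n := \row_i tnth t i.

Lemma measurable_row_of_tuple n : measurable_fun setT (@row_of_tuple n).
Proof.
have := @measurability _ _ _ (borel 'rV[R]_n) setT (@row_of_tuple n) (@open 'rV[R]_n) erefl; apply.
move=> _ [U oU <-]; rewrite setTI.
pose c (q : n.-tuple rat * nat) : 'rV[R]_n := \row_i ratr (tnth q.1 i).
pose F q := if `[< ball (c q) q.2.+1%:R^-1 `<=` U >]
  then @row_of_tuple n @^-1` ball (c q) q.2.+1%:R^-1 else set0.
have -> : @row_of_tuple n @^-1` U = \bigcup_q F q.
  apply/seteqP; split=> [t Ut|t [q _]]; last first.
    by rewrite /F; case: asboolP => // qU /qU.
  move: oU; rewrite openE => /(_ _ Ut) /nbhs_ballP[e /= e0 eU].
  have e20 : 0 < e / 2 by rewrite divr_gt0.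
  have [N _ Ne] := near_infty_natSinv_lt (PosNum e20).
  have /= {}Ne := Ne N (leqnn N).
  have N0 : (0 : R) < N.+1%:R^-1 by rewrite invr_gt0.
  have ex i : exists r : rat, ball (tnth t i) N.+1%:R^-1 (ratr r : R).
    have /rat_in_itvoo[r rI] : tnth t i - N.+1%:R^-1 < tnth t i + N.+1%:R^-1.
      by rewrite ltrBlDr -addrA ltrDl addr_gt0.
    exists r; rewrite /ball/= ltr_distlC.
    by move: rI; rewrite in_itv/= => /andP[-> ->].
  have [r rP] := choice ex.
  pose q := ([tuple of mktuple r], N).
  have bq : ball (c q) N.+1%:R^-1 (row_of_tuple t).
    split=> // i j; rewrite /c !mxE tnth_mktuple.
    exact/ball_sym/rP.
  exists q => //; rewrite /F; case: asboolP => // -[] y qy; apply: eU.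
  have := ball_triangle (ball_sym bq) qy => /le_ball; apply.
  by rewrite [leRHS](splitr e) lerD// ltW.
apply: countable_bigcupT_measurable => [|q]; first exact: countableP.
rewrite /F; case: ifP => // _.
have -> : @row_of_tuple n @^-1` ball (c q) q.2.+1%:R^-1 =
    \bigcap_(i in [set: 'I_n])
      (fun t => tnth t i) @^-1` ball (c q ord0 i) (q.2.+1%:R^-1 : R).
  apply/seteqP; split=> [t [_ qt] i _|t qt] /=.
    by have := qt ord0 i; rewrite [X in ball _ _ X]mxE.
  by split=> [|i j]; [rewrite invr_gt0|rewrite ord1 [X in ball _ _ X]mxE; exact: qt].
apply: fin_bigcap_measurable => // i _.
rewrite -[X in measurable X]setTI.
apply: (measurable_tnth i) => //.
exact: measurable_ball.
Qed.

Section image_measure.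
Context d d' (T1 : measurableType d) (T2 : measurableType d')
  (m : {measure set T1 -> \bar R}) (f : T1 -> T2) (mf : measurable_fun setT f).

Definition image_measure : {measure set T2 -> \bar R}.
Proof. by refine [the {measure set T2 -> \bar R} of pushforward m f]; exact: mf. Defined.

End image_measure.

(* The n-fold product of the one-dimensional Lebesgue measure. *)
Fixpoint lebesgue_tuple n : {measure set (n.-tuple (measurableTypeR R)) -> \bar R} :=
  match n with
  | 0 => dirac [tuple]
  | m.+1 => image_measure
      (product_measure1 (lebesgue_tuple m) (@lebesgue_measure R))
      (@measurable_cons_tuple m)
  end.

Definition lebesgue_rV n : {measure set (borel 'rV[R]_n) -> \bar R} :=
  image_measure (lebesgue_tuple n) (@measurable_row_of_tuple n).

End lebesgue_measure_rV.

Section smooth_functions.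
Context {R : realType} {n : nat}.
Implicit Types V : set 'rV[R]_n.

Definition partial {W : normedModType R} (j : 'I_n) (f : 'rV[R]_n -> W) :
  'rV[R]_n -> W := fun x => 'D_(delta_mx 0 j) f x.

(* Only meant for open V. *)
Fixpoint Ck {W : normedModType R} (m : nat) V (f : 'rV[R]_n -> W) : Prop :=
  (forall x, V x -> {for x, continuous f}) /\
  match m with
  | 0 => True
  | m'.+1 => forall j, (forall x, V x -> derivable f x (delta_mx 0 j)) /\
                       Ck m' V (partial j f)
  end.

Definition smooth_on {W : normedModType R} V (f : 'rV[R]_n -> W) : Prop :=
  forall m, Ck m V f.

Definition csmooth_on V (f : 'rV[R]_n -> R[i]) : Prop :=
  smooth_on V (fun x => complex.Re (f x)) /\
  smooth_on V (fun x => complex.Im (f x)).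

Definition cpartial (j : 'I_n) (f : 'rV[R]_n -> R[i]) (x : 'rV[R]_n) : R[i] :=
  (partial j (fun y => complex.Re (f y)) x
   +i* partial j (fun y => complex.Im (f y)) x)%C.

Definition vpartial k (j : 'I_n) (f : 'rV[R]_n -> 'cV[R[i]]_k)
    (x : 'rV[R]_n) : 'cV[R[i]]_k :=
  \col_i cpartial j (fun y => f y i 0) x.

End smooth_functions.

(* The values of chart_map outside chart_dom, and of chart_inv outside
   chart_img, are irrelevant. *)
Record chart (R : realType) (n : nat) (M : topologicalType) := Chart {
  chart_dom : set M;
  chart_map : M -> 'rV[R]_n;
  chart_inv : 'rV[R]_n -> M;
  chart_img : set 'rV[R]_n := chart_map @` chart_dom;
  chart_dom_open : open chart_dom;
  chart_img_open : open chart_img;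
  chart_mapK : forall p, chart_dom p -> chart_inv (chart_map p) = p;
  chart_map_continuous :
    forall p, chart_dom p -> {for p, continuous chart_map};
  chart_inv_continuous :
    forall x, chart_img x -> {for x, continuous chart_inv}
}.

Definition chart_compat (R : realType) n (M : topologicalType)
    (c c' : chart R n M) : Prop :=
  smooth_on (chart_map c @` (chart_dom c `&` chart_dom c'))
            (chart_map c' \o chart_inv c).

(* Carriers are pointed because measurable types are. *)
Record manifold (R : realType) (n : nat) := Manifold {
  mfd_carrier :> ptopologicalType;
  mfd_hausdorff : hausdorff_space mfd_carrier;
  mfd_second_countable : @second_countable mfd_carrier;
  mfd_atlas : set (chart R n mfd_carrier);
  mfd_atlas_cover : forall p, exists2 c, mfd_atlas c & chart_dom c p;
  mfd_atlas_compat :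
    forall c c', mfd_atlas c -> mfd_atlas c' -> chart_compat c c'
}.

Section manifold_theory.
Context {R : realType} {n : nat} (M : manifold R n).

(* The charts of the maximal atlas. *)
Definition is_chart (c : chart R n M) : Prop :=
  forall c', mfd_atlas c' -> chart_compat c c' /\ chart_compat c' c.

Definition is_atlas (B : set (chart R n M)) : Prop :=
  (forall c, B c -> is_chart c) /\
  (forall p : M, exists2 c, B c & chart_dom c p).

Definition msmooth_on (U : set M) (f : M -> R[i]) : Prop :=
  forall c, is_chart c ->
    csmooth_on (chart_map c @` (chart_dom c `&` U)) (f \o chart_inv c).

Section measures.
Variable mu : {measure set (borel M) -> \bar R}.

Definition is_density (c : chart R n M) (f : 'rV[R]_n -> R) : Prop :=
  forall A : set (borel 'rV[R]_n), measurable A -> A `<=` chart_img c ->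
    mu (chart_dom c `&` chart_map c @^-1` A) =
    (\int[lebesgue_rV n]_(x in A) (f x)%:E)%E.

Definition is_smooth_density (c : chart R n M) (f : 'rV[R]_n -> R) : Prop :=
  [/\ smooth_on (chart_img c) f,
      forall x, chart_img c x -> 0 < f x
    & is_density c f].

Definition nowhere_vanishing_smooth_measure : Prop :=
  forall c, is_chart c -> exists f, is_smooth_density c f.

Definition uniformly_bounded_densities : Prop :=
  exists (B : set (chart R n M)) (L : R), is_atlas B /\
    forall c, B c -> exists2 f, is_smooth_density c f &
      forall x, chart_img c x -> `|f x| <= L /\ `|(f x)^-1| <= L.

End measures.
End manifold_theory.

(* A trivialization over triv_dom of a family of vector spaces:
   triv_map p is the restriction to the fibre over p of the second component
   of S|_U -> U * C^k, triv_inv p its inverse; both are irrelevant for p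
   outside triv_dom. *)
Record trivialization (R : realType) (M : topologicalType) (k : nat)
    (F : M -> lmodType R[i]) := Trivialization {
  triv_dom : set M;
  triv_map : forall p, F p -> 'cV[R[i]]_k;
  triv_inv : forall p, 'cV[R[i]]_k -> F p;
  triv_dom_open : open triv_dom;
  triv_linear : forall p, triv_dom p -> linear (@triv_map p);
  triv_mapK : forall p, triv_dom p -> cancel (@triv_map p) (@triv_inv p);
  triv_invK : forall p, triv_dom p -> cancel (@triv_inv p) (@triv_map p)
}.

Definition triv_compat (R : realType) n (M : manifold R n) k
    (F : M -> lmodType R[i]) (t t' : trivialization k F) : Prop :=
  forall i j, msmooth_on (triv_dom t `&` triv_dom t')
    (fun p => triv_map t' (triv_inv t p (delta_mx j 0)) i 0).

(* A smooth vector bundle is given by its fibres and an atlas of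
   trivializations with smooth transition matrices; these data determine the
   manifold structure of the total space. *)
Record vbundle (R : realType) n (M : manifold R n) (k : nat) := Vbundle {
  fibre :> M -> lmodType R[i];
  vb_atlas : set (trivialization k fibre);
  vb_atlas_cover : forall p, exists2 t, vb_atlas t & triv_dom t p;
  vb_atlas_compat :
    forall t t', vb_atlas t -> vb_atlas t' -> triv_compat t t'
}.

Section bundle_theory.
Context {R : realType} {n : nat} {M : manifold R n} {k : nat}
  (S : vbundle M k).

(* The local trivializations of S as a smooth bundle. *)
Definition is_triv (t : trivialization k S) : Prop :=
  forall t', vb_atlas t' -> triv_compat t t' /\ triv_compat t' t.

Definition section_of : Type := forall p : M, S p.
Implicit Types u v : section_of.

Definition smooth_section u : Prop :=
  forall t, is_triv t -> forall i,
    msmooth_on (triv_dom t) (fun p => triv_map t (u p) i 0).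

Definition supp u : set M := closure [set p | u p <> 0].

(* Smooth sections with compact support contained in U. *)
Definition smooth_supp_in (U : set M) u : Prop :=
  [/\ smooth_section u, compact (supp u) & supp u `<=` U].

Definition smooth_cpt u : Prop := smooth_section u /\ compact (supp u).

(* Smoothly varying inner products on the fibres, linear in the first
   argument. *)
Record hermitian_metric := HermitianMetric {
  herm :> forall p, S p -> S p -> R[i];
  herm_linear : forall p (y : S p) a (x x' : S p),
    herm (a *: x + x') y = a * herm x y + herm x' y;
  herm_sym : forall p (x y : S p), herm y x = (herm x y)^*;
  herm_pos : forall p (x : S p), x != 0 -> 0 < herm x x;
  herm_smooth : forall t, is_triv t -> forall i j,
    msmooth_on (triv_dom t) (fun p =>
      herm (triv_inv t p (delta_mx i 0)) (triv_inv t p (delta_mx j 0)))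
}.

(* First order linear differential operators; only the values on smooth
   sections matter. *)
Record diffop := Diffop {
  diffop_fun :> section_of -> section_of;
  diffop_smooth : forall u, smooth_section u -> smooth_section (diffop_fun u);
  diffop_linear : forall (a : R[i]) u v,
    smooth_section u -> smooth_section v ->
    forall p, diffop_fun (fun q => a *: u q + v q) p =
              a *: diffop_fun u p + diffop_fun v p;
  diffop_local : forall u v (U : set M),
    smooth_section u -> smooth_section v -> open U ->
    (forall p, U p -> u p = v p) ->
    forall p, U p -> diffop_fun u p = diffop_fun v p;
  diffop_first_order : forall (c : chart R n M) (t : trivialization k S),
    is_chart c -> is_triv t -> chart_dom c = triv_dom t ->
    exists (A : 'I_n -> M -> 'M[R[i]]_k) (B : M -> 'M[R[i]]_k),
    [/\ forall j i l, msmooth_on (chart_dom c) (fun p => A j p i l),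
        forall i l, msmooth_on (chart_dom c) (fun p => B p i l)
      & forall p u, chart_dom c p -> smooth_section u ->
        diffop_fun u p =
        \sum_(j < n) triv_inv t p
          (A j p *m vpartial j
             (fun x => triv_map t (u (chart_inv c x))) (chart_map c p))
        + triv_inv t p (B p *m triv_map t (u p))]
}.

Section L2.
Variables (h : hermitian_metric) (mu : {measure set (borel M) -> \bar R}).

Definition L2_inner u v : R[i] :=
  ((\int[mu]_(p in [set: borel M]) complex.Re (h p (u p) (v p)))%R
   +i* (\int[mu]_(p in [set: borel M]) complex.Im (h p (u p) (v p)))%R)%C.

(* A completion of the smooth compactly supported sections for L2_inner: a
   Banach space with an isometric linear map onto a dense subspace; the inner
   product extends by polarization. *)
Record L2_space := L2Space {
  L2_carrier :> completeNormedModType R[i];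
  L2_emb : section_of -> L2_carrier;
  L2_emb_linear : forall (a : R[i]) u v, smooth_cpt u -> smooth_cpt v ->
    L2_emb (fun p => a *: u p + v p) = a *: L2_emb u + L2_emb v;
  L2_emb_isometry : forall u, smooth_cpt u -> `|L2_emb u| ^+ 2 = L2_inner u u;
  L2_emb_dense : closure (L2_emb @` smooth_cpt) = setT
}.

(* The completion of the sections with compact support in U, realized as a
   closed subspace. *)
Definition L2_on (H : L2_space) (U : set M) : set H :=
  closure (@L2_emb H @` smooth_supp_in U).

End L2.
End bundle_theory.

Arguments L2_emb {R n M k S h mu} l u.
Arguments L2_on {R n M k S h mu} H U.

Definition linear_on (K : numFieldType) (H H' : normedModType K) (D : set H)
    (T : H -> H') : Prop :=
  forall a x y, D x -> D y -> T (a *: x + y) = a *: T x + T y.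

(* The operator norm of the restriction of T to D is at most C. *)
Definition opnorm_le (R : realType) (H H' : normedModType R[i]) (D : set H)
    (T : H -> H') (C : R) : Prop :=
  0 <= C /\ forall x, D x -> `|T x| <= C%:C%C * `|x|.

(* Main.v *)
(** Friedrichs mollifiers. In a coordinate cube where the bundle is trivial,
    take the convolution of a cut-off section with an approximate identity of
    width t. Schur's test bounds it uniformly in [L^2]. Integrating by parts, the
    kernel of its commutator with [a d_j] is a derivative of the mollifier, of
    size [1/t] after normalization, times a difference of values of [a], of size
    [t]; so Schur's test applies again. Zero-order terms and derivatives of the
    cutoff contribute bounded operators. Finitely many cubes cover K; if [chi] is 1 on
    the cubes already treated and [chi_q] on a new one, then [chi_q (1 - chi)] is
    supported in the new patch and [chi_q (1 - chi) + chi] is 1 on their union.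
    Everything is proved for smooth compactly supported sections and then
    extended by density. For a Cauchy sequence [u_m], the pairings with test
    functions converge to a bounded functional, hence the mollified sections
    converge uniformly to a smooth limit, although limits in the abstract
    completion are not themselves sections. *)
Require Import Defs.
From HB Require Import structures.
From mathcomp Require Import all_boot all_order all_algebra.
From mathcomp Require Import all_classical all_reals all_analysis measurable_realfun.
From mathcomp Require Import complex.
From mathcomp Require Import ring lra.
Set Implicit Arguments.
Unset Strict Implicit.
Unset Printing Implicit Defensive.

Import Order.TTheory GRing.Theory Num.Theory.
Import numFieldNormedType.Exports.

Local Open Scope classical_set_scope.
Local Open Scope ring_scope.

(** * Differential calculus on R^n *)

(** Estimates are kept at the level of squared integrals of continuous functions of bounded support,
    where every integral is finite. No integral compares two charts: a patch records a two-sided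
    comparison of the measure with Lebesgue measure on the sets of a single chart. The fibre metric
    is compared with the Euclidean one through the determinant of the Gram matrix on a compact cube.
    The radii leave room for the operators: a section cut off in the cube of radius [2 r] and
    mollified at width [t < r] stays in the cube of radius [3 r], and operator coefficients cut off
    between [3 r] and [4 r] are unchanged there. Each operator approximates multiplication by its
    cutoff, a property that is additive over patches; [eps] is the least of the radii involved and
    1. The operators act on the whole completion, and [K] enters through the cutoff being 1 on it.
    In the commutator, [D] is applied to a smooth representative of [F t u]; it is unique because a
    smooth section of zero energy vanishes. *)

Section row_topology.
Context {R : realType}.

(** The norm of a row is its maximum norm, so every ball below is a cube. Products of one-variable
    cutoffs are therefore cutoffs for balls, and the volume of a ball is a product of lengths. *)
Lemma rV_norm_le n (v : 'rV[R]_n) (r : R) :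
  0 <= r -> (`|v| <= r) <-> (forall i, `|v 0 i| <= r).
Proof.
move=> r0; split=> [vr i|vr].
  apply: le_trans vr; rewrite [in leRHS]/Num.norm/= mx_normrE.
  exact: (le_bigmax _ (fun ij : 'I_1 * 'I_n => `|v ij.1 ij.2|) (0, i)).
rewrite [leLHS]/Num.norm/= mx_normrE; apply: bigmax_le => // -[a b] _ /=.
by rewrite ord1.
Qed.

Lemma rV_coord_le n (v : 'rV[R]_n) i : `|v 0 i| <= `|v|.
Proof. by have /rV_norm_le -> := lexx `|v|. Qed.

Lemma rV_norm_lt n (v : 'rV[R]_n) (r : R) :
  0 < r -> (`|v| < r) <-> (forall i, `|v 0 i| < r).
Proof.
move=> r0; split=> [vr i|vr]; first exact: le_lt_trans (rV_coord_le _ _) vr.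
rewrite [ltLHS]/Num.norm/= mx_normrE; apply: bigmax_lt => // -[a b] _ /=.
by rewrite ord1.
Qed.

Lemma continuous_rV (T : topologicalType) n (G : T -> 'rV[R]_n) x :
  (forall i, {for x, continuous (fun t => G t 0 i)}) -> {for x, continuous G}.
Proof.
move=> Gx; apply/cvgrPdist_lt => e e0.
have : \forall t \near x, forall i, `|G x 0 i - G t 0 i| < e.
  by apply: filter_forall => i; exact: (cvgrPdist_lt _ _).1 (Gx i) e e0.
apply: filterS => t Gt.
by apply/(rV_norm_lt _ e0) => i; rewrite !mxE.
Qed.

Lemma norm_delta n (j : 'I_n) : `|delta_mx 0 j : 'rV[R]_n| <= 1.
Proof.
apply/rV_norm_le => // i; rewrite mxE eqxx /=.
by case: (i == j); rewrite ?normr1 ?normr0.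
Qed.

Lemma compact_closed_ball n (x : 'rV[R]_n) (r : R) :
  compact [set y | `|y - x| <= r].
Proof.
apply: bounded_closed_compact.
  exists (r + `|x|); split; first exact: num_real.
  move=> M rM y /= yr; apply: le_trans (ltW rM).
  by rewrite -[y](subrK x); apply: le_trans (ler_normD _ _) _; rewrite lerD2r.
have c : continuous (fun y : 'rV[R]_n => `|y - x|).
  move=> y; have h : (fun y => y - x) @ y --> y - x by apply: (cvgB cvg_id (cvg_cst _)).
  exact: cvg_norm h.
apply: (@preimage_closed _ _ (fun y : 'rV[R]_n => `|y - x|) [set z | z <= r]).
  by move=> y _; exact: c.
exact: closed_le.
Qed.

End row_topology.

Section Ck_calculus.
Context {R : realType} {n : nat}.
Implicit Types (V U : set 'rV[R]_n) (f g : 'rV[R]_n -> R).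

Lemma Ck_continuous (W : normedModType R) m V (f : 'rV[R]_n -> W) x :
  Ck m V f -> V x -> {for x, continuous f}.
Proof. by case: m => [|m] [cf _]; exact: cf. Qed.

Lemma Ck_sub (W : normedModType R) m U V (f : 'rV[R]_n -> W) :
  U `<=` V -> Ck m V f -> Ck m U f.
Proof.
move=> UV; elim: m f => [|m IH] f [cf df]; split=> //; try by move=> x /UV/cf.
move=> j; have [dfj kf] := df j; split=> [x /UV/dfj//|]; exact: IH.
Qed.

(** Derivatives are taken of the globally defined function, and [V] only lists the points at which
    conditions are imposed. The conditions can thus be checked on singletons, which makes regularity
    local. *)
Lemma Ck_pointwise (W : normedModType R) m V (f : 'rV[R]_n -> W) :
  (forall x, V x -> Ck m [set x] f) -> Ck m V f.
Proof.
elim: m f => [|m IH] f Vf; split=> //.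
- by move=> x /Vf[cf _]; exact: cf.
- by move=> x /Vf[cf _]; exact: cf.
- move=> j; split=> [x /Vf[_ /(_ j)[df _]]|]; first exact: df.
  by apply: IH => x /Vf[_ /(_ j)[_]].
Qed.

Lemma Ck_local (W : normedModType R) m V (f : 'rV[R]_n -> W) :
  (forall x, V x -> exists2 U, U x & Ck m U f) -> Ck m V f.
Proof.
move=> Vf; apply: Ck_pointwise => x /Vf[U Ux]; apply: Ck_sub.
by move=> _ ->.
Qed.

Lemma partial_ext (W : normedModType R) V (f g : 'rV[R]_n -> W) j x :
  open V -> (forall y, V y -> f y = g y) -> V x -> partial j f x = partial j g x.
Proof.
move=> oV fg Vx; apply: near_eq_derive.
by move: oV; rewrite openE => /(_ _ Vx); apply: filterS => y; exact: fg.
Qed.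

Lemma continuous_ext (T S : topologicalType) (V : set T) (f g : T -> S) x :
  open V -> (forall y, V y -> f y = g y) -> V x ->
  {for x, continuous f} -> {for x, continuous g}.
Proof.
move=> oV fg Vx cf; rewrite /prop_for /continuous_at -fg//.
apply: cvg_trans cf; apply: near_eq_cvg.
by move: oV; rewrite openE => /(_ _ Vx); apply: filterS => y; exact: fg.
Qed.

(** Openness of [V] makes the two functions agree near each of its points, so that their partial
    derivatives agree on [V] again and the induction continues. *)
Lemma Ck_ext (W : normedModType R) m V (f g : 'rV[R]_n -> W) :
  open V -> (forall x, V x -> f x = g x) -> Ck m V f -> Ck m V g.
Proof.
move=> oV; elim: m f g => [|m IH] f g fg [cf df].
  by split=> // x Vx; exact: (continuous_ext oV fg Vx (cf x Vx)).
split=> [x Vx|j]; first exact: (continuous_ext oV fg Vx (cf x Vx)).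
have [dfj kf] := df j; split=> [x Vx|].
  apply: near_eq_derivable (dfj x Vx).
  by move: oV; rewrite openE => /(_ _ Vx); apply: filterS => y; exact: fg.
by apply: IH kf => x Vx; exact: (partial_ext j oV fg Vx).
Qed.

Lemma CkW (W : normedModType R) m V (f : 'rV[R]_n -> W) : Ck m.+1 V f -> Ck m V f.
Proof.
elim: m f => [|m IH] f [cf df]; split=> // j.
by have [dfj kf] := df j; split=> //; exact: IH.
Qed.

Lemma Ck_cst (W : normedModType R) m V (c : W) : Ck m V (cst c).
Proof.
elim: m c => [|m IH] c; split=> //; try by move=> x _; apply: cst_continuous.
move=> j; split=> [x _|]; first exact: derivable_cst.
rewrite (_ : partial j _ = cst 0); first exact: IH.
by apply/funext => x; exact: derive_cst.
Qed.

Lemma is_derive_coord (i j : 'I_n) (x : 'rV[R]_n) :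
  is_derive x (delta_mx 0 j) (fun x : 'rV[R]_n => x 0 i) (i == j)%:R.
Proof.
have dx : derivable (fun x : 'rV[R]_n => x) x (delta_mx 0 j) by exact: derivable_id.
apply: DeriveDef; first exact: (derivable_mxP _ _ _).1 dx 0 i.
have := derive_mx dx; rewrite derive_id => /matrixP/(_ 0 i).
by rewrite !mxE/= => <-.
Qed.

Lemma Ck_coord m V i : Ck m V (fun x : 'rV[R]_n => x 0 i).
Proof.
case: m => [|m]; split => //; try by move=> x _; exact: coord_continuous.
move=> j; split=> [x _|].
  exact: (@ex_derive _ _ _ _ _ _ _ (is_derive_coord i j x)).
rewrite (_ : partial j _ = cst ((i == j)%:R : R)); first exact: Ck_cst.
by apply/funext => x; apply: (@derive_val _ _ _ _ _ _ _ (is_derive_coord i j x)).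
Qed.

Lemma CkD (W : normedModType R) m V (f g : 'rV[R]_n -> W) :
  open V -> Ck m V f -> Ck m V g -> Ck m V (fun x => f x + g x).
Proof.
move=> oV; elim: m f g => [|m IH] f g [cf df] [cg dg]; split=> //.
- by move=> x Vx; exact: (cvgD (cf _ Vx) (cg _ Vx)).
- by move=> x Vx; exact: (cvgD (cf _ Vx) (cg _ Vx)).
- move=> j; have [dfj kf] := df j; have [dgj kg] := dg j; split=> [x Vx|].
    by apply: derivableD; [exact: dfj|exact: dgj].
  apply: Ck_ext (IH _ _ kf kg) => // x Vx /=.
  by rewrite /partial deriveD //; [exact: dfj|exact: dgj].
Qed.

Lemma CkM m V f g : open V -> Ck m V f -> Ck m V g -> Ck m V (fun x => f x * g x).
Proof.
move=> oV; elim: m f g => [|m IH] f g kf kg; split=> //.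
- by move=> x Vx; exact: (cvgM (Ck_continuous kf Vx) (Ck_continuous kg Vx)).
- by move=> x Vx; exact: (cvgM (Ck_continuous kf Vx) (Ck_continuous kg Vx)).
- move: (kf) (kg) => [cf df] [cg dg].
  move=> j; have [dfj kfj] := df j; have [dgj kgj] := dg j; split=> [x Vx|].
    by apply: derivableM; [exact: dfj|exact: dgj].
  have := CkD oV (IH _ _ (CkW kf) kgj) (IH _ _ (CkW kg) kfj).
  apply: Ck_ext => // x Vx /=.
  by rewrite /partial deriveM //; [exact: dfj|exact: dgj].
Qed.

Lemma Ck_sum m V (I : Type) (s : seq I) (P : pred I) (F : I -> 'rV[R]_n -> R) :
  open V -> (forall i, P i -> Ck m V (F i)) ->
  Ck m V (fun x => \sum_(i <- s | P i) F i x).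
Proof.
move=> oV VF; elim: s => [|i s IH].
  by apply: (Ck_ext oV _ (Ck_cst _ _ 0)) => x _; rewrite big_nil.
case: (boolP (P i)) => Pi.
  by apply: (Ck_ext oV _ (CkD oV (VF i Pi) IH)) => x _; rewrite big_cons Pi.
by apply: (Ck_ext oV _ IH) => x _; rewrite big_cons (negbTE Pi).
Qed.

Lemma Ck_rV_coord p m V (G : 'rV[R]_n -> 'rV[R]_p) i :
  open V -> Ck m V G -> Ck m V (fun x => G x 0 i).
Proof.
move=> oV; elim: m G => [|m IH] G [cG dG]; split=> //.
- move=> x Vx; exact: (cvg_comp _ _ (cG x Vx) (@coord_continuous R 1 p 0 i (G x))).
- move=> x Vx; exact: (cvg_comp _ _ (cG x Vx) (@coord_continuous R 1 p 0 i (G x))).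
- move=> j; have [dGj kG] := dG j; split=> [x Vx|].
    by have /derivable_mxP := dGj x Vx; exact.
  apply: Ck_ext (IH _ kG) => // x Vx /=.
  by rewrite /partial (derive_mx (dGj x Vx)) mxE.
Qed.

End Ck_calculus.

(** * Differentiability of C^1 functions and the chain rule *)

Section chain_rule.
Context {R : realType}.

Lemma derive_line0 (V W : normedModType R) (f : V -> W) x v :
  'D_1 (fun h : R => f (h *: v + x)) 0 = 'D_v f x.
Proof.
rewrite /derive (_ : (fun h : R => h^-1 *: ((_ \o shift 0) (h *: 1) - _)) =
  fun h : R => h^-1 *: ((f \o shift x) (h *: v) - f x))//.
by apply/funext => h /=; rewrite addr0 scale0r add0r [_%:A]mulr1.
Qed.

Lemma is_derive_line n (f : 'rV[R]_n -> R) (w v : 'rV[R]_n) (s : R) :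
  derivable f (s *: v + w) v ->
  is_derive s 1 (fun s : R => f (s *: v + w)) ('D_v f (s *: v + w)).
Proof.
have e : (fun h : R => h^-1 *: (((fun s : R => f (s *: v + w)) \o shift s) (h *: 1)
            - f (s *: v + w))) =
         (fun h : R => h^-1 *: ((f \o shift (s *: v + w)) (h *: v) - f (s *: v + w))).
  by apply/funext => h /=; rewrite [h *: 1]mulr1 scalerDl addrA.
by move=> df; apply: DeriveDef; rewrite /derivable /derive e.
Qed.

(** The coordinates of [z] are replaced by those of [y] one at a time. Since the ball is a cube,
    every intermediate segment stays inside, and the mean value theorem bounds each of the [n]
    steps. *)
Lemma lipschitz_ball n (f : 'rV[R]_n -> R) (x : 'rV[R]_n) (d B : R) :
  (forall y, `|y - x| < d -> forall i, derivable f y (delta_mx 0 i) /\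
     `|partial i f y| <= B) ->
  forall y z, `|y - x| < d -> `|z - x| < d -> `|f y - f z| <= n%:R * B * `|y - z|.
Proof.
move=> fB y z yd zd.
have d0 : 0 < d by apply: le_lt_trans yd.
pose w (k : nat) : 'rV[R]_n := \row_i if (i < k)%N then y 0 i else z 0 i.
have w0 : w 0 = z by apply/rowP => i; rewrite mxE.
have wn : w n = y by apply/rowP => i; rewrite mxE ltn_ord.
have step (k : 'I_n) : `|f (w k.+1) - f (w k)| <= B * `|y - z|.
  (* [g s] is [w k] with its [k]-th coordinate set to [s], so that the parameter is the coordinate
     itself. *)
  pose g s : 'rV[R]_n := s *: delta_mx 0 k + (w k - z 0 k *: delta_mx 0 k).
  have gE s i : g s 0 i = if i == k then s else w k 0 i.
    rewrite !mxE eqxx /=; case: eqP => [->|_] /=; last by rewrite !mulr0 subr0 add0r.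
    by rewrite ltnn !mulr1 subrr addr0.
  have wk : w k = g (z 0 k).
    by apply/rowP => i; rewrite gE; case: eqP => // ->; rewrite mxE ltnn.
  have wk1 : w k.+1 = g (y 0 k).
    apply/rowP => i; rewrite gE !mxE ltnS leq_eqVlt; case: (eqVneq i k) => [->|ik].
      by rewrite eqxx.
    by rewrite (negbTE (_ : nat_of_ord i != k)).
  have gd s : s \in `[Num.min (y 0 k) (z 0 k), Num.max (y 0 k) (z 0 k)] -> `|g s - x| < d.
    move=> sI; apply/rV_norm_lt => // i.
    rewrite mxE gE [(- x) 0 i]mxE.
    have yi : `|y 0 i - x 0 i| < d.
      by have := (rV_norm_lt _ d0).1 yd i; rewrite !mxE.
    have zi : `|z 0 i - x 0 i| < d.
      by have := (rV_norm_lt _ d0).1 zd i; rewrite !mxE.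
    case: eqP => [ik|_]; last by rewrite mxE; case: ifP.
    subst i; move: sI yi zi; rewrite in_itv /= !ltr_norml.
    case: (leP (y 0 k) (z 0 k)) => ? /andP[? ?] /andP[? ?] /andP[? ?]; apply/andP; split; lra.
  have yz : `|y 0 k - z 0 k| <= `|y - z|.
    by have := rV_coord_le (y - z) k; rewrite !mxE.
  have B0 : 0 <= B by have [_] := fB y yd k; apply: le_trans.
  have key a b : a <= b -> a = Num.min (y 0 k) (z 0 k) -> b = Num.max (y 0 k) (z 0 k) ->
      `|f (g b) - f (g a)| <= B * (b - a).
    move=> ab aE bE.
    have dg s : s \in `[a, b] -> is_derive s 1 (fun s => f (g s)) (partial k f (g s)).
      by rewrite aE bE => /gd/fB/(_ k)[dfk _]; exact: is_derive_line.
    have dgo s : s \in `]a, b[ -> is_derive s 1 (fun s => f (g s)) (partial k f (g s)).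
      by move=> sI; apply: dg; exact: subset_itv_oo_cc.
    have cg : {within `[a, b], continuous (fun s => f (g s))}.
      apply: derivable_within_continuous => s sI; have [] := dg s sI; by [].
    have [c cI ->] := MVT_segment ab dgo cg.
    rewrite normrM (ger0_norm (_ : 0 <= b - a)) ?subr_ge0//.
    apply: ler_wpM2r; rewrite ?subr_ge0//.
    by move: cI; rewrite aE bE => /gd/fB/(_ k)[].
  apply: le_trans (_ : B * `|y 0 k - z 0 k| <= _); last exact: ler_wpM2l.
  rewrite wk wk1; case: (leP (y 0 k) (z 0 k)) => yzk.
    rewrite distrC (distrC (y 0 k)) (ger0_norm (_ : 0 <= z 0 k - y 0 k)) ?subr_ge0//.
    by apply: (key _ _ yzk); [rewrite min_l|rewrite max_r].
  rewrite (ger0_norm (_ : 0 <= y 0 k - z 0 k)); last by rewrite subr_ge0 ltW.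
  by apply: (key _ _ (ltW yzk)); [rewrite min_r// ltW|rewrite max_l// ltW].
rewrite -{1}wn -{1}w0.
have : f (w n) - f (w 0%N) = \sum_(k < n) (f (w k.+1) - f (w k)).
  by rewrite -(big_mkord xpredT (fun k => f (w k.+1) - f (w k))) telescope_sumr.
move=> ->; apply: le_trans (ler_norm_sum _ _ _) _.
apply: le_trans (ler_sum _ (fun k _ => step k)) _.
by rewrite sumr_const card_ord -mulrA [leRHS]mulr_natl.
Qed.

(** The candidate for a differential with gradient [c]; it receives a linear structure below so that
    it can be compared with ['d f x]. *)
Definition lincomb n (c : 'I_n -> R) (w : 'rV[R]_n) : R := \sum_i w 0 i * c i.

Lemma lincomb_delta n (c : 'I_n -> R) i : lincomb c (delta_mx 0 i) = c i.
Proof.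
rewrite /lincomb (bigD1 i)//= mxE !eqxx mul1r big1 ?addr0// => j ji.
by rewrite mxE (negbTE ji) andbF mul0r.
Qed.

Lemma lincombD n (c : 'I_n -> R) u v : lincomb c (u + v) = lincomb c u + lincomb c v.
Proof.
by rewrite /lincomb -big_split; apply: eq_bigr => i _; rewrite mxE mulrDl.
Qed.

Fact lincomb_linear n (c : 'I_n -> R) : linear (lincomb c : 'rV[R]_n -> R^o).
Proof.
move=> a u v; rewrite /lincomb scaler_sumr -big_split /=.
by apply: eq_bigr => i _; rewrite !mxE mulrDl scalerAl.
Qed.

HB.instance Definition _ n (c : 'I_n -> R) :=
  GRing.isLinear.Build R 'rV[R]_n R^o *:%R (lincomb c) (@lincomb_linear n c).

Lemma lincomb_continuous n (c : 'I_n -> R) : continuous (lincomb c).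
Proof.
move=> x; have : Ck 0 setT (fun x : 'rV[R]_n => \sum_i x 0 i * c i).
  apply: Ck_sum => [|i _]; first exact: openT.
  by apply: CkM; [exact: openT|exact: Ck_coord|exact: (Ck_cst _ _ (c i))].
by case=> cL _; exact: cL.
Qed.

(** Subtracting the candidate differential leaves a function whose partial derivatives are small
    near [x], by continuity of those of [f]. It is Lipschitz there with a small constant, which is
    the required little-o. *)
Lemma C1_differentiable n (f : 'rV[R]_n -> R) (V : set 'rV[R]_n) x :
  open V -> V x -> Ck 1 V f ->
  differentiable f x /\ 'd f x = lincomb (fun i => partial i f x) :> ('rV[R]_n -> R).
Proof.
move=> oV Vx [cf df].
set L := lincomb _.
have fx : (f : 'rV[R]_n -> R^o) \o shift x = cst (f x : R^o) + (L : 'rV[R]_n -> R^o) +o_ (0 : 'rV[R]_n) id.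
  apply/eqaddoP => e e0.
  (* The divisor absorbs the factor [n] of the Lipschitz estimate and is nonzero even when
     [n = 0]. *)
  pose e' := e / n.+1%:R; have e'0 : 0 < e' by rewrite divr_gt0.
  have : \forall y \near x, V y /\ forall i, `|partial i f x - partial i f y| < e'.
    have nV : \forall y \near x, V y by move: oV; rewrite openE => /(_ _ Vx).
    have nd : \forall y \near x, forall i, `|partial i f x - partial i f y| < e'.
      have h (i : 'I_n) : \forall y \near x, `|partial i f x - partial i f y| < e'.
        by have [_ [ci _]] := df i; have /cvgrPdist_lt/(_ _ e'0) := ci x Vx.
      exact: filter_forall h.
    by apply: filterS2 nV nd.
  move=> /nbhs_normP[d /= d0 dP].
  pose g y := f y - L y.
  have gB y : `|y - x| < d -> forall i, derivable g y (delta_mx 0 i) /\ `|partial i g y| <= e'.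
    move=> yd i; have [Vy dy] : V y /\ forall i, `|partial i f x - partial i f y| < e'.
      by apply: dP; rewrite /ball_/= distrC.
    have dfy := (df i).1 y Vy.
    have dL : is_derive y (delta_mx 0 i) L (partial i f x).
      have dfL : differentiable L y by apply: linear_differentiable; exact: lincomb_continuous.
      apply: DeriveDef; first exact: diff_derivable.
      rewrite deriveE// (@diff_lin _ _ _ L)//; last exact: lincomb_continuous.
      exact: lincomb_delta.
    have [dL1 dL2] := dL; split; first exact: derivableB.
    by rewrite /partial deriveB// dL2 distrC ltW// dy.
  have : \forall h \near (0 : 'rV[R]_n), `|h| < d.
    by apply/nbhs_normP; exists d => //= z; rewrite /ball_/= sub0r normrN.
  apply: filterS => h hd.
  rewrite /= /cst.
  have := lipschitz_ball gB (_ : `|(h + x) - x| < d) (_ : `|x - x| < d).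
  rewrite addrK subrr normr0 => /(_ hd d0).
  rewrite (_ : g (h + x) - g x = f (h + x) - (f x + L h)); last first.
    by rewrite /g /L lincombD; ring.
  move=> /le_trans; apply.
  rewrite [leLHS](_ : _ = n%:R / n.+1%:R * (e * `|h|)); last by rewrite /e'; ring.
  apply: ler_piMl; first by rewrite mulr_ge0// ltW.
  by rewrite ler_pdivrMr// mul1r ler_nat.
have cL : continuous (L : 'rV[R]_n -> R^o) by exact: lincomb_continuous.
have dE : 'd (f : 'rV[R]_n -> R^o) x = L :> ('rV[R]_n -> R^o) := diff_unique cL fx.
by split=> //; apply/diff_locallyP; rewrite dE.
Qed.

(** [G] is only known to be derivable in the direction [v]. Restricting it to the line through [x]
    gives a function of one variable, for which derivable and differentiable coincide, and the chain
    rule for differentials applies. *)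
Lemma is_derive_comp n m (f : 'rV[R]_m -> R) (V : set 'rV[R]_m) (G : 'rV[R]_n -> 'rV[R]_m) x v :
  open V -> V (G x) -> Ck 1 V f -> derivable G x v ->
  is_derive x v (f \o G) (\sum_i 'D_v G x 0 i * partial i f (G x)).
Proof.
move=> oV VGx kf dG; have [dfG dfE] := C1_differentiable oV VGx kf.
have G1 : derivable (fun h : R => G (h *: v + x)) 0 1.
  by have /derivable1P := dG.
have dG1 : 'D_1 (fun h : R => G (h *: v + x)) 0 = 'D_v G x.
  exact: derive_line0.
have G0 : (fun h : R => G (h *: v + x)) 0 = G x by rewrite scale0r add0r.
have dfG' : differentiable f ((fun h : R => G (h *: v + x)) 0) by rewrite G0.
have G1' := (derivable1_diffP _ _).1 G1.
have dc := differentiable_comp G1' dfG'.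
apply: DeriveDef; first exact: (derivable1P (f \o G) x v).2 ((derivable1_diffP _ _).2 dc).
have -> : 'D_v (f \o G) x = 'D_1 (f \o (fun h : R => G (h *: v + x))) 0.
  by rewrite -derive_line0.
by rewrite deriveE// diff_comp//= G0 dfE -deriveE// dG1.
Qed.

Lemma Ck_rV n p m V (G : 'rV[R]_n -> 'rV[R]_p) : open V ->
  (forall i, Ck m V (fun x => G x 0 i)) -> Ck m V G.
Proof.
move=> oV; elim: m G => [|m IH] G kG; split=> //.
- by move=> x Vx; apply: continuous_rV => i; exact: Ck_continuous (kG i) Vx.
- by move=> x Vx; apply: continuous_rV => i; exact: Ck_continuous (kG i) Vx.
- have dG j x : V x -> derivable G x (delta_mx 0 j).
    move=> Vx; apply/derivable_mxP => a i; rewrite ord1.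
    by have [_ /(_ j)[dG _]] := kG i; exact: dG.
  move=> j; split=> [x|]; first exact: dG.
  apply: IH => i; have [_ /(_ j)[_]] := kG i; apply: Ck_ext => // x Vx.
  by rewrite /partial (derive_mx (dG j x Vx)) mxE.
Qed.

Lemma partial_comp n m (f : 'rV[R]_m -> R) V (G : 'rV[R]_n -> 'rV[R]_m) x j :
  open V -> V (G x) -> Ck 1 V f -> derivable G x (delta_mx 0 j) ->
  partial j (f \o G) x = \sum_i partial j (fun x => G x 0 i) x * partial i f (G x).
Proof.
move=> oV VG kf dG; have := is_derive_comp oV VG kf dG.
case=> _; rewrite /partial => ->; apply: eq_bigr => i _.
by rewrite (derive_mx dG) mxE.
Qed.

(** By the chain rule a partial derivative of [f \o G] is a sum of products of partials of [G] with
    partials of [f] composed with [G]; the latter are covered by induction on the order. *)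
Lemma Ck_comp n m p (f : 'rV[R]_m -> R) V (G : 'rV[R]_n -> 'rV[R]_m) U :
  open V -> open U -> (forall x, U x -> V (G x)) -> Ck p V f -> Ck p U G ->
  Ck p U (f \o G).
Proof.
move=> oV oU UV; elim: p f => [|p IH] f kf kG; split=> //.
- move=> x Ux; apply: (continuous_comp (Ck_continuous kG Ux)).
  exact: Ck_continuous kf (UV _ Ux).
- move=> x Ux; apply: (continuous_comp (Ck_continuous kG Ux)).
  exact: Ck_continuous kf (UV _ Ux).
have k1f : Ck 1 V f.
  by elim: p {IH kG} kf => // p IHp /CkW.
move=> j; have [_ /(_ j)[dG kGj]] := kG; split=> [x Ux|].
  by have [] := is_derive_comp oV (UV _ Ux) k1f (dG x Ux).
have : Ck p U (fun x => \sum_i partial j (fun x => G x 0 i) x * partial i f (G x)).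
  apply: Ck_sum => // i _; apply: CkM => //.
    have := Ck_rV_coord i oU kGj; apply: Ck_ext => // x Ux.
    by rewrite /partial (derive_mx (dG x Ux)) mxE.
  by apply: IH; [have [_ /(_ i)[_ kfi]] := kf|exact: CkW].
apply: Ck_ext => // x Ux.
by rewrite (partial_comp oV (UV _ Ux) k1f (dG x Ux)).
Qed.

Lemma smooth_comp n m (f : 'rV[R]_m -> R) V (G : 'rV[R]_n -> 'rV[R]_m) U :
  open V -> open U -> (forall x, U x -> V (G x)) -> smooth_on V f -> smooth_on U G ->
  smooth_on U (f \o G).
Proof. by move=> oV oU UV kf kG p; exact: Ck_comp oV oU UV (kf p) (kG p). Qed.

Lemma smooth_rV_comp n m p (f : 'rV[R]_m -> 'rV[R]_p) V (G : 'rV[R]_n -> 'rV[R]_m) U :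
  open V -> open U -> (forall x, U x -> V (G x)) -> smooth_on V f -> smooth_on U G ->
  smooth_on U (f \o G).
Proof.
move=> oV oU UV kf kG q; apply: Ck_rV => // i.
apply: (Ck_comp (f := fun y => f y 0 i) oV oU UV) => //; exact: Ck_rV_coord.
Qed.

End chain_rule.

Section smooth_closure.
Context {R : realType} {n : nat} (V : set 'rV[R]_n) (oV : open V).
Implicit Types f g : 'rV[R]_n -> R.

Lemma smooth_cst (c : R) : smooth_on V (fun=> c).
Proof. by move=> m; exact: (Ck_cst m V c). Qed.

Lemma smooth_coord i : smooth_on V (fun x : 'rV[R]_n => x 0 i).
Proof. by move=> m; exact: Ck_coord. Qed.

Lemma smoothD f g : smooth_on V f -> smooth_on V g -> smooth_on V (fun x => f x + g x).
Proof. by move=> kf kg m; exact: CkD. Qed.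

Lemma smoothM f g : smooth_on V f -> smooth_on V g -> smooth_on V (fun x => f x * g x).
Proof. by move=> kf kg m; exact: CkM. Qed.

Lemma smoothN f : smooth_on V f -> smooth_on V (fun x => - f x).
Proof.
move=> kf; have := smoothM (smooth_cst (-1)) kf.
by rewrite (_ : (fun x => -1 * f x) = (fun x => - f x))//; apply/funext => x; rewrite mulN1r.
Qed.

Lemma smoothB f g : smooth_on V f -> smooth_on V g -> smooth_on V (fun x => f x - g x).
Proof. by move=> kf kg; exact: smoothD kf (smoothN kg). Qed.

Lemma smooth_prod (I : Type) (s : seq I) (P : pred I) (F : I -> 'rV[R]_n -> R) :
  (forall i, P i -> smooth_on V (F i)) -> smooth_on V (fun x => \prod_(i <- s | P i) F i x).
Proof.
move=> VF; elim: s => [|i s IH].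
  rewrite (_ : (fun x => _) = (fun=> 1)); first exact: smooth_cst.
  by apply/funext => x; rewrite big_nil.
case: (boolP (P i)) => Pi.
  rewrite (_ : (fun x => _) = (fun x => F i x * \prod_(i <- s | P i) F i x)).
    by apply: smoothM => //; exact: VF.
  by apply/funext => x; rewrite big_cons Pi.
rewrite (_ : (fun x => _) = (fun x => \prod_(i <- s | P i) F i x))//.
by apply/funext => x; rewrite big_cons (negbTE Pi).
Qed.

Lemma smooth_partial f j : smooth_on V f -> smooth_on V (partial j f).
Proof. by move=> kf m; have [_ /(_ j)[]] := kf m.+1. Qed.

Lemma smooth_continuous (W : normedModType R) (f : 'rV[R]_n -> W) x :
  smooth_on V f -> V x -> {for x, continuous f}.
Proof. by move=> kf; exact: Ck_continuous (kf 0). Qed.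

Lemma smooth_derivable (W : normedModType R) (f : 'rV[R]_n -> W) x j :
  smooth_on V f -> V x -> derivable f x (delta_mx 0 j).
Proof. by move=> /(_ 1)[_ /(_ j)[df _]]; exact: df. Qed.

(** Functions of one real variable are viewed on rows of length one, so that the calculus above
    applies to them. *)
Definition smooth1 (f : R -> R) := smooth_on setT (fun x : 'rV[R]_1 => f (x 0 0)).

Lemma smooth1_comp (f : R -> R) g : smooth1 f -> smooth_on V g -> smooth_on V (f \o g).
Proof.
move=> kf kg m.
pose G x : 'rV[R]_1 := const_mx (g x).
have -> : f \o g = (fun x : 'rV[R]_1 => f (x 0 0)) \o G.
  by apply/funext => x /=; rewrite mxE.
apply: (Ck_comp openT oV) => //.
apply: Ck_rV => // i; rewrite (_ : (fun x => G x 0 i) = g)//.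
by apply/funext => x; rewrite mxE.
Qed.

End smooth_closure.

(** * Smooth cutoffs built from a flat exponential *)

Section flat_function.
Context {R : realType}.
Implicit Types x : R.

(* [flat m x = x^-m exp(-1/x)] on positive reals: a family closed under
   derivation whose members are all continuous at [0]. *)
Definition flat (m : nat) x : R := if 0 < x then x ^- m * expR (- x^-1) else 0.

Lemma flat_ge0 m x : 0 <= flat m x.
Proof. by rewrite /flat; case: ifP => // x0; rewrite mulr_ge0 ?expR_ge0// invr_ge0 exprn_ge0 ?ltW. Qed.

(** From [expR y >= 1 + y >= y] at [y = x^-1 / m.+1%:R], raised to the power [m.+1]. One power
    beyond [m] leaves a factor [x], which gives both continuity and differentiability at 0. *)
Lemma flat_le m x : 0 < x -> flat m x <= (m.+1%:R ^+ m.+1) * x.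
Proof.
move=> x0; rewrite /flat x0 expRN.
have m0 : (0 : R) < m.+1%:R by [].
have h : (x^-1 / m.+1%:R) ^+ m.+1 <= expR x^-1.
  rewrite -[in leRHS](divfK (lt0r_neq0 m0) x^-1) expRM_natr.
  apply: lerXn2r; rewrite ?nnegrE ?expR_ge0//.
    by rewrite divr_ge0// invr_ge0 ltW.
  by apply: le_trans (expR_ge1Dx _); rewrite lerDr.
have e0 : 0 < (x^-1 / m.+1%:R) ^+ m.+1 by rewrite exprn_gt0// divr_gt0 ?invr_gt0.
apply: le_trans (_ : x ^- m * ((x^-1 / m.+1%:R) ^+ m.+1)^-1 <= _).
  by rewrite ler_pM2l ?invr_gt0 ?exprn_gt0// lef_pV2 ?posrE ?expR_gt0.
rewrite exprMn !exprVn invfM !invrK (exprS x) (mulrC x) !mulrA mulVf ?mul1r 1?mulrC//.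
by rewrite expf_neq0// gt_eqF.
Qed.

(** Off 0 this is ordinary calculus on a half-line. At 0 the difference quotient of [flat m] is
    [flat m.+1], which tends to 0 by the linear bound. *)
Lemma is_derive_flat m x : is_derive x 1 (flat m) (flat m.+2 x - m%:R * flat m.+1 x).
Proof.
case: (ltgtP 0 x) => [x0|x0|<-].
- have nf : \near x, x ^- m * expR (- x^-1) = flat m x.
    by near=> y; rewrite /flat ifT//; near: y; exact: lt_nbhsr.
  apply: near_eq_is_derive nf _.
  have xn0 : x != 0 by rewrite gt_eqF.
  have d1 : is_derive x 1 (fun x : R => x ^+ m) (m%:R * x ^+ m.-1).
    apply: DeriveDef; first exact: exprn_derivable.
    by rewrite exp_derive /GRing.scale /= mulr1.
  have d2 : is_derive x 1 (fun x : R => (x ^+ m)^-1) (- (x ^+ m) ^- 2 * (m%:R * x ^+ m.-1)).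
    by apply: is_deriveV => //; rewrite expf_neq0.
  have d3 : is_derive x 1 (fun x : R => - x^-1) (x ^- 2).
    have d := is_deriveV (xn0 : id x != 0) (is_derive_id x 1).
    apply: (@is_derive_eq _ _ _ _ _ _ _ _ (is_deriveN d)).
    by rewrite /GRing.scale /= mulr1 opprK.
  have d4 : is_derive x 1 (fun x : R => expR (- x^-1)) (expR (- x^-1) * x ^- 2).
    by apply: (@is_derive1_comp _ expR (fun x : R => - x^-1)) => //; exact: is_derive_expR.
  apply: is_derive_eq (is_deriveM d2 d4) _.
  rewrite /GRing.scale /= /flat x0.
  case: m {d1 d2} => [|m] /=; first by field.
  by rewrite !exprS; field; rewrite ?expf_neq0 ?xn0.
- have nf : \near x, cst 0 x = flat m x.
    near=> y; rewrite /flat ifF//; apply/negbTE; rewrite -leNgt ltW//.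
    by near: y; exact: lt_nbhsl.
  apply: near_eq_is_derive nf _.
  rewrite /flat !ifF; last 2 first.
  - by rewrite ltNge ltW.
  - by rewrite ltNge ltW.
  by rewrite mulr0 subr0; exact: is_derive_cst.
- have fl : (fun h : R => h^-1 *: ((flat m \o shift 0) (h *: 1) - flat m 0)) @ 0^' --> (0 : R).
    apply/cvgrPdist_lt => e e0; near=> h.
    have h0 : h != 0 by near: h; exact: nbhs_dnbhs_neq.
    rewrite /= addr0 [h *: 1]mulr1 {2}/flat ltxx subr0 sub0r normrN.
    have -> : h^-1 *: flat m h = flat m.+1 h.
      rewrite /flat; case: ifP => _; last by rewrite scaler0.
      by rewrite [LHS]mulrA exprS invfM.
    rewrite ger0_norm ?flat_ge0//.
    have [hp|hn] := ltP 0 h; last first.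
      by rewrite /flat (_ : (0 < h) = false)//; apply/negbTE; rewrite -leNgt.
    apply: le_lt_trans (flat_le _ hp) _.
    rewrite -ltr_pdivlMl ?exprn_gt0//.
    rewrite mulrC; apply: le_lt_trans (ler_norm _) _.
    by near: h; apply: dnbhs0_lt; rewrite mulr_gt0// invr_gt0 exprn_gt0.
  apply: DeriveDef; first by apply/cvg_ex; exists 0.
  rewrite /derive (cvg_lim _ fl)// /flat ltxx; ring.
Unshelve. all: by end_near. Qed.


Lemma smooth1_flat m : smooth1 (flat m).
Proof.
move=> p; elim: p m => [|p IH] m.
  split=> // x _.
  apply: (continuous_comp (f := fun x : 'rV[R]_1 => x 0 0) (g := flat m)).
    exact: coord_continuous.
  apply/differentiable_continuous/derivable1_diffP.
  by have [] := is_derive_flat m (x 0 0).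
have e (x : 'rV[R]_1) :
    (fun h : R => h^-1 *: (((fun x : 'rV[R]_1 => flat m (x 0 0)) \o shift x)
       (h *: delta_mx 0 0) - flat m (x 0 0))) =
    (fun h : R => h^-1 *: ((flat m \o shift (x 0 0)) (h *: 1) - flat m (x 0 0))).
  by apply/funext => h /=; rewrite !mxE !eqxx.
split=> [x _|j].
  apply: (continuous_comp (f := fun x : 'rV[R]_1 => x 0 0) (g := flat m)).
    exact: coord_continuous.
  apply/differentiable_continuous/derivable1_diffP.
  by have [] := is_derive_flat m (x 0 0).
rewrite ord1; split=> [x _|].
  by rewrite /derivable e; have [] := is_derive_flat m (x 0 0).
have -> : partial 0 (fun x : 'rV[R]_1 => flat m (x 0 0)) =
    (fun x : 'rV[R]_1 => flat m.+2 (x 0 0) + (- m%:R) * flat m.+1 (x 0 0)).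
  apply/funext => x; have [_] := is_derive_flat m (x 0 0).
  by rewrite mulNr /partial /derive e.
apply: CkD; [exact: openT|exact: IH|].
by apply: CkM; [exact: openT|exact: (Ck_cst _ _ (- m%:R : R))|exact: IH].
Qed.

(* The inner factor exceeds [1] for [x >= 1], where the outer [flat 0]
   therefore vanishes: no division is needed. *)
Definition smooth_step x : R := 1 - expR 1 * flat 0 (1 - expR 1 * flat 0 x).

Lemma smooth1_step : smooth1 smooth_step.
Proof.
have a : smooth_on setT (fun x : 'rV[R]_1 => 1 - expR 1 * flat 0 (x 0 0)).
  apply: (smoothB openT); first exact: smooth_cst.
  by apply: (smoothM openT); [exact: smooth_cst|exact: smooth1_flat].
apply: (smoothB openT); first exact: smooth_cst.
apply: (smoothM openT); first exact: smooth_cst.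
by have := smooth1_comp openT (smooth1_flat 0) a.
Qed.

(** The factor [expR 1] is the inverse of [flat 0 1], and for [x <= 0] the outer argument is exactly
    1. *)
Lemma smooth_step0 x : x <= 0 -> smooth_step x = 0.
Proof.
move=> x0; rewrite /smooth_step /flat (_ : (0 < x) = false); last first.
  by apply/negbTE; rewrite -leNgt.
by rewrite mulr0 subr0 ltr01 expr0 invr1 mul1r expRN mulfV ?subrr// gt_eqF// expR_gt0.
Qed.

Lemma smooth_step1 x : 1 <= x -> smooth_step x = 1.
Proof.
move=> x1; have x0 : 0 < x by apply: lt_le_trans x1.
have -> : smooth_step x = 1 - expR 1 * flat 0 (1 - expR (1 - x^-1)).
  by rewrite /smooth_step {2}/flat x0 expr0 invr1 mul1r -expRD.
rewrite /flat (_ : (0 < _) = false) ?mulr0 ?subr0//.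
apply/negbTE; rewrite -leNgt subr_le0 -{1}(@expR0 R) ler_expR subr_ge0.
by rewrite invf_le1.
Qed.

Lemma smooth_step_ge0 x : 0 <= smooth_step x.
Proof.
rewrite /smooth_step subr_ge0.
have : 1 - expR 1 * flat 0 x <= 1 by rewrite gerBl mulr_ge0// ?expR_ge0// flat_ge0.
move: (1 - expR 1 * flat 0 x) => y y1; rewrite /flat; case: ifP => [y0|_]; last by rewrite mulr0.
by rewrite expr0 invr1 mul1r -expRD -[leRHS](@expR0 R) ler_expR subr_le0 invf_ge1.
Qed.

Lemma smooth_step_le1 x : smooth_step x <= 1.
Proof. by rewrite /smooth_step gerBl mulr_ge0// ?expR_ge0// flat_ge0. Qed.

End flat_function.

(* Locked: otherwise [done] keeps unfolding it when comparing reals. *)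
Fact bumpf_key : unit. Proof. by []. Qed.

Section bump.
Context {R : realType} {n : nat}.
Implicit Types (x y : 'rV[R]_n) (a b : R).

(** Each factor has argument at least 1 where the coordinate distance is at most [a], and at most 0
    where it is at least [b]. Squares replace absolute values to keep the argument smooth. *)
Definition bumpf x a b : 'rV[R]_n -> R := locked_with bumpf_key (fun y =>
  \prod_(i < n) smooth_step ((b ^+ 2 - (y 0 i - x 0 i) ^+ 2) / (b ^+ 2 - a ^+ 2))).

Lemma bumpfE x a b : bumpf x a b = fun y =>
  \prod_(i < n) smooth_step ((b ^+ 2 - (y 0 i - x 0 i) ^+ 2) / (b ^+ 2 - a ^+ 2)).
Proof. exact: locked_withE. Qed.

Lemma smooth_bumpf x a b : smooth_on setT (bumpf x a b).
Proof.
rewrite bumpfE; apply: smooth_prod => [|i _]; first exact: openT.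
apply: (smooth1_comp openT smooth1_step).
apply: (smoothM openT); last exact: smooth_cst.
apply: (smoothB openT); first exact: smooth_cst.
have h : smooth_on setT (fun y : 'rV[R]_n => y 0 i - x 0 i).
  by apply: (smoothB openT); [exact: smooth_coord|exact: smooth_cst].
rewrite (_ : (fun y : 'rV[R]_n => (y 0 i - x 0 i) ^+ 2) =
  (fun y : 'rV[R]_n => (y 0 i - x 0 i) * (y 0 i - x 0 i))).
  exact: (smoothM openT h h).
by apply/funext => y; rewrite expr2.
Qed.

Lemma bumpf_ge0 x a b y : 0 <= bumpf x a b y.
Proof. by rewrite bumpfE; apply: prodr_ge0 => i _; exact: smooth_step_ge0. Qed.

Lemma bumpf_le1 x a b y : bumpf x a b y <= 1.
Proof.
by rewrite bumpfE; apply: prodr_ile1 => i _; rewrite smooth_step_ge0 smooth_step_le1.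
Qed.

Lemma bumpf_eq1 x a b y : 0 <= a < b -> `|y - x| <= a -> bumpf x a b y = 1.
Proof.
move=> /andP[a0 ab] ya; rewrite bumpfE big1// => i _; apply: smooth_step1.
have b0 := le_lt_trans a0 ab.
rewrite ler_pdivlMr ?mul1r; last by rewrite subr_gt0 ltrXn2r// ltW.
rewrite lerD2l lerN2 -real_normK ?num_real// lerXn2r// ?nnegrE//.
by have := (rV_norm_le _ a0).1 ya i; rewrite !mxE.
Qed.

Lemma bumpf_supp x a b y : 0 <= a < b -> bumpf x a b y != 0 -> `|y - x| < b.
Proof.
move=> /andP[a0 ab]; have b0 := le_lt_trans a0 ab.
rewrite bumpfE => /prodf_neq0 yn0; apply/rV_norm_lt => // i; rewrite ltNge !mxE; apply/negP => yb.
have /negP := yn0 i isT; apply; apply/eqP; apply: smooth_step0.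
rewrite pmulr_lle0; last by rewrite invr_gt0 subr_gt0 ltrXn2r// ltW.
by rewrite subr_le0 -[leRHS]real_normK ?num_real// lerXn2r// nnegrE// ltW.
Qed.

End bump.

(** * Lebesgue integration on R^n *)

Section lebesgue_tuple.
Context {R : realType}.
Local Notation mR := (measurableTypeR R).
Local Notation lambda := (@lebesgue_measure R).

Lemma ge0_integral_image d d' (T1 : measurableType d) (T2 : measurableType d')
    (m : {measure set T1 -> \bar R}) (phi : T1 -> T2) (mphi : measurable_fun setT phi)
    (f : T2 -> \bar R) : measurable_fun setT f -> (forall x, (0 <= f x)%E) ->
  (\int[image_measure m mphi]_x f x = \int[m]_x f (phi x))%E.
Proof.
move=> mf f0.
by have := @ge0_integral_pushforward _ _ _ _ R _ mphi m setT f measurableT mf (fun x _ => f0 x).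
Qed.

Definition box n (I : 'I_n -> set mR) : set (n.-tuple mR) := [set t | forall i, I i (tnth t i)].

Lemma measurable_box n (I : 'I_n -> set mR) : (forall i, measurable (I i)) -> measurable (box I).
Proof.
move=> mI; rewrite (_ : box I = \bigcap_(i in [set: 'I_n]) ((fun t => tnth t i) @^-1` I i)).
  apply: fin_bigcap_measurable => // i _; rewrite -[X in measurable X]setTI.
  exact: (measurable_tnth i).
by apply/seteqP; split=> [t tI i _|t tI i]; exact: tI.
Qed.

Lemma lebesgue_tuple_box n (I : 'I_n -> set mR) : (forall i, measurable (I i)) ->
  (lebesgue_tuple n (box I) = \prod_(i < n) lambda (I i))%E.
Proof.
elim: n I => [|n IH] I mI.
  rewrite big_ord0 /= diracE mem_set//=; by case.
rewrite big_ord_recl muleC -IH//.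
transitivity (product_measure1 (lebesgue_tuple n) lambda
   (box (fun i => I (lift ord0 i)) `*` I ord0)).
  rewrite /= /pushforward; congr (_ _).
  apply/seteqP; split=> [[t s] /= tI|[t s] /= [tI sI] i].
    split=> [i|]; first by have := tI (lift ord0 i); rewrite tnthS.
    by have := tI ord0; rewrite tnth0.
  by case: (unliftP ord0 i) => [j|] ->; rewrite ?tnthS ?tnth0//; exact: tI.
by rewrite product_measure1E//; exact: measurable_box.
Qed.

Lemma sigma_finite_lebesgue_tuple n : sigma_finite setT (@lebesgue_tuple R n).
Proof.
exists (fun k => box (fun _ : 'I_n => `[- k%:R, k%:R]%classic)).
  apply/esym/seteqP; split=> // t _.
  pose M := \sum_(i < n) `|tnth t i|.
  exists (Num.truncn M).+1 => // i /=; rewrite in_itv/= -ler_norml.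
  apply: le_trans (ltW (truncnS_gt _)); rewrite /M (bigD1 i)//= lerDl.
  by rewrite sumr_ge0.
move=> k; split; first by apply: measurable_box.
rewrite lebesgue_tuple_box//; rewrite ltey_eq; apply/orP; left.
apply: prode_fin_num => i _.
by rewrite lebesgue_measure_itv/=; case: ifP.
Qed.

(** A named copy of the set function, to which the sigma-finiteness used by Tonelli's theorem is
    attached as an instance. *)
Definition leb_tuple n : set (n.-tuple mR) -> \bar R := lebesgue_tuple n.
Arguments leb_tuple : clear implicits.

HB.instance Definition _ n := Measure.copy (leb_tuple n) (@lebesgue_tuple R n).
HB.instance Definition _ n := @Measure_isSigmaFinite.Build _ _ R (leb_tuple n)
  (@sigma_finite_lebesgue_tuple n).

Lemma lebesgue_tupleS n (f : n.+1.-tuple mR -> \bar R) :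
  measurable_fun setT f -> (forall x, (0 <= f x)%E) ->
  (\int[lebesgue_tuple n.+1]_t f t =
   \int[leb_tuple n]_t \int[lambda]_s f [tuple of s :: t])%E.
Proof.
move=> mf f0; rewrite ge0_integral_image//.
have h := @fubini_tonelli1 _ _ _ _ R (leb_tuple n) lambda (f \o @cons_pair_tuple R n).
rewrite -[LHS]/(\int[leb_tuple n \x lambda]_z (f \o @cons_pair_tuple R n) z)%E.
rewrite h//; last by move=> x; exact: f0.
exact: (measurableT_comp mf (@measurable_cons_tuple R n)).
Qed.

Lemma measurable_section_tuple n (f : n.+1.-tuple mR -> \bar R) :
  measurable_fun setT f -> (forall x, (0 <= f x)%E) ->
  measurable_fun setT (fun t : n.-tuple mR => \int[lambda]_s f [tuple of s :: t])%E.
Proof.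
move=> mf f0.
have := @measurable_fun_fubini_tonelli_F _ _ _ _ R lambda (f \o @cons_pair_tuple R n).
apply; last by move=> x; exact: f0.
exact: (measurableT_comp mf (@measurable_cons_tuple R n)).
Qed.

(** The image of Lebesgue measure under translation has the same values on half-open intervals,
    which determine the measure. *)
Lemma lebesgue_translation (a : R) (f : mR -> \bar R) :
  measurable_fun setT f -> (forall x, (0 <= f x)%E) ->
  (\int[lambda]_s f ((s : R) + a)%R = \int[lambda]_s f s)%E.
Proof.
move=> mf f0.
have ma : measurable_fun setT (fun s : mR => (s : R) + a : mR) by exact: measurable_funD.
rewrite -(@ge0_integral_image _ _ _ _ lambda (fun s : mR => (s : R) + a : mR) ma f)//.
apply: eq_measure_integral => A mA _.
apply/esym; apply: lebesgue_measure_unique => // X [[c d] _ <-] /=.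
rewrite /pushforward (_ : _ @^-1` _ = `](c - a), (d - a)]%classic).
  rewrite !lebesgue_measure_itv/= !lte_fin ltrD2r.
  by case: ifP => // _; rewrite -!EFinB; congr _%:E; ring.
by apply/seteqP; split=> s /=; rewrite !in_itv/= ltrBlDr lerBrDr.
Qed.

Definition shift_tuple n (a : 'I_n -> R) (t : n.-tuple mR) : n.-tuple mR :=
  [tuple (tnth t i + a i) | i < n].

Lemma measurable_shift_tuple n (a : 'I_n -> R) : measurable_fun setT (shift_tuple a).
Proof.
apply/measurable_fun_tnthP => i.
rewrite (_ : _ \o _ = fun t => tnth t i + a i); last first.
  by apply/funext => t /=; rewrite tnth_mktuple.
by apply: measurable_funD => //; exact: measurable_tnth.
Qed.

(** Tonelli's theorem separates the head coordinate; it is translated by the one-dimensional case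
    and the tail by induction. *)
Lemma lebesgue_tuple_translation n (a : 'I_n -> R) (f : n.-tuple mR -> \bar R) :
  measurable_fun setT f -> (forall x, (0 <= f x)%E) ->
  (\int[lebesgue_tuple n]_t f (shift_tuple a t) = \int[lebesgue_tuple n]_t f t)%E.
Proof.
elim: n a f => [|n IH] a f mf f0.
  by apply: eq_integral => t _; congr f; apply: eq_from_tnth; case.
have mfa : measurable_fun setT (f \o shift_tuple a).
  exact: measurableT_comp (measurable_shift_tuple a).
rewrite [RHS]lebesgue_tupleS// (lebesgue_tupleS mfa (fun x => f0 _)).
rewrite -(IH (fun i => a (lift ord0 i)) (fun t : n.-tuple mR => \int[lambda]_s f [tuple of s :: t])%E).
- apply: eq_integral => t _.
  have ms (t' : n.-tuple mR) : measurable_fun setT (fun s : mR => f [tuple of s :: t']).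
    apply: (measurableT_comp mf).
    exact: (measurable_cons (@measurable_id _ _ setT) (@measurable_cst _ _ _ _ setT t')).
  rewrite -(lebesgue_translation (a ord0) (ms _) (fun s => f0 _)).
  apply: eq_integral => s _; rewrite /=; congr f; apply: eq_from_tnth => i.
  rewrite tnth_mktuple; case: (unliftP ord0 i) => [j|] ->; rewrite ?tnthS ?tnth0//.
  by rewrite tnth_mktuple.
- exact: measurable_section_tuple.
- by move=> t; apply: integral_ge0.
Qed.

End lebesgue_tuple.

Arguments leb_tuple {R} n _.

Section borel_functions.
Context {R : realType} (T : ptopologicalType).

Lemma measurable_open (U : set T) : open U -> measurable (U : set (borel T)).
Proof. exact: sub_sigma_algebra. Qed.

Lemma measurable_closed (U : set T) : closed U -> measurable (U : set (borel T)).
Proof.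
by move=> cU; rewrite -(setCK U); apply: measurableC; apply: measurable_open; exact: closed_openC.
Qed.

Lemma measurable_continuous (f : T -> R) :
  continuous f -> measurable_fun setT (f : borel T -> measurableTypeR R).
Proof.
move=> cf; apply: (measurability _ (RGenOInfty.measurableE R)) => //.
move=> _ [_ [a ->] <-]; rewrite setTI; apply: measurable_open.
apply: open_comp; last exact: interval_open.
by move=> x _; exact: cf.
Qed.

End borel_functions.

(* Locked: unfolding the integral makes unification intractable. *)
Fact Leb_key : unit. Proof. by []. Qed.

Section integral_rV.
Context {R : realType} {n : nat}.
Local Notation mR := (measurableTypeR R).
Local Notation rV := ('rV[R]_n).
Implicit Types (f g w : rV -> R) (x y : rV).
Local Notation leb := (@lebesgue_rV R n).

Definition bsupp f := exists r, forall x, f x != 0 -> `|x| <= r.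
(** The class in which all integrations take place: every member is integrable, and sums, products
    and translates remain inside. *)
Definition cc f := continuous f /\ bsupp f.
Definition Leb : (rV -> R) -> R := locked_with Leb_key (fun f => \int[leb]_x f x).

Lemma Leb_integral f : Leb f = \int[leb]_x f x.
Proof. by rewrite /Leb locked_withE. Qed.

Lemma lebesgue_closed_ball x r : 0 <= r ->
  leb [set y : rV | `|y - x| <= r] = ((r *+ 2) ^+ n)%:E.
Proof.
move=> r0.
transitivity (lebesgue_tuple n (box (fun i : 'I_n => `[x 0 i - r, x 0 i + r]%classic : set mR))).
  rewrite /lebesgue_rV /= /pushforward; congr (_ _).
  apply/seteqP; split=> t /=.
    move=> /(rV_norm_le _ r0) h i /=; have := h i.
    by rewrite !mxE in_itv/= ler_norml => /andP[? ?]; apply/andP; split; lra.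
  move=> h; apply/(rV_norm_le _ r0) => i; have := h i.
  by rewrite !mxE /= in_itv/= ler_norml => /andP[? ?]; apply/andP; split; lra.
rewrite lebesgue_tuple_box//.
rewrite (eq_bigr (fun=> (r *+ 2)%:E)).
  by rewrite prodEFin prodr_const card_ord.
move=> i _; rewrite lebesgue_measure_itv/= lte_fin.
case: ltP => [_|]; first by rewrite -EFinB; congr _%:E; rewrite mulr2n; ring.
rewrite lerBrDr -addrA gerDl => rr; have -> : r = 0 by apply/eqP; rewrite eq_le r0 andbT; lra.
by rewrite mul0rn.
Qed.

Lemma measurable_closed_ball x r : measurable ([set y : rV | `|y - x| <= r] : set (borel rV)).
Proof.
apply: measurable_closed; apply: compact_closed; first exact: norm_hausdorff.
exact: compact_closed_ball.
Qed.

Lemma cc_bound f : cc f -> exists2 B : R, 0 <= B & forall x, `|f x| <= B.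
Proof.
move=> [cf [r fr]].
have := compact_bounded (continuous_compact (continuous_subspaceT cf) (@compact_closed_ball R n 0 r)).
move=> [B [Br BP]]; exists (`|B| + 1); first by rewrite addr_ge0.
move=> x; have [->|fx] := eqVneq (f x) 0; first by rewrite normr0 addr_ge0.
apply: BP; first by rewrite (le_lt_trans (ler_norm _))// ltrDl.
by exists x => //=; rewrite subr0; exact: fr.
Qed.

Lemma integrable_cc f : cc f -> leb.-integrable setT (EFin \o f).
Proof.
move=> ccf; have [cf [r fr]] := ccf; have [B B0 fB] := cc_bound ccf.
have mB := measurable_closed_ball 0 `|r|.
have mf := measurable_continuous cf.
have -> : EFin \o f = (EFin \o f) \_ [set y : rV | `|y - 0| <= `|r|].
  apply/funext => x; rewrite patchE; case: ifPn => // /negP xr.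
  have [/= ->//|fx] := eqVneq (f x) 0; case: xr; rewrite inE /= subr0.
  by apply: le_trans (fr _ fx) _; exact: ler_norm.
apply: (integrable_mkcond _ mB).1; apply: measurable_bounded_integrable => //.
- by rewrite lebesgue_closed_ball// ltry.
- exact: measurable_funTS.
- exists B; split; first exact: num_real.
  by move=> M BM x _; exact: le_trans (fB x) (ltW BM).
Qed.

Lemma LebE f : cc f -> (\int[leb]_x (f x)%:E)%E = (Leb f)%:E.
Proof.
move=> ccf; rewrite !Leb_integral /Rintegral fineK//.
exact: integrable_fin_num (integrable_cc ccf).
Qed.

Lemma ccD f g : cc f -> cc g -> cc (fun x => f x + g x).
Proof.
move=> [cf [r fr]] [cg [s gs]]; split; first by move=> x; exact: (cvgD (cf x) (cg x)).
exists (Num.max r s) => x fgx; rewrite le_max.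
have [f0|/fr->//] := eqVneq (f x) 0.
by move: fgx; rewrite f0 add0r => /gs ->; rewrite orbT.
Qed.

Lemma ccM f g : cc f -> continuous g -> cc (fun x => f x * g x).
Proof.
move=> [cf [r fr]] cg; split; first by move=> x; exact: (cvgM (cf x) (cg x)).
by exists r => x; rewrite mulf_eq0 negb_or => /andP[/fr].
Qed.

Lemma ccMl f g : continuous f -> cc g -> cc (fun x => f x * g x).
Proof.
move=> cf cg; rewrite (_ : (fun x => _) = (fun x => g x * f x)); first exact: (ccM cg cf).
by apply/funext => x; rewrite mulrC.
Qed.

Lemma ccZ a f : cc f -> cc (fun x => a * f x).
Proof. by apply: (ccMl (f := cst a)); apply: cst_continuous. Qed.

Lemma ccN f : cc f -> cc (fun x => - f x).
Proof.
move=> /(ccZ (-1)); rewrite (_ : (fun x => -1 * f x) = (fun x => - f x))//.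
by apply/funext => x; rewrite mulN1r.
Qed.

Lemma ccB f g : cc f -> cc g -> cc (fun x => f x - g x).
Proof. by move=> cf /ccN; exact: ccD. Qed.

Lemma cc_norm f : cc f -> cc (fun x => `|f x|).
Proof.
move=> [cf [r fr]]; split; first by move=> x; exact: (cvg_norm (cf x)).
by exists r => x; rewrite normr_eq0 => /fr.
Qed.

Lemma cc_sqr f : cc f -> cc (fun x => f x ^+ 2).
Proof. by move=> ccf; exact: ccM ccf ccf.1. Qed.

Lemma cc_shift f a : cc f -> cc (fun x => f (x + a)).
Proof.
move=> [cf [r fr]]; split.
  move=> x; apply: (continuous_comp (f := fun x : rV => x + a) (g := f)); last exact: cf.
  exact: (cvgD cvg_id (cvg_cst _)).
exists (r + `|a|) => x /fr xr; rewrite -[x](addrK a).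
by apply: le_trans (ler_normB _ _) _; rewrite lerD2r.
Qed.

Lemma LebD f g : cc f -> cc g -> Leb (fun x => f x + g x) = Leb f + Leb g.
Proof. by move=> cf cg; rewrite !Leb_integral RintegralD//; exact: integrable_cc. Qed.

Lemma LebZ a f : cc f -> Leb (fun x => a * f x) = a * Leb f.
Proof. by move=> cf; rewrite !Leb_integral RintegralZl//; exact: integrable_cc. Qed.

Lemma LebN f : cc f -> Leb (fun x => - f x) = - Leb f.
Proof.
move=> cf; rewrite -mulN1r -LebZ//; congr Leb; apply/funext => x; by rewrite mulN1r.
Qed.

Lemma LebB f g : cc f -> cc g -> Leb (fun x => f x - g x) = Leb f - Leb g.
Proof. by move=> cf cg; rewrite LebD ?LebN//; exact: ccN. Qed.

Lemma Leb_ge0 f : (forall x, 0 <= f x) -> 0 <= Leb f.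
Proof. by move=> f0; rewrite Leb_integral; apply: Rintegral_ge0. Qed.

Lemma le_Leb f g : cc f -> cc g -> (forall x, f x <= g x) -> Leb f <= Leb g.
Proof. by move=> cf cg fg; rewrite !Leb_integral; apply: le_Rintegral => //; exact: integrable_cc. Qed.

Lemma Leb_norm f : cc f -> `|Leb f| <= Leb (fun x => `|f x|).
Proof. by move=> cf; rewrite !Leb_integral; apply: le_normr_Rintegral => //; exact: integrable_cc. Qed.

Lemma eq_Leb f g : f =1 g -> Leb f = Leb g.
Proof. by move=> /funext ->. Qed.

Lemma Leb0 : Leb (fun=> 0) = 0.
Proof. by rewrite !Leb_integral /Rintegral integral0. Qed.

Lemma lebesgue_rVE (f : borel rV -> \bar R) :
  measurable_fun setT f -> (forall x, (0 <= f x)%E) ->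
  (\int[leb]_x f x = \int[lebesgue_tuple n]_t (f \o @row_of_tuple R n) t)%E.
Proof. by move=> mf f0; exact: ge0_integral_image. Qed.

Lemma ge0_lebesgue_translation (a : rV) (f : borel rV -> \bar R) :
  measurable_fun setT f -> (forall x, (0 <= f x)%E) ->
  (\int[leb]_x f ((x : rV) + a)%R = \int[leb]_x f x)%E.
Proof.
move=> mf f0.
have mrow : measurable_fun setT (f \o @row_of_tuple R n).
  exact: (measurableT_comp mf (@measurable_row_of_tuple R n)).
have ma : measurable_fun setT (fun x : borel rV => ((x : rV) + a : borel rV)).
  have := @measurability _ _ (borel rV) (borel rV) setT (fun x => (x : rV) + a) (@open rV) erefl; apply.
  move=> _ [U oU <-]; rewrite setTI; apply: measurable_open.
  apply: open_comp => // x _.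
  exact: (cvgD cvg_id (cvg_cst _)).
have mfa : measurable_fun setT (fun x : borel rV => f ((x : rV) + a)) by exact: (measurableT_comp mf ma).
rewrite (lebesgue_rVE mfa)// (lebesgue_rVE mf f0).
have h := lebesgue_tuple_translation (fun i => a 0 i) mrow; rewrite -h; last by move=> t; exact: f0.
apply: eq_integral => t _ /=; congr f; apply/rowP => i.
by rewrite !mxE tnth_mktuple.
Qed.

Lemma Leb_translation a f : cc f -> Leb (fun x => f (x + a)) = Leb f.
Proof.
move=> ccf.
have pos g : cc g -> (forall x, 0 <= g x) -> Leb (fun x => g (x + a)) = Leb g.
  move=> cg g0; apply: EFin_inj; rewrite -!LebE//; last exact: cc_shift.
  apply: (ge0_lebesgue_translation a (f := EFin \o g)).
    by apply/measurable_EFinP; exact: measurable_continuous cg.1.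
  by move=> x; rewrite lee_fin.
(* Translation invariance is at hand for nonnegative integrands; both terms of this difference are
   nonnegative and remain continuous with bounded support. *)
have e : f = (fun x => (`|f x| + f x) - `|f x|) by apply/funext => x; ring.
have c1 : cc (fun x => `|f x|) := cc_norm ccf.
have c2 : cc (fun x => `|f x| + f x) := ccD c1 ccf.
rewrite [in RHS]e LebB// -(pos _ c1)// -(pos _ c2).
  by rewrite -LebB; [|exact: (cc_shift a c2)|exact: (cc_shift a c1)]; apply: eq_Leb => x; ring.
by move=> x; rewrite -lerBlDr sub0r -normrN; exact: ler_norm.
Qed.

End integral_rV.

(** * Test functions and their first-order Taylor estimates *)

Section test_functions.
Context {R : realType} {n : nat}.
Local Notation rV := ('rV[R]_n).
Implicit Types (f g w k : rV -> R) (x y : rV).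

Definition tf f := smooth_on setT f /\ bsupp f.

Lemma tf_cc f : tf f -> cc f.
Proof. by move=> [sf bf]; split=> // x; exact: (smooth_continuous sf). Qed.

Lemma tfD f g : tf f -> tf g -> tf (fun x => f x + g x).
Proof.
move=> tff tfg; split; last exact: (ccD (tf_cc tff) (tf_cc tfg)).2.
by case: tff tfg => ? _ [? _]; apply: smoothD => //; exact: openT.
Qed.

Lemma tfM f g : tf f -> smooth_on setT g -> tf (fun x => f x * g x).
Proof.
move=> [sf [r fr]] sg; split; first by apply: smoothM => //; exact: openT.
by exists r => x; rewrite mulf_eq0 negb_or => /andP[/fr].
Qed.

Lemma tfMl f g : smooth_on setT f -> tf g -> tf (fun x => f x * g x).
Proof.
move=> sf [sg [r gr]]; split; first by apply: smoothM => //; exact: openT.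
by exists r => x; rewrite mulf_eq0 negb_or => /andP[_ /gr].
Qed.

Lemma tfZ a f : tf f -> tf (fun x => a * f x).
Proof. by apply: tfMl; exact: smooth_cst. Qed.

Lemma tfN f : tf f -> tf (fun x => - f x).
Proof.
move=> /(tfZ (-1)); rewrite (_ : (fun x => -1 * f x) = (fun x => - f x))//.
by apply/funext => x; rewrite mulN1r.
Qed.

Lemma tfB f g : tf f -> tf g -> tf (fun x => f x - g x).
Proof. by move=> tff /tfN; exact: tfD. Qed.

Lemma tf0 : tf (fun=> 0).
Proof. by split; [exact: smooth_cst|exists 0 => x; rewrite eqxx]. Qed.

Lemma tf_sum (I : Type) (s : seq I) (F : I -> rV -> R) :
  (forall i, tf (F i)) -> tf (fun x => \sum_(i <- s) F i x).
Proof.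
move=> tfF; elim: s => [|i s IH].
  rewrite (_ : (fun x => _) = fun=> 0); first exact: tf0.
  by apply/funext => x; rewrite big_nil.
rewrite (_ : (fun x => _) = fun x => F i x + \sum_(i <- s) F i x); first exact: tfD.
by apply/funext => x; rewrite big_cons.
Qed.

Lemma partial_supp f (C : set rV) j x : closed C -> (forall x, f x != 0 -> C x) ->
  partial j f x != 0 -> C x.
Proof.
move=> cC fC; apply: contra_neqP => Cx.
have oC : open (~` C) by exact: closed_openC.
rewrite (partial_ext (g := cst 0) j oC _ Cx); first exact: derive_cst.
by move=> y Cy; apply/eqP/negPn/negP => /fC.
Qed.

Lemma closed_norm_ball x (r : R) : closed [set y : rV | `|y - x| <= r].
Proof. by apply: compact_closed; [exact: norm_hausdorff|exact: compact_closed_ball]. Qed.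

Lemma tf_partial f j : tf f -> tf (partial j f).
Proof.
move=> [sf [r fr]]; split; first exact: smooth_partial.
exists r => x fx; rewrite -[x]subr0.
apply: (partial_supp (@closed_norm_ball 0 r) _ fx) => y /=.
by rewrite subr0; exact: fr.
Qed.

Lemma smooth_shift f a : smooth_on setT f -> smooth_on setT (fun x => f (x + a)).
Proof.
move=> sf; apply: (smooth_comp (f := f) (G := fun x => x + a) openT openT) => //.
move=> m; apply: Ck_rV => [|i]; first exact: openT.
rewrite (_ : (fun x => _) = fun x : rV => x 0 i + a 0 i).
  by apply: CkD; [exact: openT|exact: Ck_coord|exact: (Ck_cst _ _ (a 0 i))].
by apply/funext => x; rewrite mxE.
Qed.

Lemma tf_shift f a : tf f -> tf (fun x => f (x + a)).
Proof.
by move=> tff; split; [apply: smooth_shift; exact: tff.1|exact: (cc_shift a (tf_cc tff)).2].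
Qed.

Lemma partialM f g j x : smooth_on setT f -> smooth_on setT g ->
  partial j (fun x => f x * g x) x = partial j f x * g x + f x * partial j g x.
Proof.
move=> sf sg; rewrite /partial deriveM; [|exact: (smooth_derivable sf I)|exact: (smooth_derivable sg I)].
by rewrite addrC; congr (_ + _); exact: mulrC.
Qed.

Lemma partial_shift f a j x : partial j (fun x => f (x + a)) x = partial j f (x + a).
Proof.
rewrite /partial /derive (_ : (fun h => _) = fun h : R =>
  h^-1 *: ((f \o shift (x + a)) (h *: delta_mx 0 j) - f (x + a)))//.
by apply/funext => h; rewrite /= addrA.
Qed.

Lemma mvt_line f (j : 'I_n) x (h : R) : smooth_on setT f -> exists2 c, `|c| <= `|h| &
  f (h *: delta_mx 0 j + x) - f x = h * partial j f (c *: delta_mx 0 j + x).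
Proof.
move=> sf; pose g s := f (s *: delta_mx 0 j + x).
have dg (s : R) : is_derive s (1 : R) g (partial j f (s *: delta_mx 0 j + x)).
  by apply: is_derive_line; exact: (smooth_derivable sf I).
have cg (I : set R) : {within I, continuous g}.
  apply: continuous_subspaceT => s; apply/differentiable_continuous/derivable1_diffP.
  by have [] := dg s.
have -> : f x = g 0 by rewrite /g scale0r add0r.
have [h0|h0] := leP 0 h.
  have [c cI e] := MVT_segment h0 (fun s _ => dg s) (cg _).
  exists c; last by rewrite e subr0 mulrC.
  by move: cI; rewrite in_itv/= => /andP[c0 ch]; rewrite !ger0_norm.
have [c cI e] := MVT_segment (ltW h0) (fun s _ => dg s) (cg _).
exists c; last by rewrite -opprB e sub0r mulrN opprK mulrC.
move: cI; rewrite in_itv/= => /andP[hc c0].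
by rewrite !ler0_norm ?lerN2// ltW.
Qed.

Lemma tf_lipschitz f : tf f -> exists2 B : R, 0 <= B & forall x y, `|f x - f y| <= B * `|x - y|.
Proof.
move=> tff.
have /choice[b bP] : forall j, exists b : R, 0 <= b /\ forall x, `|partial j f x| <= b.
  by move=> j; have [b b0 bf] := cc_bound (tf_cc (tf_partial j tff)); exists b.
pose B := \sum_j b j.
have bB j : b j <= B.
  by rewrite /B (bigD1 j)//= lerDl sumr_ge0// => i _; have [] := bP i.
have B0 : 0 <= B by apply: sumr_ge0 => i _; have [] := bP i.
exists (n%:R * B) => [|x y]; first by rewrite mulr_ge0.
apply: (lipschitz_ball (x := y) (d := `|x - y| + 1)).
- move=> z _ i; split; first exact: (smooth_derivable tff.1 I).
  by apply: le_trans (bB i); have [] := bP i.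
- by rewrite ltrDl.
- by rewrite subrr normr0 ltr_wpDl.
Qed.

(** The mean value theorem turns the remainder into [h] times a difference of values of
    [partial j f] at points at distance at most [|h|], and that derivative is Lipschitz. The bound
    is uniform in [x]. *)
Lemma tf_taylor f j : tf f -> exists2 B : R, 0 <= B & forall x (h : R),
  `|f (h *: delta_mx 0 j + x) - f x - h * partial j f x| <= B * h ^+ 2.
Proof.
move=> tff; have [B B0 fB] := tf_lipschitz (tf_partial j tff).
exists B => // x h; have [c ch ->] := mvt_line j x h tff.1.
rewrite -mulrBr normrM -(real_normK (num_real h)) expr2 mulrCA; apply: ler_wpM2l => //.
apply: le_trans (fB _ _) _; apply: ler_wpM2l => //.
rewrite addrK normrZ.
apply: le_trans ch; rewrite -[leRHS]mulr1; apply: ler_wpM2l => //.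
exact: norm_delta.
Qed.

End test_functions.

(** * Smoothness of the pairing of a functional with translates of a kernel *)

Section smooth_pairing.
Context {R : realType} {n : nat}.
Local Notation rV := ('rV[R]_n).
Implicit Types (f g w k : rV -> R) (x y : rV).

(** Linearity and sup-norm continuity on test functions. One smoothness proof then serves both
    integration against a function and the limit functional of a Cauchy sequence, for which no
    representing function is at hand. *)
Definition bounded_functional (L : (rV -> R) -> R) (B : R) :=
  [/\ 0 <= B, forall a f g, tf f -> tf g -> L (fun y => a * f y + g y) = a * L f + L g
    & forall f (s : R), tf f -> (forall y, `|f y| <= s) -> `|L f| <= B * s].

Variables (L : (rV -> R) -> R) (B : R).
Hypothesis LB : bounded_functional L B.

Lemma pairing_continuous k x : tf k -> {for x, continuous (fun x => L (fun y => k (y - x)))}.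
Proof.
have [B0 Ladd Lbd] := LB => tk; have [C C0 kC] := tf_lipschitz tk.
(* The summand 1 keeps the divisor positive when the bound vanishes; the same device recurs in later
   estimates. *)
apply/(@cvgrPdist_lt _ _ _ (nbhs x)) => e e0; have BC : 0 < B * C + 1 by rewrite ltr_wpDl// mulr_ge0.
suff h : \forall x' \near x, `|L (fun y => k (y - x)) - L (fun y => k (y - x'))| < e by exact: h.
apply/nbhs_normP; exists (e / (B * C + 1)) => /= [|x' xx']; first by rewrite divr_gt0.
have -> : L (fun y => k (y - x)) - L (fun y => k (y - x')) =
    L (fun y => -1 * k (y - x') + k (y - x)).
  by rewrite Ladd; [ring|exact: tf_shift|exact: tf_shift].
have s1 y : `|-1 * k (y - x') + k (y - x)| <= C * `|x - x'|.
  rewrite mulN1r addrC; apply: le_trans (kC _ _) _.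
  rewrite (_ : y - x - (y - x') = - (x - x')) ?normrN//.
  by apply/rowP => i; rewrite !mxE; ring.
have := Lbd _ _ (tfD (tfZ (-1) (tf_shift (- x') tk)) (tf_shift (- x) tk)) s1.
move=> /le_lt_trans; apply.
rewrite mulrA; apply: le_lt_trans (_ : (B * C + 1) * `|x - x'| < _).
  by rewrite ler_wpM2r// lerDl.
by rewrite mulrC -ltr_pdivlMr.
Qed.

(** The Taylor remainder of the kernel is [O(h ^+ 2)] uniformly in [y], so [L] may be applied to it
    and divided by [h]. The minus sign comes from the argument [y - x]. *)
Lemma is_derive_pairing k j x : tf k ->
  is_derive x (delta_mx 0 j) (fun x => L (fun y => k (y - x)))
    (L (fun y => - partial j k (y - x))).
Proof.
have [B0 Ladd Lbd] := LB => tk; have [C C0 kC] := tf_taylor j tk.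
set F := fun x => _; set d := L _.
suff cv : (fun h : R => h^-1 *: ((F \o shift x) (h *: delta_mx 0 j) - F x)) @ 0^' --> d.
  by apply: DeriveDef; [apply/cvg_ex; exists d|rewrite /derive (cvg_lim _ cv)].
apply/cvgrPdist_lt => e e0; have BC : 0 < B * C + 1 by rewrite ltr_wpDl// mulr_ge0.
have eBC : 0 < e / (B * C + 1) by rewrite divr_gt0.
near=> h; have h0 : h != 0 by near: h; exact: nbhs_dnbhs_neq.
set v : rV := h *: delta_mx 0 j.
have t1 : tf (fun y => k (y - (v + x))) by exact: tf_shift.
have t2 : tf (fun y => k (y - x)) by exact: tf_shift.
have t3 : tf (fun y => - partial j k (y - x)) by apply: tfN; apply: tf_shift; exact: tf_partial.
have -> : d - h^-1 *: ((F \o shift x) v - F x) = - (h^-1 *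
    L (fun y => (- h) * (- partial j k (y - x)) + (-1 * k (y - x) + k (y - (v + x))))).
  rewrite !Ladd//; last exact: (tfD (tfZ _ t2) t1).
  by rewrite /= /F /d [h^-1 *: _]mulrDr; field.
rewrite normrN normrM normfV.
have s1 y : `|(- h) * (- partial j k (y - x)) + (-1 * k (y - x) + k (y - (v + x)))| <= C * h ^+ 2.
  have := kC (y - x) (- h); rewrite sqrrN; congr (`|_| <= _).
  rewrite (_ : (- h) *: delta_mx 0 j + (y - x) = y - (v + x)); last first.
    by rewrite scaleNr opprD addrC addrAC addrA.
  ring.
have := Lbd _ _ (tfD (tfZ (- h) t3) (tfD (tfZ (-1) t2) t1)) s1.
have hi : 0 < `|h|^-1 by rewrite invr_gt0 normr_gt0.
rewrite -(ler_pM2l hi) => /le_lt_trans; apply.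
rewrite (_ : `|h|^-1 * _ = B * C * `|h|); last first.
  by rewrite -real_normK ?num_real//; field; rewrite normr_eq0.
apply: le_lt_trans (_ : (B * C + 1) * `|h| < _); first by rewrite ler_wpM2r// lerDl.
by rewrite mulrC -ltr_pdivlMr//; near: h; exact: dnbhs0_lt.
Unshelve. all: by end_near. Qed.

Lemma partial_pairing k j x : tf k ->
  partial j (fun x => L (fun y => k (y - x))) x = L (fun y => - partial j k (y - x)).
Proof. by move=> tk; have [_] := is_derive_pairing j x tk. Qed.

Lemma smooth_pairing k : tf k -> smooth_on setT (fun x => L (fun y => k (y - x))).
Proof.
move=> tk m; elim: m k tk => [|m IH] k tk; split=> //.
- by move=> x _; exact: pairing_continuous.
- by move=> x _; exact: pairing_continuous.
- move=> j; split=> [x _|]; first by have [] := is_derive_pairing j x tk.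
  rewrite (_ : partial j _ = fun x => L (fun y => - partial j k (y - x))).
    by apply: (IH (fun z => - partial j k z)); apply: tfN; exact: tf_partial.
  by apply/funext => x; exact: partial_pairing.
Qed.

End smooth_pairing.

(** * Convolution and mollifiers *)

Section convolution.
Context {R : realType} {n : nat}.
Local Notation mR := (measurableTypeR R).
Local Notation rV := ('rV[R]_n).
Local Notation leb := (@lebesgue_rV R n).
Implicit Types (f g w k : rV -> R) (x y : rV).

(** The kernel is evaluated at [y - x], so a derivative in [x] falls on it with a minus sign, and
    substitution gives the integral of [k z * w (z + x)]. *)
Definition conv k w x : R := Leb (fun y => k (y - x) * w y).

Lemma partial_ball_supp f x0 (r : R) j x : (forall x, f x != 0 -> `|x - x0| <= r) ->
  partial j f x != 0 -> `|x - x0| <= r.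
Proof. by move=> fr fx; have := partial_supp (@closed_norm_ball R n x0 r) fr fx. Qed.

Lemma conv_cc k w x : tf k -> continuous w -> cc (fun y => k (y - x) * w y).
Proof. by move=> tk cw; apply: ccM => //; apply: tf_cc; exact: tf_shift. Qed.

Lemma Leb_pairing w : cc w ->
  bounded_functional (fun f => Leb (fun y => f y * w y)) (Leb (fun y => `|w y|)).
Proof.
move=> cw; have h f : tf f -> cc (fun y => f y * w y) by move=> /tf_cc [cf _]; exact: ccMl.
split=> [|a f g tff tfg|f s tff fs].
- exact: Leb_ge0.
- rewrite -LebZ; last exact: h.
  rewrite -LebD; [|by apply: ccZ; exact: h|exact: h].
  by apply: eq_Leb => y; ring.
- apply: le_trans (Leb_norm (h _ tff)) _; rewrite mulrC -LebZ; last exact: cc_norm.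
  apply: le_Leb; [exact: (cc_norm (h _ tff))|by apply: ccZ; exact: cc_norm|].
  by move=> y; rewrite normrM ler_wpM2r.
Qed.

Lemma smooth_conv k w : tf k -> cc w -> smooth_on setT (conv k w).
Proof. by move=> tk cw; exact: (smooth_pairing (Leb_pairing cw) tk). Qed.

Lemma partial_conv k w j x : tf k -> cc w ->
  partial j (conv k w) x = Leb (fun y => - partial j k (y - x) * w y).
Proof. by move=> tk cw; exact: (partial_pairing (Leb_pairing cw) j x tk). Qed.

Lemma conv_supp k w (x0 : rV) (r t : R) x : (forall z, k z != 0 -> `|z| <= t) ->
  (forall y, w y != 0 -> `|y - x0| <= r) -> conv k w x != 0 -> `|x - x0| <= r + t.
Proof.
move=> kt wr; apply: contra_neqT => xr; rewrite /conv.
rewrite (_ : (fun y => _) = fun=> 0); first exact: Leb0.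
apply/funext => y; apply/eqP; rewrite mulf_eq0 -[_ || _]negbK negb_or.
apply/negP => /andP[/kt k1 /wr w1]; move/negP: xr; apply.
rewrite (_ : x - x0 = (y - x0) - (y - x)); last by apply/rowP => i; rewrite !mxE; ring.
by apply: le_trans (ler_normB _ _) _; exact: lerD.
Qed.

Lemma convE k w x : tf k -> continuous w -> conv k w x = Leb (fun z => k z * w (z + x)).
Proof.
move=> tk cw; rewrite /conv -(Leb_translation x (conv_cc x tk cw)).
by apply: eq_Leb => z; rewrite addrK.
Qed.

(** By translation invariance the integral of [g (x + h e_j) - g x] is 0. Hence [h] times the
    integral in question is, up to sign, the integral of a Taylor remainder of size [h ^+ 2] over a
    fixed ball; small [h] forces it to vanish. *)
Lemma Leb_partial g j : tf g -> Leb (partial j g) = 0.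
Proof.
move=> tg; have [B B0 gB] := tf_taylor j tg.
have [sg [r gr]] := tg.
(* [b] is 1 on the support of [g] and on its translates by steps of length at most 1, so
   [B * h ^+ 2 * b] dominates the remainder everywhere. *)
pose b := bumpf (0%R : rV) (`|r| + 1) (`|r| + 2).
have r0 : 0 <= `|r| + 1 < `|r| + 2 by rewrite addr_ge0//= ltrD2l ltr1n.
have tb : tf b.
  split; first exact: smooth_bumpf.
  by exists (`|r| + 2) => x /(bumpf_supp r0); rewrite subr0 => /ltW.
have key (h : R) : 0 < h -> h <= 1 -> `|Leb (partial j g)| <= B * Leb b * h.
  move=> h0 h1.
  have e : h * Leb (partial j g) =
     - Leb (fun x => g (x + h *: delta_mx 0 j) - g x - h * partial j g x).
    have c1 := tf_cc (tf_shift (h *: delta_mx 0 j) tg).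
    have c2 := tf_cc tg; have c3 := tf_cc (tf_partial j tg).
    rewrite (LebB (ccB c1 c2) (ccZ h c3)) (LebB c1 c2) (Leb_translation _ c2) (LebZ _ c3).
    by ring.
  have : `|h * Leb (partial j g)| <= B * h ^+ 2 * Leb b.
    rewrite e normrN; apply: le_trans (Leb_norm _) _.
      apply: ccB; last by apply: ccZ; exact: tf_cc (tf_partial j tg).
      by apply: ccB; [apply: tf_cc; exact: tf_shift|exact: tf_cc].
    rewrite -LebZ; last exact: tf_cc.
    apply: le_Leb; [|by apply: ccZ; exact: tf_cc|].
      apply: cc_norm; apply: ccB; last by apply: ccZ; exact: tf_cc (tf_partial j tg).
      by apply: ccB; [apply: tf_cc; exact: tf_shift|exact: tf_cc].
    move=> x; have [xr|xr] := leP `|x| (`|r| + 1).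
      by rewrite /b bumpf_eq1 ?subr0// mulr1 (addrC x); exact: gB.
    have gx : g x = 0.
      apply/eqP/negPn/negP => /gr gx; have := le_lt_trans (ler_norm r) (_ : `|r| < `|r| + 1).
      by rewrite ltrDl => /(_ ltr01)/lt_trans/(_ xr); rewrite ltNge gx.
    have dgx : partial j g x = 0.
      apply/eqP/negPn/negP => dgx.
      have gr0 y : g y != 0 -> `|y - 0| <= r by rewrite subr0; exact: gr.
      have := partial_ball_supp gr0 dgx; rewrite subr0 => gx'.
      have := le_lt_trans (ler_norm r) (_ : `|r| < `|r| + 1).
      by rewrite ltrDl => /(_ ltr01)/lt_trans/(_ xr); rewrite ltNge gx'.
    have gxh : g (x + h *: delta_mx 0 j) = 0.
      apply/eqP/negPn/negP => /gr gxh.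
      have : `|x| <= r + h.
        rewrite -[x](addrK (h *: delta_mx 0 j)); apply: le_trans (ler_normB _ _) _.
        apply: lerD => //; rewrite normrZ gtr0_norm//.
        by rewrite -[leRHS]mulr1 ler_wpM2l ?norm_delta// ltW.
      by rewrite leNgt => /negP; apply; apply: le_lt_trans xr; rewrite lerD// ler_norm.
    rewrite gx dgx gxh mulr0 !subr0 normr0; apply: mulr_ge0; last exact: bumpf_ge0.
    by rewrite mulr_ge0// sqr_ge0.
  rewrite normrM gtr0_norm// expr2 (_ : B * (h * h) * Leb b = h * (B * Leb b * h)); last by ring.
  by rewrite ler_pM2l.
have b0 : 0 <= B * Leb b by rewrite mulr_ge0// Leb_ge0// => x; exact: bumpf_ge0.
apply/eqP; rewrite -normr_le0 leNgt; apply/negP => L0.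
(* A step so small that the bound falls to at most half of the supposedly nonzero value. *)
pose h := Num.min 1 (`|Leb (partial j g)| / 2 / (B * Leb b + 1)).
have h0 : 0 < h by rewrite lt_min ltr01/= !divr_gt0// ltr_wpDl.
have h1 : h <= 1 by rewrite ge_min lexx.
have := key h h0 h1; rewrite leNgt => /negP; apply.
apply: le_lt_trans (_ : (B * Leb b + 1) * h < _).
  by rewrite ler_pM2r// lerDl.
rewrite mulrC -ltr_pdivlMr; last by rewrite ltr_wpDl.
apply: le_lt_trans (_ : `|Leb (partial j g)| / 2 / (B * Leb b + 1) < _).
  by rewrite /h ge_min lexx orbT.
by rewrite ltr_pM2r ?invr_gt0 ?ltr_wpDl// ltr_pdivrMr// mulr2n mulrDr mulr1 ltrDl.
Qed.

Lemma quadratic_ge0 (a b c : R) : 0 <= a ->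
  (forall s : R, 0 <= c - 2 * s * b + s ^+ 2 * a) -> b ^+ 2 <= a * c.
Proof.
move=> a0 q; have [a1|a1] := eqVneq a 0.
  have [->|b0] := eqVneq b 0; first by rewrite expr0n a1 mul0r.
  (* For [a = 0] and [b != 0] the expression is affine in [s], and this argument gives it the value
     -1. *)
  have := q ((c + 1) / (2 * b)); rewrite a1 mulr0 addr0.
  rewrite (_ : c - _ = -1); last by field.
  by rewrite oppr_ge0 ler10.
have ap : 0 < a by rewrite lt_def a1.
have := q (b / a); rewrite (_ : c - _ + _ = c - b ^+ 2 / a); last by field.
by rewrite subr_ge0 ler_pdivrMr// mulrC.
Qed.

Lemma Leb_CS f g : cc f -> cc g ->
  Leb (fun x => f x * g x) ^+ 2 <= Leb (fun x => f x ^+ 2) * Leb (fun x => g x ^+ 2).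
Proof.
move=> cf cg; apply: quadratic_ge0 => [|s]; first by apply: Leb_ge0 => x; exact: sqr_ge0.
have c1 := cc_sqr cf; have c2 := cc_sqr cg; have c3 := ccM cf cg.1.
rewrite -LebZ// -LebZ// -LebB//; last exact: ccZ.
rewrite -LebD; [|by apply: ccB => //; exact: ccZ|exact: ccZ].
apply: Leb_ge0 => x; rewrite (_ : _ + _ = (g x - s * f x) ^+ 2) ?sqr_ge0//; ring.
Qed.

(** Cauchy-Schwarz for the weight [k], from the nonnegative quadratic in [s] given by the integral
    of [k * (w - s) ^+ 2]. *)
Lemma Leb_jensen k w : cc k -> continuous w -> (forall x, 0 <= k x) ->
  Leb (fun x => k x * w x) ^+ 2 <= Leb k * Leb (fun x => k x * w x ^+ 2).
Proof.
move=> ck cw k0; apply: quadratic_ge0 => [|s]; first exact: Leb_ge0.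
have c1 := ccM ck cw.
have c2 : cc (fun x => k x * w x ^+ 2).
  by apply: ccM => // x; exact: (cvgM (cw x) (cw x)).
rewrite -LebZ// -LebZ// -LebB//; last exact: ccZ.
rewrite -LebD; [|by apply: ccB => //; exact: ccZ|exact: ccZ].
apply: Leb_ge0 => x; rewrite (_ : _ + _ = k x * (w x - s) ^+ 2); last by ring.
by rewrite mulr_ge0// sqr_ge0.
Qed.

Lemma tf_conv k w : tf k -> cc w -> tf (conv k w).
Proof.
move=> tk cw; split; first exact: smooth_conv.
have [_ [t kt]] := tk; have [_ [r wr]] := cw.
exists (r + t) => x cx; rewrite -[x]subr0; apply: (conv_supp kt _ cx) => y.
by rewrite subr0; exact: wr.
Qed.

Definition add_tuple (p : n.-tuple mR * n.-tuple mR) : n.-tuple mR :=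
  [tuple ((tnth p.1 i : R) + (tnth p.2 i : R) : mR) | i < n].

Lemma measurable_add_tuple : measurable_fun setT add_tuple.
Proof.
apply/measurable_fun_tnthP => i.
rewrite (_ : _ \o _ = fun p : n.-tuple mR * n.-tuple mR => (tnth p.1 i : R) + (tnth p.2 i : R) : mR).
  apply: measurable_funD.
    exact: (measurableT_comp (measurable_tnth i) measurable_fst).
  exact: (measurableT_comp (measurable_tnth i) measurable_snd).
by apply/funext => t /=; rewrite tnth_mktuple.
Qed.

(** After the substitution [z = y - x] Tonelli's theorem exchanges the integrals, and translation
    invariance evaluates the inner one. The computation is done on tuples, where the product measure
    lives. *)
Lemma Leb_conv k g : tf k -> tf g -> (forall x, 0 <= k x) -> (forall x, 0 <= g x) ->
  Leb (conv k g) = Leb k * Leb g.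
Proof.
move=> tk tg k0 g0; apply: EFin_inj.
have ck := tf_cc tk; have cg := tf_cc tg.
have mk : measurable_fun setT (k : borel rV -> mR) := measurable_continuous ck.1.
have mg : measurable_fun setT (g : borel rV -> mR) := measurable_continuous cg.1.
rewrite -LebE; last by apply: tf_cc; exact: tf_conv.
have mrow := @measurable_row_of_tuple R n.
have E f : cc f -> (forall x, 0 <= f x) ->
    (Leb f)%:E = (\int[leb_tuple n]_t (f (row_of_tuple t))%:E)%E.
  move=> cf f0; rewrite -LebE//.
  apply: (lebesgue_rVE (f := EFin \o f)); last by move=> x; rewrite lee_fin.
  by apply/measurable_EFinP; exact: measurable_continuous cf.1.
rewrite LebE; last by apply: tf_cc; exact: tf_conv.
rewrite E; [|by apply: tf_cc; exact: tf_conv|].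
  2: by move=> x; apply: Leb_ge0 => y; rewrite mulr_ge0.
pose F (p : n.-tuple mR * n.-tuple mR) : \bar R :=
  (k (row_of_tuple p.2) * g (row_of_tuple (add_tuple p)))%:E.
have mF : measurable_fun setT F.
  apply/measurable_EFinP; apply: measurable_funM.
    exact: (measurableT_comp mk (measurableT_comp mrow measurable_snd)).
  exact: (measurableT_comp mg (measurableT_comp mrow measurable_add_tuple)).
have F0 p : (0 <= F p)%E by rewrite lee_fin mulr_ge0.
have rowD t s : row_of_tuple (add_tuple (t, s)) = row_of_tuple s + row_of_tuple t :> rV.
  by apply/rowP => i; rewrite !mxE tnth_mktuple addrC.
transitivity (\int[leb_tuple n]_t \int[leb_tuple n]_s F (t, s))%E.
  apply: eq_integral => t _; rewrite convE//; last exact: cg.1.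
  rewrite E.
  - by apply: eq_integral => s _; rewrite /F /= rowD.
  - by apply: ccM => //; exact: (cc_shift (row_of_tuple t) cg).1.
  - by move=> z; rewrite mulr_ge0.
have := @fubini_tonelli _ _ _ _ R (leb_tuple n) (leb_tuple n) F mF F0.
move=> ->.
transitivity (\int[leb_tuple n]_s ((Leb g)%:E * (k (row_of_tuple s))%:E))%E.
  apply: eq_integral => s _.
  transitivity (k (row_of_tuple s) * Leb g)%:E; last by rewrite mulrC EFinM.
  rewrite -(Leb_translation (row_of_tuple s) cg) -LebZ; last exact: cc_shift.
  rewrite E.
  - by apply: eq_integral => t _; rewrite /F /= rowD addrC.
  - by apply: ccZ; exact: cc_shift.
  - by move=> z; rewrite mulr_ge0.
rewrite ge0_integralZl//.
- by rewrite -E// -EFinM mulrC.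
- by apply/measurable_EFinP; exact: (measurableT_comp mk mrow).
- by move=> s _; rewrite lee_fin.
- by rewrite lee_fin Leb_ge0.
Qed.

(** Schur's test for a translation-invariant majorant. The weighted Cauchy-Schwarz inequality yields
    one factor [Leb k] pointwise, and integrating the convolution of [k] with [w ^+ 2] yields the
    other. *)
Lemma schur_bound k w f : tf k -> tf w -> cc f -> (forall x, 0 <= k x) ->
  (forall x, `|f x| <= Leb (fun y => k (y - x) * `|w y|)) ->
  Leb (fun x => f x ^+ 2) <= Leb k ^+ 2 * Leb (fun x => w x ^+ 2).
Proof.
move=> tk tw cf k0 fk.
have tw2 : tf (fun x => w x ^+ 2) := tfM tw tw.1.
have c1 : cc (fun x => Leb k * conv k (fun x => w x ^+ 2) x).
  by apply: ccZ; apply: tf_cc; apply: tf_conv => //; exact: tf_cc.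
apply: le_trans (_ : Leb (fun x => Leb k * conv k (fun x => w x ^+ 2) x) <= _).
  apply: le_Leb => // [|x]; first exact: cc_sqr.
  rewrite -real_normK ?num_real//.
  apply: le_trans (_ : Leb (fun y => k (y - x) * `|w y|) ^+ 2 <= _).
    by rewrite lerXn2r// nnegrE// Leb_ge0// => y; rewrite mulr_ge0.
  have := @Leb_jensen (fun y => k (y - x)) (fun y => `|w y|).
  rewrite (Leb_translation (- x) (tf_cc tk)) /conv.
  rewrite (_ : (fun y => k (y - x) * `|w y| ^+ 2) = fun y => k (y - x) * w y ^+ 2).
    apply=> // [|]; first by apply: tf_cc; exact: tf_shift.
    exact: (cc_norm (tf_cc tw)).1.
  by apply/funext => y; rewrite real_normK ?num_real.
rewrite LebZ; last by apply: tf_cc; apply: tf_conv => //; exact: tf_cc.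
by rewrite Leb_conv//; [rewrite expr2 mulrA|move=> x; exact: sqr_ge0].
Qed.

End convolution.

Section ball_integrals.
Context {R : realType} {n : nat}.
Local Notation rV := ('rV[R]_n).
Local Notation leb := (@lebesgue_rV R n).
Implicit Types (f : rV -> R) (x : rV) (c r : R).

Lemma integral_ball x r c : 0 <= r -> 0 <= c ->
  (\int[leb]_y (c * \1_[set y : rV | `|y - x| <= r]%R y)%:E = (c * (r *+ 2) ^+ n)%:E)%E.
Proof.
move=> r0 c0; under eq_integral do rewrite EFinM.
rewrite ge0_integralZl//.
- rewrite integral_indic//; last exact: measurable_closed_ball.
  by rewrite setIT lebesgue_closed_ball.
- apply/measurable_EFinP; apply: measurable_indic; exact: measurable_closed_ball.
Qed.

Lemma Leb_ge_ball f x r c : cc f -> 0 <= r -> 0 <= c -> (forall y, 0 <= f y) ->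
  (forall y, `|y - x| <= r -> c <= f y) -> c * (r *+ 2) ^+ n <= Leb f.
Proof.
move=> cf r0 c0 f0 cfr; rewrite -lee_fin -LebE// -(integral_ball x)//.
apply: ge0_le_integral => //.
- by move=> y _; rewrite lee_fin mulr_ge0.
- apply/measurable_EFinP; apply: measurable_funM => //.
  apply: measurable_indic; exact: measurable_closed_ball.
- by apply/measurable_EFinP; exact: measurable_continuous cf.1.
- move=> y _; rewrite lee_fin indicE; case: (boolP (y \in _)) => [|_].
    by rewrite inE /= mulr1; exact: cfr.
  by rewrite mulr0.
Qed.

Lemma Leb_le_ball f x r c : cc f -> 0 <= r -> (forall y, 0 <= f y <= c) ->
  (forall y, f y != 0 -> `|y - x| <= r) -> Leb f <= c * (r *+ 2) ^+ n.
Proof.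
move=> cf r0 fc fr; have f0 y : 0 <= f y by have /andP[] := fc y.
have c0 : 0 <= c by have /andP[/le_trans h /h] := fc x.
rewrite -lee_fin -LebE// -(integral_ball x)//.
apply: ge0_le_integral => //.
- by move=> y _; rewrite lee_fin.
- by apply/measurable_EFinP; exact: measurable_continuous cf.1.
- apply/measurable_EFinP; apply: measurable_funM => //.
  apply: measurable_indic; exact: measurable_closed_ball.
- move=> y _; rewrite lee_fin indicE; have [-> |fy] := eqVneq (f y) 0.
    by rewrite mulr_ge0.
  by rewrite mem_set ?mulr1; [have /andP[] := fc y|exact: fr].
Qed.

End ball_integrals.

(** * The mollifier, its majorant and Friedrichs' estimate *)

Fact moll_key : unit. Proof. by []. Qed.

Section mollifier.
Context {R : realType} {n : nat}.
Local Notation rV := ('rV[R]_n).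
Implicit Types (f g w k a : rV -> R) (x y z : rV) (t : R).

Definition base_bump : rV -> R := bumpf 0 (2^-1) 1.

(** Normalized by the integral of the rescaled bump itself: unit mass is then immediate, and the
    size [t ^- n] is recovered from a lower bound for that integral. *)
Definition moll t : rV -> R := locked_with moll_key
  (fun z => (Leb (fun z => base_bump (t^-1 *: z)))^-1 * base_bump (t^-1 *: z)).

Lemma mollE t : moll t =
  fun z => (Leb (fun z => base_bump (t^-1 *: z)))^-1 * base_bump (t^-1 *: z).
Proof. exact: locked_withE. Qed.

(* Dominates [moll t], and [t] times its partial derivatives, up to constants. *)
Definition moll_hat t : rV -> R :=
  locked_with moll_key (fun z => (t ^+ n)^-1 * bumpf 0 t (2 * t) z).

Lemma moll_hatE t : moll_hat t = fun z => (t ^+ n)^-1 * bumpf 0 t (2 * t) z.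
Proof. exact: locked_withE. Qed.

Lemma base_bump_range : (0 : R) <= (2^-1 : R) < (1 : R).
Proof. by rewrite invr_ge0 ler0n/= invf_lt1// ltr1n. Qed.

Lemma tf_base_bump : tf base_bump.
Proof.
split; first exact: smooth_bumpf.
by exists 1 => x /(bumpf_supp base_bump_range); rewrite subr0 => /ltW.
Qed.

Lemma smooth_scale f (s : R) : smooth_on setT f -> smooth_on setT (fun x => f (s *: x)).
Proof.
move=> sf; apply: (smooth_comp (f := f) (G := fun x => s *: x) openT openT) => //.
move=> m; apply: Ck_rV => [|i]; first exact: openT.
rewrite (_ : (fun x => _) = fun x : rV => s * x 0 i).
  by apply: CkM; [exact: openT|exact: (Ck_cst _ _ s)|exact: Ck_coord].
by apply/funext => x; rewrite mxE.
Qed.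

Lemma partial_scale f (s : R) j x : smooth_on setT f ->
  partial j (fun x => f (s *: x)) x = s * partial j f (s *: x).
Proof.
move=> sf.
have dG : is_derive x (delta_mx 0 j) (fun x : rV => s *: x) (s *: delta_mx 0 j).
  exact: is_deriveZ.
have [_] := @is_derive_comp R n n f setT (fun x => s *: x) x (delta_mx 0 j) openT I (sf 1) (@ex_derive _ _ _ _ _ _ _ dG).
rewrite /partial => ->; rewrite derive_val (bigD1 j)//= !mxE !eqxx mulr1 big1 ?addr0// => i ij.
by rewrite !mxE (negbTE ij) andbF mulr0 mul0r.
Qed.

Lemma tf_scale f (s : R) : 0 < s -> tf f -> tf (fun x => f (s *: x)).
Proof.
move=> s0 [sf [r fr]]; split; first exact: smooth_scale.
exists (s^-1 * r) => x /fr; rewrite normrZ gtr0_norm// => h.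
by rewrite ler_pdivlMl.
Qed.

(** The rescaled bump is 1 on the cube of radius [t / 2], whose volume is [t ^+ n]. *)
Lemma moll_mass t : 0 < t -> t ^+ n <= Leb (fun z => base_bump (t^-1 *: z)).
Proof.
move=> t0; have ti : 0 < t^-1 by rewrite invr_gt0.
have tb := tf_scale ti tf_base_bump.
have -> : t ^+ n = 1 * ((2^-1 * t) *+ 2) ^+ n by rewrite mul1r; congr (_ ^+ _); rewrite mulr2n; lra.
apply: (@Leb_ge_ball _ _ _ 0); [exact: tf_cc|by rewrite mulr_ge0// ?invr_ge0// ltW|by []|..].
  by move=> y; exact: bumpf_ge0.
move=> y; rewrite subr0 => yt; rewrite /base_bump bumpf_eq1 ?base_bump_range//.
by rewrite subr0 normrZ gtr0_norm// ler_pdivrMl// mulrC.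
Qed.

Lemma moll_mass_gt0 t : 0 < t -> 0 < Leb (fun z => base_bump (t^-1 *: z)).
Proof. by move=> t0; apply: lt_le_trans (moll_mass t0); rewrite exprn_gt0. Qed.

Lemma tf_moll t : 0 < t -> tf (moll t).
Proof. by move=> t0; rewrite mollE; apply: tfZ; apply: tf_scale tf_base_bump; rewrite invr_gt0. Qed.

Lemma moll_ge0 t z : 0 < t -> 0 <= moll t z.
Proof.
by move=> t0; rewrite mollE mulr_ge0 ?invr_ge0 ?bumpf_ge0// ltW// moll_mass_gt0.
Qed.

Lemma moll_supp t z : 0 < t -> moll t z != 0 -> `|z| <= t.
Proof.
move=> t0; rewrite mollE mulf_eq0 negb_or => /andP[_ /(bumpf_supp base_bump_range)].
by rewrite subr0 normrZ gtr0_norm ?invr_gt0// ltr_pdivrMl// mulr1 => /ltW.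
Qed.

Lemma Leb_moll t : 0 < t -> Leb (moll t) = 1.
Proof.
move=> t0; rewrite mollE LebZ; last by apply: tf_cc; apply: tf_scale tf_base_bump; rewrite invr_gt0.
by rewrite mulVf// gt_eqF// moll_mass_gt0.
Qed.

Lemma tf_moll_hat t : 0 < t -> tf (moll_hat t).
Proof.
move=> t0; rewrite moll_hatE; apply: tfZ; split; first exact: smooth_bumpf.
have tt : 0 <= t < 2 * t by apply/andP; split; lra.
by exists (2 * t) => x /(bumpf_supp tt); rewrite subr0 => /ltW.
Qed.

Lemma moll_hat_ge0 t z : 0 < t -> 0 <= moll_hat t z.
Proof. by move=> t0; rewrite moll_hatE mulr_ge0 ?bumpf_ge0// invr_ge0 exprn_ge0// ltW. Qed.

(** The majorant is at most [t ^- n] and lives on a cube of side [4 t]; this is the origin of the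
    powers of 4 below. *)
Lemma Leb_moll_hat t : 0 < t -> Leb (moll_hat t) <= 4 ^+ n.
Proof.
move=> t0; have tt : 0 <= t < 2 * t by apply/andP; split; lra.
have tn : 0 < t ^+ n by rewrite exprn_gt0.
have -> : (4 : R) ^+ n = (t ^+ n)^-1 * ((2 * t) *+ 2) ^+ n.
  rewrite (_ : (2 * t) *+ 2 = 4 * t); last by rewrite mulr2n; lra.
  by rewrite exprMn mulrCA mulVf ?mulr1// gt_eqF.
apply: (@Leb_le_ball _ _ _ 0); [exact: tf_cc (tf_moll_hat t0)|lra|..] => y.
  rewrite moll_hat_ge0//= moll_hatE -[leRHS]mulr1 ler_pM2l ?invr_gt0//.
  exact: bumpf_le1.
by rewrite moll_hatE mulf_eq0 negb_or subr0 => /andP[_ /(bumpf_supp tt)]; rewrite subr0 => /ltW.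
Qed.

Lemma le_moll_hat t z (c : R) : 0 < t -> 0 <= c -> `|z| <= t ->
  (Leb (fun z => base_bump (t^-1 *: z)))^-1 * c <= c * moll_hat t z.
Proof.
move=> t0 c0 zt; have tt : 0 <= t < 2 * t by apply/andP; split; lra.
rewrite moll_hatE bumpf_eq1 ?subr0// mulr1 mulrC; apply: ler_wpM2l => //.
by rewrite lef_pV2 ?posrE ?exprn_gt0 ?moll_mass_gt0// moll_mass.
Qed.

Lemma moll_le_hat t z : 0 < t -> moll t z <= moll_hat t z.
Proof.
move=> t0; have [->|/(moll_supp t0) zt] := eqVneq (moll t z) 0; first exact: moll_hat_ge0.
rewrite -[leRHS]mul1r; apply: le_trans (le_moll_hat t0 ler01 zt).
by rewrite mollE ler_pM2l ?invr_gt0 ?moll_mass_gt0// bumpf_le1.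
Qed.

(** The chain rule contributes [t^-1], and the derivative of the fixed bump is bounded. On the
    support of the derivative, inside radius [t], the majorant equals [t ^- n]. *)
Lemma partial_moll_le : exists2 C : R, 0 <= C & forall t j z, 0 < t ->
  `|partial j (moll t) z| <= C / t * moll_hat t z.
Proof.
have /choice[b bP] : forall j : 'I_n, exists b : R, 0 <= b /\ forall x, `|partial j base_bump x| <= b.
  by move=> j; have [b b0 bf] := cc_bound (tf_cc (tf_partial j tf_base_bump)); exists b.
pose B := \sum_j b j.
have bB j : b j <= B by rewrite /B (bigD1 j)//= lerDl sumr_ge0// => i _; have [] := bP i.
have B0 : 0 <= B by apply: sumr_ge0 => i _; have [] := bP i.
exists B => // t j z t0; have ti : 0 < t^-1 by rewrite invr_gt0.
have [->|] := eqVneq (partial j (moll t) z) 0.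
  by rewrite normr0 mulr_ge0 ?moll_hat_ge0// divr_ge0// ltW.
have ms y : moll t y != 0 -> `|y - 0| <= t by rewrite subr0; exact: moll_supp.
move=> /(partial_ball_supp ms); rewrite subr0 => zt.
have sb : smooth_on setT (fun z => base_bump (t^-1 *: z)).
  by apply: smooth_scale; exact: tf_base_bump.1.
have -> : partial j (moll t) z =
    (Leb (fun z => base_bump (t^-1 *: z)))^-1 * (t^-1 * partial j base_bump (t^-1 *: z)).
  rewrite -partial_scale; last exact: tf_base_bump.1.
  rewrite /partial mollE.
  rewrite (deriveZ (f := fun z => base_bump (t^-1 *: z)))//.
  exact: (smooth_derivable sb I).
have mi : 0 < (Leb (fun z => base_bump (t^-1 *: z)))^-1 by rewrite invr_gt0 moll_mass_gt0.
rewrite normrM (gtr0_norm mi).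
have Bt : 0 <= B / t by rewrite divr_ge0// ltW.
apply: le_trans (le_moll_hat t0 Bt zt).
rewrite (ler_pM2l mi) normrM gtr0_norm// mulrC ler_pM2r//.
by apply: le_trans (bB j); have [] := bP j.
Qed.

End mollifier.

Section mollified_functions.
Context {R : realType} {n : nat}.
Local Notation rV := ('rV[R]_n).
Implicit Types (f g w k a : rV -> R) (x y z : rV) (t : R).

Lemma conv_moll_bound t g : 0 < t -> tf g ->
  Leb (fun x => conv (moll t) g x ^+ 2) <= (4 ^+ n) ^+ 2 * Leb (fun x => g x ^+ 2).
Proof.
move=> t0 tg; have tm := @tf_moll R n t t0; have th := @tf_moll_hat R n t t0.
have h0 (x : rV) : 0 <= moll_hat t x by exact: moll_hat_ge0.
have cc1 : cc (conv (moll t) g) by apply: tf_cc; apply: tf_conv tm _; exact: tf_cc.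
suff dom x : `|conv (moll t) g x| <= Leb (fun y => moll_hat t (y - x) * `|g y|).
  apply: le_trans (schur_bound th tg cc1 h0 dom) _.
  apply: ler_wpM2r; first by apply: Leb_ge0 => x; exact: sqr_ge0.
  by apply: lerXn2r; rewrite ?nnegrE ?exprn_ge0 ?Leb_ge0//; exact: Leb_moll_hat.
have cg := tf_cc tg; have c1 := conv_cc x tm cg.1.
  apply: le_trans (Leb_norm c1) _; apply: le_Leb; first exact: cc_norm.
    by apply: conv_cc => //; exact: (cc_norm cg).1.
move=> y; rewrite normrM (ger0_norm (moll_ge0 _ t0)); apply: ler_wpM2r; first exact: normr_ge0.
exact: moll_le_hat.
Qed.

(** Unit mass writes the difference as an average of [g y - g x] over points at distance at most
    [t], and [g] is Lipschitz. *)
Lemma conv_moll_approx g : tf g -> exists2 C : R, 0 <= C & forall t x, 0 < t ->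
  `|conv (moll t) g x - g x| <= C * t.
Proof.
move=> tg; have [C C0 gC] := tf_lipschitz tg; exists C => // t x t0.
have tm := @tf_moll R n t t0; have tms := tf_shift (- x) tm; have cg := tf_cc tg.
have -> : conv (moll t) g x - g x = Leb (fun y => moll t (y - x) * (g y - g x)).
  rewrite (_ : (fun y => _) = fun y => moll t (y - x) * g y - g x * moll t (y - x)).
    rewrite (LebB (conv_cc x tm cg.1) (ccZ _ (tf_cc tms))) (LebZ _ (tf_cc tms)).
    by rewrite (Leb_translation (- x) (tf_cc tm)) (Leb_moll t0) mulr1.
  by apply/funext => y; ring.
have c1 : cc (fun y => moll t (y - x) * (g y - g x)).
  apply: ccM; first exact: tf_cc.
  by move=> y; exact: (cvgB (cg.1 y) (cvg_cst _)).
apply: le_trans (Leb_norm c1) _.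
apply: le_trans (_ : Leb (fun y => C * t * moll t (y - x)) <= _).
  apply: le_Leb; [exact: cc_norm|by apply: ccZ; exact: tf_cc|move=> y].
  rewrite normrM ger0_norm ?moll_ge0// mulrC.
  have [->|/(moll_supp t0) yt] := eqVneq (moll t (y - x)) 0; first by rewrite !mulr0.
  apply: ler_wpM2r; first exact: moll_ge0.
  by apply: le_trans (gC _ _) _; apply: ler_wpM2l.
rewrite LebZ; last exact: tf_cc.
by rewrite (Leb_translation (- x) (tf_cc tm)) Leb_moll// mulr1.
Qed.

(* Friedrichs' lemma: after integration by parts the kernel of the commutator is
   [(a y - a x) d_j moll t (y - x) + moll t (y - x) d_j a y], and the factor
   [a y - a x = O(t)] compensates the [1 / t] of the derivative. *)
Lemma commutator_bound a j : tf a -> exists2 C : R, 0 <= C & forall t w, 0 < t -> tf w ->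
  Leb (fun x => (a x * partial j (conv (moll t) w) x -
                 conv (moll t) (fun y => a y * partial j w y) x) ^+ 2)
  <= C * Leb (fun x => w x ^+ 2).
Proof.
move=> ta; have [A A0 aA] := tf_lipschitz ta.
have [A1 A10 aA1] := cc_bound (tf_cc (tf_partial j ta)).
have [C C0 mC] := @partial_moll_le R n.
pose D := A * C + A1; have D0 : 0 <= D by rewrite addr_ge0// mulr_ge0.
exists ((D * 4 ^+ n) ^+ 2) => [|t w t0 tw]; first exact: sqr_ge0.
have tm := @tf_moll R n t t0; have th := @tf_moll_hat R n t t0.
have cw := tf_cc tw; have taw : tf (fun y => a y * partial j w y).
  by apply: tfM => //; exact: (tf_partial j tw).1.
pose f x := a x * partial j (conv (moll t) w) x - conv (moll t) (fun y => a y * partial j w y) x.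
have cf : cc f.
  apply: ccB; last by apply: tf_cc; apply: tf_conv => //; exact: tf_cc.
  apply: tf_cc; apply: tfM => //; apply: (tf_partial j _).1; apply: tf_conv => //.
have fE x : f x = Leb (fun y => (a y - a x) * (partial j (moll t) (y - x) * w y) +
                                moll t (y - x) * (partial j a y * w y)).
  have tms := tf_shift (- x) tm.
  have tg : tf (fun y => moll t (y - x) * (a y * w y)) := tfM tms (tfM ta tw.1).1.
  have := Leb_partial j tg.
  rewrite (_ : partial j _ = fun y => partial j (moll t) (y - x) * (a y * w y) +
    moll t (y - x) * (partial j a y * w y + a y * partial j w y)); last first.
    apply/funext => y; rewrite (partialM _ _ tms.1 (tfM ta tw.1).1) (partialM _ _ ta.1 tw.1).
    by rewrite (partial_shift (moll t) (- x) j y).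
  (* The integration by parts: the vanishing integral of the derivative of
     [moll t (y - x) * (a y * w y)] is added, which cancels the term containing the derivative of
     [w]. *)
  move=> L0; rewrite /f partial_conv// /conv -[LHS]addr0 -[in X in _ + X = _]L0.
  have tpm := tf_shift (- x) (tf_partial j tm).
  have c1 : cc (fun y => - partial j (moll t) (y - x) * w y).
    by apply: ccM cw.1; apply: ccN; exact: tf_cc.
  have c2 := conv_cc x tm (tf_cc taw).1.
  rewrite -LebZ// -LebB//; last exact: ccZ.
  rewrite -LebD; [|by apply: ccB => //; exact: ccZ|].
    by apply: eq_Leb => y; ring.
  apply: ccD; first by apply: ccM; [exact: tf_cc|exact: (tf_cc (tfM ta tw.1)).1].
  apply: ccM; first exact: tf_cc.
  by apply: (tf_cc (tfD _ taw)).1; apply: tfM tw.1; exact: tf_partial.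
have th' : tf (fun z => D * moll_hat t z) := tfZ D th.
apply: le_trans (schur_bound (k := fun z => D * moll_hat t z) th' tw cf _ _) _.
- by move=> x; apply: mulr_ge0 => //; exact: moll_hat_ge0.
- move=> x; rewrite fE.
  have tpm := tf_shift (- x) (tf_partial j tm); have tms := tf_shift (- x) tm.
  have c1 : cc (fun y => (a y - a x) * (partial j (moll t) (y - x) * w y) +
                                moll t (y - x) * (partial j a y * w y)).
    apply: ccD.
      apply: ccMl; last by apply: ccM cw.1; exact: tf_cc.
      by move=> y; exact: (cvgB ((tf_cc ta).1 y) (cvg_cst _)).
    by apply: ccM; [exact: tf_cc|exact: (tf_cc (tfM (tf_partial j ta) tw.1)).1].
  apply: le_trans (Leb_norm c1) _; apply: le_Leb; first exact: cc_norm.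
    by apply: (conv_cc x th'); exact: (cc_norm cw).1.
  move=> y; apply: le_trans (ler_normD _ _) _.
  rewrite !normrM !mulrA -mulrDl; apply: ler_wpM2r; first exact: normr_ge0.
  rewrite [leRHS]mulrDl; apply: lerD.
    (* Where the derivative of the mollifier is nonzero, [y] is within [t] of [x], so the product is
       at most [A * t] times [C / t] times the majorant. *)
    have [->|dm] := eqVneq (partial j (moll t) (y - x)) 0.
      by rewrite normr0 mulr0; apply: mulr_ge0; [exact: mulr_ge0|exact: moll_hat_ge0].
    have ms z : moll t z != 0 -> `|z - 0| <= t by rewrite subr0; exact: moll_supp.
    have := partial_ball_supp ms dm; rewrite subr0 => yt.
    apply: le_trans (_ : (A * t) * (C / t * moll_hat t (y - x)) <= _).
      apply: ler_pM; [exact: normr_ge0|exact: normr_ge0| |exact: mC].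
      by apply: le_trans (aA _ _) _; apply: ler_wpM2l.
    by rewrite le_eqVlt; apply/orP; left; apply/eqP; field; rewrite gt_eqF.
  rewrite mulrC; apply: ler_pM; [exact: normr_ge0|exact: normr_ge0|exact: aA1|].
  by rewrite (ger0_norm (moll_ge0 _ t0)); exact: moll_le_hat.
apply: ler_wpM2r; first by apply: Leb_ge0 => x; exact: sqr_ge0.
rewrite LebZ; last exact: tf_cc.
rewrite lerXn2r ?nnegrE//.
- by rewrite mulr_ge0// Leb_ge0// => x; exact: moll_hat_ge0.
- by rewrite mulr_ge0// exprn_ge0.
- by apply: ler_wpM2l => //; exact: Leb_moll_hat.
Qed.

(** By Cauchy-Schwarz and translation invariance the bound does not depend on [x]: convolution turns
    square-mean Cauchy sequences into uniformly Cauchy ones. *)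
Lemma conv_sup_bound k w x : tf k -> tf w ->
  conv k w x ^+ 2 <= Leb (fun z => k z ^+ 2) * Leb (fun y => w y ^+ 2).
Proof.
move=> tk tw; have := Leb_CS (tf_cc (tf_shift (- x) tk)) (tf_cc tw).
by rewrite (Leb_translation (- x) (f := fun z => k z ^+ 2))//; exact: cc_sqr (tf_cc tk).
Qed.

End mollified_functions.

(** * Smooth functions, bundles and coordinate patches *)

Section complex_smooth.
Context {R : realType} {n : nat}.
Implicit Types (V U : set 'rV[R]_n) (f g : 'rV[R]_n -> R[i]) (z : R[i]).
Local Notation Re := complex.Re.
Local Notation Im := complex.Im.

Lemma Re_mul z1 z2 : Re (z1 * z2) = Re z1 * Re z2 - Im z1 * Im z2 :> R.
Proof. by case: z1 => ? ?; case: z2. Qed.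

Lemma Im_mul z1 z2 : Im (z1 * z2) = Re z1 * Im z2 + Im z1 * Re z2 :> R.
Proof. by case: z1 => ? ?; case: z2. Qed.

Lemma Re_add z1 z2 : Re (z1 + z2) = Re z1 + Re z2 :> R.
Proof. by case: z1 => ? ?; case: z2. Qed.

Lemma Im_add z1 z2 : Im (z1 + z2) = Im z1 + Im z2 :> R.
Proof. by case: z1 => ? ?; case: z2. Qed.

Lemma csmooth_cst V z : csmooth_on V (fun=> z).
Proof. by split; exact: smooth_cst. Qed.

Lemma csmoothD V f g : open V -> csmooth_on V f -> csmooth_on V g ->
  csmooth_on V (fun x => f x + g x).
Proof.
move=> oV [rf jf] [rg jg]; split.
  rewrite (_ : (fun x => Re _) = fun x => Re (f x) + Re (g x)); first exact: smoothD.
  by apply/funext => x; exact: Re_add.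
rewrite (_ : (fun x => Im _) = fun x => Im (f x) + Im (g x)); first exact: smoothD.
by apply/funext => x; exact: Im_add.
Qed.

Lemma csmoothM V f g : open V -> csmooth_on V f -> csmooth_on V g ->
  csmooth_on V (fun x => f x * g x).
Proof.
move=> oV [rf jf] [rg jg]; split.
  rewrite (_ : (fun x => Re _) = fun x => Re (f x) * Re (g x) - Im (f x) * Im (g x)).
    by apply: smoothB => //; exact: smoothM.
  by apply/funext => x; exact: Re_mul.
rewrite (_ : (fun x => Im _) = fun x => Re (f x) * Im (g x) + Im (f x) * Re (g x)).
  by apply: smoothD => //; exact: smoothM.
by apply/funext => x; exact: Im_mul.
Qed.

Lemma csmooth_sum V (I : Type) (s : seq I) (F : I -> 'rV[R]_n -> R[i]) : open V ->
  (forall i, csmooth_on V (F i)) -> csmooth_on V (fun x => \sum_(i <- s) F i x).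
Proof.
move=> oV sF; elim: s => [|i s IH].
  rewrite (_ : (fun x => _) = fun=> 0); first exact: csmooth_cst.
  by apply/funext => x; rewrite big_nil.
rewrite (_ : (fun x => _) = fun x => F i x + \sum_(i <- s) F i x); first exact: csmoothD.
by apply/funext => x; rewrite big_cons.
Qed.

Lemma csmooth_real V (f : 'rV[R]_n -> R) : smooth_on V f -> csmooth_on V (fun x => (f x)%:C%C).
Proof. by move=> sf; split=> //=; exact: smooth_cst. Qed.

Lemma csmooth_sub V U f : U `<=` V -> csmooth_on V f -> csmooth_on U f.
Proof. by move=> UV [rf jf]; split=> m; exact: Ck_sub UV _. Qed.

Lemma csmooth_ext V f g : open V -> (forall x, V x -> f x = g x) ->
  csmooth_on V f -> csmooth_on V g.
Proof.
by move=> oV fg [rf jf]; split=> m; [have := rf m|have := jf m]; apply: Ck_ext => // x Vx;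
  rewrite fg.
Qed.

Lemma csmooth_local V f : (forall x, V x -> exists2 U, U x & csmooth_on U f) -> csmooth_on V f.
Proof.
by move=> Vf; split=> m; apply: Ck_local => x /Vf[U Ux [rf jf]]; exists U.
Qed.

Lemma csmooth_comp V f p (U : set 'rV[R]_p) (G : 'rV[R]_p -> 'rV[R]_n) :
  open V -> open U -> (forall x, U x -> V (G x)) -> csmooth_on V f -> smooth_on U G ->
  csmooth_on U (f \o G).
Proof.
move=> oV oU UV [rf jf] sG; split; first exact: (smooth_comp oV oU UV rf sG).
exact: (smooth_comp oV oU UV jf sG).
Qed.

End complex_smooth.

(** * Smoothness on the manifold, checked in one chart at a time *)

Section charts.
Context {R : realType} {n : nat} {M : manifold R n}.
Implicit Types (c : chart R n M) (U O : set M) (f g : M -> R[i]) (p : M).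

Lemma chart_img_openI c U : open U -> open (chart_map c @` (chart_dom c `&` U)).
Proof.
move=> oU; rewrite openE => _ [p [cp Up] <-].
have ip : chart_img c (chart_map c p) by exists p.
have n1 : \forall y \near chart_map c p, chart_img c y.
  by have := chart_img_open (c := c); rewrite openE => /(_ _ ip).
have n2 : \forall y \near chart_map c p, U (chart_inv c y).
  apply: (chart_inv_continuous ip); rewrite chart_mapK//.
  by move: oU; rewrite openE => /(_ _ Up).
apply: filterS2 n1 n2 => _ [q cq <-]; rewrite chart_mapK// => Uq.
by exists q.
Qed.

Lemma chart_imgK c x : chart_img c x -> chart_dom c (chart_inv c x) /\ chart_map c (chart_inv c x) = x.
Proof. by move=> [p cp <-]; rewrite chart_mapK. Qed.

Lemma chart_restr_subproof c U (oU : open U) x :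
  (chart_map c @` (chart_dom c `&` U)) x -> {for x, continuous (chart_inv c)}.
Proof. by move=> [p [cp _] <-]; apply: chart_inv_continuous; exists p. Qed.

(** The coordinate formula of a differential operator asks for a chart and a trivialization with the
    same domain; restricting both to the intersection provides such a pair. *)
Definition chart_restr c U (oU : open U) : chart R n M :=
  @Chart R n M (chart_dom c `&` U) (chart_map c) (chart_inv c)
    (openI (chart_dom_open c) oU) (chart_img_openI oU)
    (fun p cp => chart_mapK cp.1) (fun p cp => chart_map_continuous cp.1)
    (chart_restr_subproof oU).

Lemma is_chart_restr c U (oU : open U) : is_chart c -> is_chart (chart_restr c oU).
Proof.
move=> cc c' Bc'; have [h1 h2] := cc c' Bc'; split => m.
  apply: Ck_sub (h1 m) => _ [p [[cp _] c'p] <-].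
  by exists p.
apply: Ck_sub (h2 m) => _ [p [c'p [cp _]] <-].
by exists p.
Qed.

Lemma atlas_is_chart c : mfd_atlas c -> is_chart c.
Proof. by move=> Bc c' Bc'; split; exact: mfd_atlas_compat. Qed.

(** Compatibility is given only with charts of the atlas; near each point the transition map factors
    through such a chart. *)
Lemma is_chart_compat c c' : is_chart c -> is_chart c' -> chart_compat c c'.
Proof.
move=> cc cc' m; apply: Ck_local => _ [p [cp c'p] <-].
have [d Bd dp] := mfd_atlas_cover p.
have [cd _] := cc d Bd; have [_ dc'] := cc' d Bd.
set O := chart_dom c' `&` chart_dom d.
have oO : open O by apply: openI; exact: chart_dom_open.
have o1 : open (chart_map c @` (chart_dom c `&` O)) := chart_img_openI oO.
exists (chart_map c @` (chart_dom c `&` O)); first by exists p.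
have o2 : open (chart_map d @` (chart_dom d `&` chart_dom c')).
  by apply: chart_img_openI; exact: chart_dom_open.
apply: (@Ck_ext _ _ _ m _ ((chart_map c' \o chart_inv d) \o (chart_map d \o chart_inv c)) _ o1).
  by move=> _ [q [cq [c'q dq]] <-] /=; rewrite (chart_mapK cq) (chart_mapK dq).
move: m; apply: (smooth_rV_comp o2 o1 _ dc').
  by move=> _ [q [cq [c'q dq]] <-] /=; rewrite (chart_mapK cq); exists q.
move=> j; apply: Ck_sub (cd j) => _ [q [cq [c'q dq]] <-].
by exists q.
Qed.

(** Smoothness quantifies over all charts; transition maps carry it over from one suitable chart
    around each point. *)
Lemma msmooth_local U f : (forall p, U p -> exists c O, [/\ is_chart c, chart_dom c p, O p, open O &
  csmooth_on (chart_map c @` (chart_dom c `&` O)) (f \o chart_inv c)]) -> msmooth_on U f.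
Proof.
move=> Uf c cc; apply: csmooth_local => _ [p [cp Up] <-].
have [d [W [isd dp Op oO sf]]] := Uf p Up.
have oO' : open (W `&` chart_dom d) by apply: openI => //; exact: chart_dom_open.
exists (chart_map c @` (chart_dom c `&` (W `&` chart_dom d))); first by exists p.
apply: (@csmooth_ext _ _ _ ((f \o chart_inv d) \o (chart_map d \o chart_inv c))).
- exact: chart_img_openI.
- by move=> _ [q [cq [Oq dq]] <-] /=; rewrite (chart_mapK cq) (chart_mapK dq).
apply: (csmooth_comp (V := chart_map d @` (chart_dom d `&` W))) => //.
- exact: chart_img_openI.
- exact: chart_img_openI.
- by move=> _ [q [cq [Oq dq]] <-] /=; rewrite (chart_mapK cq); exists q.
move=> m; apply: Ck_sub (is_chart_compat cc isd m) => _ [q [cq [Oq dq]] <-].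
by exists q.
Qed.

Lemma msmooth_pt U f : (forall p, U p -> exists O, [/\ O p, open O & msmooth_on O f]) ->
  msmooth_on U f.
Proof.
move=> Uf; apply: msmooth_local => p Up; have [W [Op oO sf]] := Uf p Up.
have [c Bc cp] := mfd_atlas_cover p; exists c, W; split=> //; first exact: atlas_is_chart.
exact/sf/atlas_is_chart.
Qed.

Lemma msmooth_sub U O f : O `<=` U -> msmooth_on U f -> msmooth_on O f.
Proof.
by move=> OU sf c cc; apply: csmooth_sub (sf c cc) => _ [p [cp Op] <-]; exists p; split=> //; exact: OU.
Qed.

Lemma msmooth_ext U f g : open U -> (forall p, U p -> f p = g p) ->
  msmooth_on U f -> msmooth_on U g.
Proof.
move=> oU fg sf c cc; apply: csmooth_ext (sf c cc); first exact: chart_img_openI.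
by move=> _ [p [cp Up] <-]; rewrite /= chart_mapK// fg.
Qed.

Lemma msmooth_cst U z : msmooth_on U (fun=> z).
Proof. by move=> c cc; exact: csmooth_cst. Qed.

Lemma msmoothD U f g : open U -> msmooth_on U f -> msmooth_on U g ->
  msmooth_on U (fun p => f p + g p).
Proof. by move=> oU sf sg c cc; apply: csmoothD (sf c cc) (sg c cc); exact: chart_img_openI. Qed.

Lemma msmoothM U f g : open U -> msmooth_on U f -> msmooth_on U g ->
  msmooth_on U (fun p => f p * g p).
Proof. by move=> oU sf sg c cc; apply: csmoothM (sf c cc) (sg c cc); exact: chart_img_openI. Qed.

Lemma msmooth_sum U (I : Type) (s : seq I) (F : I -> M -> R[i]) : open U ->
  (forall i, msmooth_on U (F i)) -> msmooth_on U (fun p => \sum_(i <- s) F i p).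
Proof.
move=> oU sF c cc.
by apply: (@csmooth_sum _ _ _ _ s (fun i => F i \o chart_inv c)) => [|i]; [exact: chart_img_openI|exact: sF].
Qed.

Lemma msmooth_continuous U f p : open U -> U p -> msmooth_on U f ->
  {for p, continuous (fun q => complex.Re (f q))} /\ {for p, continuous (fun q => complex.Im (f q))}.
Proof.
move=> oU Up sf; have [c Bc cp] := mfd_atlas_cover p.
have [rf jf] := sf c (atlas_is_chart Bc).
have oD : open (chart_dom c) := chart_dom_open c.
have key (g : M -> R) : {for chart_map c p, continuous (g \o chart_inv c)} -> {for p, continuous g}.
  move=> cg; apply: (@continuous_ext M R (chart_dom c) ((g \o chart_inv c) \o chart_map c)) => //.
    by move=> q cq; rewrite /= chart_mapK.
  by apply: continuous_comp cg; exact: chart_map_continuous.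
split; apply: key.
  by apply: (smooth_continuous rf); exists p.
by apply: (smooth_continuous jf); exists p.
Qed.

End charts.

Section trivializations.
Context {R : realType} {n : nat} {M : manifold R n} {k : nat} (S : vbundle M k).
Implicit Types (t : trivialization k S) (u v : section_of S) (p q : M) (U : set M).

Lemma cV_delta (w : 'cV[R[i]]_k) : w = \sum_l w l 0 *: delta_mx l 0.
Proof.
apply/colP => i; rewrite summxE (bigD1 i)//= !mxE !eqxx mulr1 big1 ?addr0// => l li.
by rewrite !mxE eq_sym (negbTE li) mulr0.
Qed.

Lemma triv_map0 t p : triv_dom t p -> triv_map t (0 : S p) = 0.
Proof.
by move=> tp; have := triv_linear tp (-1) 0 0; rewrite scaler0 addr0 scaleN1r addNr.
Qed.

Lemma triv_map_sum t p (I : Type) (s : seq I) (a : I -> R[i]) (x : I -> S p) : triv_dom t p ->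
  triv_map t (\sum_(i <- s) a i *: x i) = \sum_(i <- s) a i *: triv_map t (x i).
Proof.
move=> tp; elim: s => [|i s IH]; first by rewrite !big_nil triv_map0.
by rewrite !big_cons (triv_linear tp) IH.
Qed.

Lemma triv_inv_linear t p : triv_dom t p -> linear (@triv_inv _ _ _ _ t p).
Proof.
move=> tp a x y; apply: (can_inj (triv_mapK tp)).
by rewrite triv_invK// (triv_linear tp) !triv_invK.
Qed.

Lemma triv_inv0 t p : triv_dom t p -> triv_inv t p 0 = 0.
Proof. by move=> tp; rewrite -(triv_map0 tp) triv_mapK. Qed.

Lemma triv_inv_sum t p (I : Type) (s : seq I) (a : I -> R[i]) (x : I -> 'cV[R[i]]_k) : triv_dom t p ->
  triv_inv t p (\sum_(i <- s) a i *: x i) = \sum_(i <- s) a i *: triv_inv t p (x i).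
Proof.
move=> tp; apply: (can_inj (triv_mapK tp)); rewrite triv_invK// triv_map_sum//.
by apply: eq_bigr => i _; rewrite triv_invK.
Qed.

Lemma triv_change t t' p (w : 'cV[R[i]]_k) i : triv_dom t p -> triv_dom t' p ->
  triv_map t' (triv_inv t p w) i 0 =
  \sum_l w l 0 * triv_map t' (triv_inv t p (delta_mx l 0)) i 0.
Proof.
move=> tp tp'; rewrite {1}(cV_delta w) triv_inv_sum// triv_map_sum// summxE.
by apply: eq_bigr => l _; rewrite mxE.
Qed.

Definition triv_restr t U (oU : open U) : trivialization k S :=
  @Trivialization R M k S (triv_dom t `&` U) (@triv_map _ _ _ _ t) (@triv_inv _ _ _ _ t)
    (openI (triv_dom_open t) oU) (fun p tp => triv_linear tp.1)
    (fun p tp => triv_mapK tp.1) (fun p tp => triv_invK tp.1).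

Lemma is_triv_restr t U (oU : open U) : is_triv t -> is_triv (triv_restr t oU).
Proof.
move=> tt t' Bt'; have [h1 h2] := tt t' Bt'; split => i j.
  by apply: msmooth_sub (h1 i j) => p [[]].
by apply: msmooth_sub (h2 i j) => p [? []].
Qed.

Lemma atlas_is_triv t : vb_atlas t -> is_triv t.
Proof. by move=> Bt t' Bt'; split; exact: vb_atlas_compat. Qed.

(** Near each point the transition matrix is the product of those to and from a trivialization of
    the atlas. *)
Lemma is_triv_compat t t' : is_triv t -> is_triv t' -> triv_compat t t'.
Proof.
move=> tt tt' i j; apply: msmooth_pt => p [tp tp'].
have [s Bs sp] := vb_atlas_cover S p.
have [h1 _] := tt s Bs; have [_ h2] := tt' s Bs.
have oO : open (triv_dom t `&` triv_dom t' `&` triv_dom s).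
  by apply: openI; [apply: openI|]; exact: triv_dom_open.
exists (triv_dom t `&` triv_dom t' `&` triv_dom s); split=> //.
apply: (@msmooth_ext _ _ _ _ (fun p => \sum_l triv_map s (triv_inv t p (delta_mx j 0)) l 0 *
   triv_map t' (triv_inv s p (delta_mx l 0)) i 0)) => //.
  by move=> q [[tq tq'] sq]; rewrite -triv_change// triv_mapK.
apply: msmooth_sum => // l; apply: msmoothM => //.
  by apply: msmooth_sub (h1 l j) => q [[]].
by apply: msmooth_sub (h2 i l) => q [[]].
Qed.

Lemma smooth_section_local u :
  (forall p, exists t U, [/\ is_triv t, triv_dom t p, U p, open U &
     forall i, msmooth_on (U `&` triv_dom t) (fun q => triv_map t (u q) i 0)]) ->
  smooth_section u.
Proof.
move=> su t tt i; apply: msmooth_pt => p tp.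
have [s [U [ss sp Up oU sU]]] := su p.
have oO : open (triv_dom t `&` (U `&` triv_dom s)).
  by apply: openI; [|apply: openI => //]; exact: triv_dom_open.
exists (triv_dom t `&` (U `&` triv_dom s)); split=> //.
apply: (@msmooth_ext _ _ _ _ (fun q => \sum_l triv_map s (u q) l 0 *
   triv_map t (triv_inv s q (delta_mx l 0)) i 0)) => //.
  by move=> q [tq [Uq sq]]; rewrite -triv_change// triv_mapK.
apply: msmooth_sum => // l; apply: msmoothM => //.
  by apply: msmooth_sub (sU l) => q [].
by apply: msmooth_sub (is_triv_compat ss tt i l) => q [? []].
Qed.

Lemma smooth_section_lin (a : R[i]) u v : smooth_section u -> smooth_section v ->
  smooth_section (fun p => a *: u p + v p).
Proof.
move=> su sv t tt i.
have oD := triv_dom_open t.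
apply: (@msmooth_ext _ _ _ _ (fun q => a * triv_map t (u q) i 0 + triv_map t (v q) i 0)) => //.
  by move=> p tp; rewrite (triv_linear tp) !mxE.
by apply: msmoothD => //; [apply: msmoothM => //; [exact: msmooth_cst|exact: su]|exact: sv].
Qed.

Lemma smooth_section_scale (f : M -> R[i]) u : msmooth_on setT f -> smooth_section u ->
  smooth_section (fun p => f p *: u p).
Proof.
move=> sf su t tt i.
have oD := triv_dom_open t.
apply: (@msmooth_ext _ _ _ _ (fun q => f q * triv_map t (u q) i 0)) => //.
  by move=> p tp; have := triv_linear tp (f p) (u p) 0; rewrite addr0 (triv_map0 tp) addr0 => ->; rewrite mxE.
by apply: msmoothM => //; [exact: msmooth_sub sf|exact: su].
Qed.

Lemma smooth_section0 : smooth_section (fun p => 0 : S p).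
Proof.
move=> t tt i; apply: (@msmooth_ext _ _ _ _ (fun=> 0)) (msmooth_cst _ _).
  exact: triv_dom_open.
by move=> p tp; rewrite triv_map0// mxE.
Qed.

Lemma supp_sub u (C : set M) : closed C -> (forall p, u p <> 0 -> C p) -> supp u `<=` C.
Proof. by move=> cC uC; rewrite /supp ((closure_id C).1 cC); exact: closure_subset. Qed.

Lemma compact_supp u (C : set M) : compact C -> (forall p, u p <> 0 -> C p) -> compact (supp u).
Proof.
move=> cC uC; apply: (subclosed_compact _ cC); first exact: closed_closure.
by apply: supp_sub => //; apply: compact_closed => //; exact: mfd_hausdorff.
Qed.

Lemma suppP u p : u p <> 0 -> supp u p.
Proof. by move=> up; exact: subset_closure. Qed.

Lemma smooth_cpt_lin (a : R[i]) u v : smooth_cpt u -> smooth_cpt v ->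
  smooth_cpt (fun p => a *: u p + v p).
Proof.
move=> [su cu] [sv cv]; split; first exact: smooth_section_lin.
apply: (@compact_supp _ (supp u `|` supp v)); first exact: compactU.
move=> p uvp; have [up|/eqP/suppP up] := eqVneq (u p) 0; last by left.
by right; apply: suppP => vp; apply: uvp; rewrite up vp scaler0 addr0.
Qed.

Lemma smooth_cpt_scale (f : M -> R[i]) u : msmooth_on setT f -> smooth_cpt u ->
  smooth_cpt (fun p => f p *: u p).
Proof.
move=> sf [su cu]; split; first exact: smooth_section_scale.
apply: (compact_supp cu) => p fu; apply: suppP => up; apply: fu.
by rewrite up scaler0.
Qed.

Lemma smooth_cpt0 : smooth_cpt (fun p => 0 : S p).
Proof.
split; first exact: smooth_section0.
by apply: (@compact_supp _ set0) => //; exact: compact0.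
Qed.

End trivializations.

Section differential_operators.
Context {R : realType} {n : nat} {M : manifold R n} {k : nat} {S : vbundle M k}.
Implicit Types (D : diffop S) (u v : section_of S) (p q : M).

Lemma diffop0 D p : D (fun q => 0) p = 0.
Proof.
have := diffop_linear D (-1) (@smooth_section0 _ _ _ _ S) (@smooth_section0 _ _ _ _ S) p.
rewrite scaleN1r addNr (_ : (fun q => _) = fun q => 0 : S q) //.
by apply: functional_extensionality_dep => q; rewrite scaler0 addr0.
Qed.

(** On the open complement of [C] the section agrees with the zero section, so locality and
    linearity make its image vanish there. *)
Lemma diffop_supp D u p (C : set M) : smooth_section u -> closed C ->
  (forall q, u q <> 0 -> C q) -> D u p <> 0 -> C p.
Proof.
move=> su cC uC; apply: contra_notP => Cp.
have := @diffop_local _ _ _ _ _ D u (fun q => 0) (~` C) su (@smooth_section0 _ _ _ _ S) (closed_openC cC).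
move=> /(_ _ p Cp) ->; first exact: diffop0.
by move=> q Cq; apply: contra_notP Cq => /uC.
Qed.

Lemma diffop_smooth_cpt D u : smooth_cpt u -> smooth_cpt (D u).
Proof.
move=> [su cu]; split; first exact: diffop_smooth.
apply: (compact_supp cu) => p.
have cs : closed (supp u) by exact: closed_closure.
by apply: (diffop_supp su cs) => q; exact: suppP.
Qed.

End differential_operators.

(* The cubes of radii [2 r], [3 r] and [4 r] will contain the supports of the
   cutoffs, of the mollified sections and of the coefficients of an operator. *)
Record patch (R : realType) n (M : manifold R n) k (S : vbundle M k)
    (mu : {measure set (borel M) -> \bar R}) := Patch {
  patch_chart : chart R n M;
  patch_triv : trivialization k S;
  patch_center : 'rV[R]_n;
  patch_radius : R;
  patch_bound : R;
  patch_is_chart : is_chart patch_chart;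
  patch_is_triv : is_triv patch_triv;
  patch_dom : chart_dom patch_chart = triv_dom patch_triv;
  patch_radius_gt0 : 0 < patch_radius;
  patch_ball : forall x, `|x - patch_center| <= 4 * patch_radius -> chart_img patch_chart x;
  patch_bound_ge0 : 0 <= patch_bound;
  patch_measure : forall A : set (borel 'rV[R]_n), measurable A -> A `<=` chart_img patch_chart ->
    (mu (chart_dom patch_chart `&` chart_map patch_chart @^-1` A) <=
       patch_bound%:E * lebesgue_rV n A /\
     lebesgue_rV n A <=
       patch_bound%:E * mu (chart_dom patch_chart `&` chart_map patch_chart @^-1` A))%E
}.

Section patches.
Context {R : realType} {n : nat} {M : manifold R n} {k : nat} {S : vbundle M k}.
Context {mu : {measure set (borel M) -> \bar R}} (P : patch S mu).
Local Notation c := (patch_chart P).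
Local Notation t := (patch_triv P).
Local Notation x0 := (patch_center P).
Local Notation r := (patch_radius P).
Implicit Types (u v : section_of S) (p q : M) (W : 'rV[R]_n -> 'cV[R[i]]_k) (x : 'rV[R]_n).

Definition patch_loc u x : 'cV[R[i]]_k := triv_map t (u (chart_inv c x)).

Definition patch_lift W : section_of S := fun p =>
  if `[< chart_dom c p >] then triv_inv t p (W (chart_map c p)) else 0.

Definition patch_cube : set M := chart_inv c @` [set x | `|x - x0| <= 3 * r].

Lemma patch_img x : `|x - x0| <= 3 * r -> chart_img c x.
Proof.
move=> xr; apply: patch_ball; apply: le_trans xr _.
by rewrite ler_pM2r ?patch_radius_gt0// ler_nat.
Qed.

Lemma compact_patch_cube : compact patch_cube.
Proof.
apply: continuous_compact; last exact: compact_closed_ball.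
apply: continuous_in_subspaceT => x; rewrite inE => /patch_img.
exact: chart_inv_continuous.
Qed.

Lemma closed_patch_cube : closed patch_cube.
Proof. by apply: compact_closed compact_patch_cube; exact: mfd_hausdorff. Qed.

(** The coordinate vectors that extend by zero to smooth sections: their support keeps away from the
    boundary of the chart. *)
Definition vtf W := (forall i, csmooth_on setT (fun x => W x i 0)) /\
  forall x, W x != 0 -> `|x - x0| <= 3 * r.

Lemma patch_lift_supp W p : vtf W -> patch_lift W p <> 0 -> patch_cube p.
Proof.
move=> [_ W0]; rewrite /patch_lift; case: asboolP => // cp Wp.
exists (chart_map c p); last by rewrite chart_mapK.
apply: W0; apply/eqP => W1; apply: Wp; rewrite W1 triv_inv0//.
by rewrite -patch_dom.
Qed.

Lemma patch_loc_lift W x : chart_img c x -> patch_loc (patch_lift W) x = W x.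
Proof.
move=> /chart_imgK[cx xE]; rewrite /patch_loc /patch_lift asboolT//.
by rewrite triv_invK ?xE// -patch_dom.
Qed.

(** The chart domain and the complement of the cube form an open cover, the cube being compact and
    hence closed; on the second set the extension is zero. *)
Lemma smooth_patch_lift W : vtf W -> smooth_cpt (patch_lift W).
Proof.
move=> vW; split; last exact: (compact_supp compact_patch_cube (fun p => patch_lift_supp vW)).
apply: smooth_section_local => p.
have [cp|ncp] := pselect (chart_dom c p).
  exists t, (chart_dom c); split=> //.
  - exact: patch_is_triv.
  - by rewrite -patch_dom.
  - exact: chart_dom_open.
  move=> i; rewrite -patch_dom setIid; apply: msmooth_local => q cq.
  exists c, (chart_dom c); split=> //.
  - exact: patch_is_chart.
  - exact: chart_dom_open.
  rewrite setIid; apply: csmooth_ext; last exact: csmooth_sub (vW.1 i).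
    exact: chart_img_open.
  by move=> _ [s cs <-]; rewrite -[in LHS](patch_loc_lift W)//; exists s.
have [s Bs sp] := vb_atlas_cover S p.
exists s, (~` patch_cube); split=> //.
- exact: atlas_is_triv.
- move=> [x /patch_img/chart_imgK[cx _] xp]; apply: ncp; by rewrite -xp.
- exact/closed_openC/closed_patch_cube.
move=> i; apply: (@msmooth_ext _ _ _ _ (fun=> 0)) (msmooth_cst _ _).
  by apply: openI; [exact/closed_openC/closed_patch_cube|exact: triv_dom_open].
move=> q [Cq sq]; have -> : patch_lift W q = 0.
  by apply: contrapT => /(patch_lift_supp vW).
by rewrite triv_map0// mxE.
Qed.

Lemma patch_loc_smooth u i : smooth_section u ->
  csmooth_on (chart_img c) (fun x => patch_loc u x i 0).
Proof.
move=> su; have := su t (patch_is_triv P) i c (patch_is_chart P).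
by rewrite -patch_dom setIid.
Qed.

Lemma patch_lift_lin (a : R[i]) W1 W2 p :
  patch_lift (fun x => a *: W1 x + W2 x) p = a *: patch_lift W1 p + patch_lift W2 p.
Proof.
rewrite /patch_lift; case: asboolP => [cp|_]; last by rewrite scaler0 addr0.
by rewrite triv_inv_linear// -patch_dom.
Qed.

Lemma patch_loc_lin (a : R[i]) u v x : chart_img c x ->
  patch_loc (fun p => a *: u p + v p) x = a *: patch_loc u x + patch_loc v x.
Proof.
by move=> /chart_imgK[cx _]; rewrite /patch_loc triv_linear// -patch_dom.
Qed.

End patches.

(** * The energy of a section *)

Section hermitian_forms.
Context {R : realType} {n : nat} {M : manifold R n} {k : nat} {S : vbundle M k}.
Variable h : hermitian_metric S.
Local Notation Re := complex.Re.
Local Notation Im := complex.Im.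
Implicit Types (p : M) (z : R[i]).

Definition hnorm2 p (x : S p) : R := Re (h p x x).

Definition csq z : R := Re z ^+ 2 + Im z ^+ 2.

Lemma csq_ge0 z : 0 <= csq z.
Proof. by rewrite addr_ge0// sqr_ge0. Qed.

Lemma Re_opp z : Re (- z) = - Re z. Proof. by case: z. Qed.
Lemma Im_conj z : Im z^* = - Im z. Proof. by case: z. Qed.

Lemma eq_complexP z1 z2 : Re z1 = Re z2 -> Im z1 = Im z2 -> z1 = z2.
Proof. by case: z1 => a b; case: z2 => a' b' /= -> ->. Qed.

Lemma herm_lin p (y : S p) a (x x' : S p) : h p (a *: x + x') y = a * h p x y + h p x' y.
Proof. exact: herm_linear. Qed.

Lemma herm0l p (y : S p) : h p 0 y = 0.
Proof. by have := herm_lin y (-1) 0 0; rewrite scaler0 addr0 mulN1r addNr. Qed.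

Lemma herm_lin_r p (y : S p) a (x x' : S p) : h p y (a *: x + x') = a^* * h p y x + h p y x'.
Proof.
by rewrite (herm_sym h (a *: x + x') y) herm_lin (herm_sym h x y) (herm_sym h x' y) rmorphD rmorphM.
Qed.

Lemma herm0r p (y : S p) : h p y 0 = 0.
Proof. by rewrite (herm_sym h) herm0l rmorph0. Qed.

Lemma herm_self_Im p (x : S p) : Im (h p x x) = 0.
Proof.
have /(congr1 (fun z : R[i] => Im z)) := herm_sym h x x; rewrite Im_conj => e.
lra.
Qed.

Lemma herm_selfE p (x : S p) : h p x x = (hnorm2 x)%:C%C.
Proof. by apply: eq_complexP => //=; exact: herm_self_Im. Qed.

Lemma hnorm2_ge0 p (x : S p) : 0 <= hnorm2 x.
Proof.
have [->|x0] := eqVneq x 0; first by rewrite /hnorm2 herm0l.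
by have := herm_pos h x0; rewrite herm_selfE ltcR => /ltW.
Qed.

Lemma hnorm2_eq0 p (x : S p) : hnorm2 x = 0 -> x = 0.
Proof.
move=> x0; apply/eqP/negPn/negP => /(herm_pos h).
by rewrite herm_selfE x0 ltxx.
Qed.

Lemma hnorm2_lin p a (x y : S p) :
  hnorm2 (a *: x + y) = csq a * hnorm2 x + 2 * Re (a * h p x y) + hnorm2 y.
Proof.
rewrite /hnorm2 herm_lin !herm_lin_r (herm_sym h x y) !herm_selfE.
case: a => a b; case: (h p x y) => c d /=; rewrite /csq /=.
by simpc; rewrite /=; ring.
Qed.

(** The norm of [y - s z^* x], with [z] the inner product and [s] real, is a nonnegative quadratic
    in [s]. Its discriminant gives the inequality multiplied by [csq z], which is then cancelled. *)
Lemma herm_CS p (x y : S p) : csq (h p x y) <= hnorm2 x * hnorm2 y.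
Proof.
set z := h p x y.
have q (s : R) : 0 <= hnorm2 y - 2 * s * csq z + s ^+ 2 * (csq z * hnorm2 x).
  have := hnorm2_ge0 ((- s)%:C%C * z^* *: x + y); rewrite hnorm2_lin -/z.
  congr (0 <= _); case: z => a b; rewrite /csq /=.
  by simpc; rewrite /=; ring.
have c0 := csq_ge0 z.
have := quadratic_ge0 (mulr_ge0 c0 (hnorm2_ge0 x)) q.
have [->|cz] := eqVneq (csq z) 0; first by rewrite mulr_ge0 ?hnorm2_ge0.
by rewrite expr2 -mulrA ler_pM2l// lt_def cz.
Qed.

Lemma hnorm2D p (x y : S p) : hnorm2 (x + y) <= 2 * hnorm2 x + 2 * hnorm2 y.
Proof.
have := hnorm2_ge0 ((-1) *: x + y); rewrite hnorm2_lin.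
have := hnorm2_lin 1 x y; rewrite scale1r => ->.
by rewrite mul1r mulN1r /csq /= Re_opp; lra.
Qed.

Lemma hnorm2Z p a (x : S p) : hnorm2 (a *: x) = csq a * hnorm2 x.
Proof. by rewrite -[a *: x]addr0 hnorm2_lin herm0r mulr0 /= mulr0 /hnorm2 herm0l /= !addr0. Qed.

Lemma hnorm2_sum p (I : Type) (s : seq I) (x : I -> S p) :
  hnorm2 (\sum_(i <- s) x i) <= 2 ^+ size s * \sum_(i <- s) hnorm2 (x i).
Proof.
elim: s => [|i s IH]; first by rewrite !big_nil /hnorm2 herm0l mulr0.
rewrite !big_cons /= exprS; apply: le_trans (hnorm2D _ _) _.
have s1 : (1 : R) <= 2 ^+ size s by rewrite exprn_ege1// ler1n.
have x0 := hnorm2_ge0 (x i); rewrite -mulrA mulrDr mulrDr; apply: lerD; last first.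
  by rewrite ler_pM2l.
by rewrite ler_pM2l// ler_peMl.
Qed.

End hermitian_forms.

Section csmooth_det.
Context {R : realType} {n : nat}.

Lemma csmooth_prod (V : set 'rV[R]_n) (I : Type) (s : seq I) (F : I -> 'rV[R]_n -> R[i]) : open V ->
  (forall i, csmooth_on V (F i)) -> csmooth_on V (fun x => \prod_(i <- s) F i x).
Proof.
move=> oV sF; elim: s => [|i s IH].
  rewrite (_ : (fun x => _) = fun=> 1); first exact: csmooth_cst.
  by apply/funext => x; rewrite big_nil.
rewrite (_ : (fun x => _) = fun x => F i x * \prod_(i <- s) F i x); first exact: csmoothM.
by apply/funext => x; rewrite big_cons.
Qed.

Lemma csmooth_det (V : set 'rV[R]_n) m (A : 'rV[R]_n -> 'M[R[i]]_m) : open V ->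
  (forall i j, csmooth_on V (fun x => A x i j)) -> csmooth_on V (fun x => \det (A x)).
Proof.
move=> oV sA; apply: csmooth_sum => // s.
apply: csmoothM => //; first exact: csmooth_cst.
exact: csmooth_prod.
Qed.

(** Each entry is a signed minor, hence a polynomial in the entries of the matrix. *)
Lemma csmooth_adj (V : set 'rV[R]_n) m (A : 'rV[R]_n -> 'M[R[i]]_m) i j : open V ->
  (forall i j, csmooth_on V (fun x => A x i j)) -> csmooth_on V (fun x => \adj (A x) i j).
Proof.
move=> oV sA.
rewrite (_ : (fun x => _) = fun x => (-1) ^+ (j + i) * \det (row' j (col' i (A x)))).
  apply: csmoothM => //; first exact: csmooth_cst.
  apply: csmooth_det => // a b.
  rewrite (_ : (fun x => _) = fun x => A x (lift j a) (lift i b)) //.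
  by apply/funext => x; rewrite !mxE.
by apply/funext => x; rewrite mxE.
Qed.

Lemma continuous_bounded_ball (V : set 'rV[R]_n) (f : 'rV[R]_n -> R) x0 r :
  (forall x, V x -> {for x, continuous f}) -> (forall x, `|x - x0| <= r -> V x) ->
  exists2 B : R, 0 <= B & forall x, `|x - x0| <= r -> `|f x| <= B.
Proof.
move=> cf rV.
have cfr : {within [set x | `|x - x0| <= r], continuous f}.
  by apply: continuous_in_subspaceT => x; rewrite inE => /rV; exact: cf.
have := compact_bounded (continuous_compact cfr (@compact_closed_ball R n x0 r)).
move=> [B [Br BP]]; exists (`|B| + 1); first by rewrite addr_ge0.
move=> x xr; apply: BP; first by rewrite (le_lt_trans (ler_norm _))// ltrDl.
by exists x.
Qed.

Lemma csq_bounded (V : set 'rV[R]_n) (f : 'rV[R]_n -> R[i]) x0 r : csmooth_on V f ->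
  (forall x, `|x - x0| <= r -> V x) ->
  exists2 B : R, 0 <= B & forall x, `|x - x0| <= r -> csq (f x) <= B.
Proof.
move=> [rf jf] rV.
have [B1 B10 h1] := continuous_bounded_ball (fun x => smooth_continuous (x := x) rf) rV.
have [B2 B20 h2] := continuous_bounded_ball (fun x => smooth_continuous (x := x) jf) rV.
exists (B1 ^+ 2 + B2 ^+ 2) => [|x xr]; first by rewrite addr_ge0// sqr_ge0.
apply: lerD; rewrite -real_normK ?num_real// lerXn2r// ?nnegrE//; [exact: h1|exact: h2].
Qed.

Lemma csq_bounded_below (V : set 'rV[R]_n) (f : 'rV[R]_n -> R[i]) x0 r : csmooth_on V f ->
  (forall x, `|x - x0| <= r -> V x) -> (forall x, `|x - x0| <= r -> f x != 0) ->
  exists2 b : R, 0 < b & forall x, `|x - x0| <= r -> b <= csq (f x).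
Proof.
move=> [rf jf] rV f0; have [r0|r0] := ltP r 0.
  (* The ball is empty for negative radius, so any positive bound serves; otherwise it is nonempty
     and compact and the minimum is attained. *)
  exists 1 => // x xr; have := le_lt_trans (normr_ge0 _) (le_lt_trans xr r0).
  by rewrite ltxx.
have cf : {within [set x | `|x - x0| <= r], continuous (fun x => csq (f x))}.
  apply: continuous_in_subspaceT => x; rewrite inE => /rV Vx.
  have c1 := smooth_continuous rf Vx; have c2 := smooth_continuous jf Vx.
  exact: (cvgD (cvgM c1 c1) (cvgM c2 c2)).
have ne : [set x | `|x - x0| <= r] !=set0 by exists x0; rewrite /= subrr normr0.
have [c cr cmin] := EVT_min_rV ne (@compact_closed_ball R n x0 r) cf.
rewrite inE /= in cr.
exists (csq (f c)); last by move=> x xr; apply: cmin; rewrite inE.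
rewrite lt_def csq_ge0 andbT; apply: contra (f0 c cr).
by rewrite /csq paddr_eq0 ?sqr_ge0// !sqrf_eq0 eq_complex.
Qed.

End csmooth_det.

Section local_bounds.
Context {R : realType} {n : nat} {M : manifold R n} {k : nat} {S : vbundle M k}.
Context {mu : {measure set (borel M) -> \bar R}} (h : hermitian_metric S) (P : patch S mu).
Local Notation c := (patch_chart P).
Local Notation t := (patch_triv P).
Local Notation x0 := (patch_center P).
Local Notation r := (patch_radius P).
Implicit Types (p : M) (x : 'rV[R]_n) (w : 'cV[R[i]]_k).

Definition gram x : 'M[R[i]]_k := \matrix_(i, j)
  h (chart_inv c x) (triv_inv t _ (delta_mx i 0)) (triv_inv t _ (delta_mx j 0)).

Lemma csmooth_gram i j : csmooth_on (chart_img c) (fun x => gram x i j).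
Proof.
have := herm_smooth h (patch_is_triv P) i j (patch_is_chart P).
rewrite -patch_dom setIid; congr csmooth_on.
by apply/funext => x; rewrite mxE.
Qed.

Lemma herm_sum_l p (y : S p) (a : 'I_k -> R[i]) (x : 'I_k -> S p) :
  h p (\sum_l a l *: x l) y = \sum_l a l * h p (x l) y.
Proof.
elim/big_rec2: _ => [|l z1 z2 _ IH]; first exact: herm0l.
by rewrite herm_lin IH.
Qed.

Lemma herm_sum_r p (y : S p) (a : 'I_k -> R[i]) (x : 'I_k -> S p) :
  h p y (\sum_l a l *: x l) = \sum_l (a l)^* * h p y (x l).
Proof.
elim/big_rec2: _ => [|l z1 z2 _ IH]; first exact: herm0r.
by rewrite herm_lin_r IH.
Qed.

Lemma triv_inv_delta x w : chart_img c x -> triv_inv t (chart_inv c x) w =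
  \sum_l w l 0 *: triv_inv t (chart_inv c x) (delta_mx l 0).
Proof.
move=> /chart_imgK[cx _]; rewrite {1}(cV_delta w) triv_inv_sum//.
by rewrite -patch_dom.
Qed.

(** A null vector of the Gram matrix would give a fibre vector orthogonal to a spanning family,
    hence to itself. *)
Lemma gram_det_neq0 x : chart_img c x -> \det (gram x) != 0.
Proof.
move=> ix; have [cx _] := chart_imgK ix; apply/negP => /det0P[v v0 vG].
have tx : triv_dom t (chart_inv c x) by rewrite -patch_dom.
set y := triv_inv t (chart_inv c x) v^T.
have yE : y = \sum_l v 0 l *: triv_inv t (chart_inv c x) (delta_mx l 0).
  by rewrite /y triv_inv_delta//; apply: eq_bigr => l _; rewrite mxE.
have hy j : h _ y (triv_inv t _ (delta_mx j 0)) = 0.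
  rewrite yE herm_sum_l; have /rowP/(_ j) := vG; rewrite !mxE => e; rewrite -[RHS]e.
  by apply: eq_bigr => l _; rewrite mxE.
have y0 : y = 0.
  apply: (@hnorm2_eq0 _ _ _ _ _ h); rewrite /hnorm2 {2}yE herm_sum_r big1// => l _.
  by rewrite hy mulr0.
have : v^T = 0 by rewrite -(triv_invK tx v^T) -/y y0 triv_map0.
by move=> /(congr1 trmx); rewrite trmxK trmx0 => v1; rewrite v1 eqxx in v0.
Qed.

Lemma csqM (a b : R[i]) : csq (a * b) = csq a * csq b.
Proof. by rewrite /csq Re_mul Im_mul; ring. Qed.

Lemma csq_conj (a : R[i]) : csq a^* = csq a.
Proof. by case: a => x y; rewrite /csq /= sqrrN. Qed.

(** Expanding in the frame, the norm is controlled by the diagonal Gram entries, which are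
    continuous on the compact cube. *)
Lemma hnorm2_upper : exists2 C : R, 0 <= C & forall x w, `|x - x0| <= 3 * r ->
  hnorm2 h (triv_inv t (chart_inv c x) w) <= C * \sum_l csq (w l 0).
Proof.
have /choice[b bP] : forall l : 'I_k, exists b : R, 0 <= b /\
    forall x, `|x - x0| <= 3 * r -> `|complex.Re (gram x l l)| <= b.
  move=> l; have [rg _] := csmooth_gram l l.
  have [b b0 bP] := continuous_bounded_ball (fun x => smooth_continuous (x := x) rg) (@patch_img _ _ _ _ _ _ P).
  by exists b.
pose B := \sum_l b l.
have bB l : b l <= B by rewrite /B (bigD1 l)//= lerDl sumr_ge0// => i _; have [] := bP i.
have B0 : 0 <= B by apply: sumr_ge0 => i _; have [] := bP i.
exists (2 ^+ size (index_enum 'I_k) * B) => [|x w xr]; first by rewrite mulr_ge0.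
rewrite triv_inv_delta; last exact: patch_img.
apply: le_trans (hnorm2_sum _ _ _) _; rewrite -mulrA ler_pM2l; last by rewrite exprn_gt0.
rewrite mulr_sumr; apply: ler_sum => l _; rewrite hnorm2Z mulrC.
apply: ler_wpM2r; first exact: csq_ge0.
have [_ /(_ x xr)] := bP l; rewrite mxE => h1.
by apply: le_trans (bB l); apply: le_trans h1; exact: ler_norm.
Qed.

(** Cramer's rule isolates a coordinate: pairing [w] with a suitable vector built from the adjugate
    gives the determinant times [w l 0]. Cauchy-Schwarz then bounds it, the determinant being
    bounded away from 0 on the compact cube. *)
Lemma hnorm2_lower : exists2 C : R, 0 <= C & forall x w l, `|x - x0| <= 3 * r ->
  csq (w l 0) <= C * hnorm2 h (triv_inv t (chart_inv c x) w).
Proof.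
have [C C0 hC] := hnorm2_upper.
have oV := chart_img_open (c := c).
have [b b0 bP] := csq_bounded_below (csmooth_det oV csmooth_gram) (@patch_img _ _ _ _ _ _ P)
  (fun x xr => gram_det_neq0 (patch_img xr)).
have /choice[A AP] : forall l : 'I_k, exists A : 'I_k -> R, forall j, 0 <= A j /\
    forall x, `|x - x0| <= 3 * r -> csq (\adj (gram x) j l) <= A j.
  move=> l; suff /choice[A AP] : forall j, exists a : R, 0 <= a /\
    forall x, `|x - x0| <= 3 * r -> csq (\adj (gram x) j l) <= a by exists A.
  move=> j; have [a a0 aP] := csq_bounded (csmooth_adj j l oV csmooth_gram) (@patch_img _ _ _ _ _ _ P).
  by exists a.
pose B := \sum_l \sum_j A l j.
have A0 l j : 0 <= A l j by have [] := AP l j.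
have bB l : \sum_j A l j <= B.
  by rewrite /B [leRHS](bigD1 l)//= lerDl sumr_ge0// => i _; rewrite sumr_ge0.
have B0 : 0 <= B by apply: sumr_ge0 => l _; rewrite sumr_ge0.
exists (C * B / b) => [|x w l xr]; first by rewrite divr_ge0// ?mulr_ge0// ltW.
set q := hnorm2 h _; have q0 : 0 <= q by exact: hnorm2_ge0.
have ix := patch_img xr.
(* The conjugate undoes the conjugate-linearity of the inner product in its second argument. *)
pose d : 'cV[R[i]]_k := \col_j (\adj (gram x) j l)^*.
have e : h _ (triv_inv t (chart_inv c x) w) (triv_inv t (chart_inv c x) d) = \det (gram x) * w l 0.
  rewrite (triv_inv_delta w ix) herm_sum_l.
  transitivity (\sum_i w i 0 * (gram x *m \adj (gram x)) i l).
    apply: eq_bigr => i _; congr (_ * _).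
    rewrite (triv_inv_delta d ix) herm_sum_r mxE; apply: eq_bigr => j _.
    by rewrite !mxE conjCK mulrC.
  rewrite mul_mx_adj (bigD1 l)//= mxE eqxx mulr1n big1 ?addr0 1?mulrC// => i il.
  by rewrite mxE (negbTE il) mulr0.
have := herm_CS h (triv_inv t (chart_inv c x) w) (triv_inv t (chart_inv c x) d).
rewrite e csqM -/q => cs.
have dC : hnorm2 h (triv_inv t (chart_inv c x) d) <= C * B.
  apply: le_trans (hC _ _ xr) _; apply: ler_wpM2l => //; apply: le_trans (bB l).
  by apply: ler_sum => j _; rewrite mxE csq_conj; have [_ /(_ x xr)] := AP l j.
rewrite mulrAC ler_pdivlMr// mulrC.
apply: le_trans (_ : csq (\det (gram x)) * csq (w l 0) <= _).
  by apply: ler_wpM2r; [exact: csq_ge0|exact: bP].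
by apply: le_trans cs _; rewrite mulrC; apply: ler_wpM2r.
Qed.

End local_bounds.

Section herm_smooth.
Context {R : realType} {n : nat} {M : manifold R n} {k : nat} {S : vbundle M k}.
Variable (h : hermitian_metric S).
Implicit Types (u v : section_of S).

Lemma msmooth_conj (U : set M) (f : M -> R[i]) : open U -> msmooth_on U f -> msmooth_on U (fun p => (f p)^*).
Proof.
move=> oU sf c cc; have [rf jf] := sf c cc; split.
  rewrite (_ : (fun x => _) = fun x => complex.Re ((f \o chart_inv c) x))//.
  by apply/funext => x /=; case: (f _).
rewrite (_ : (fun x => _) = fun x => - complex.Im ((f \o chart_inv c) x)).
  by apply: smoothN => //; exact: chart_img_openI.
by apply/funext => x /=; case: (f _).
Qed.

Lemma msmooth_herm u v : smooth_section u -> smooth_section v ->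
  msmooth_on setT (fun p => h p (u p) (v p)).
Proof.
move=> su sv; apply: msmooth_pt => p _.
have [t Bt tp] := vb_atlas_cover S p; have tt := atlas_is_triv Bt.
have oD := triv_dom_open t.
exists (triv_dom t); split=> //.
apply: (@msmooth_ext _ _ _ _ (fun p => \sum_i triv_map t (u p) i 0 *
   \sum_j (triv_map t (v p) j 0)^* * h p (triv_inv t p (delta_mx i 0)) (triv_inv t p (delta_mx j 0)))) => //.
  move=> q tq; rewrite -[in RHS](triv_mapK tq (u q)) -[in RHS](triv_mapK tq (v q)).
  rewrite [in RHS](cV_delta (triv_map t (u q))) [in RHS](cV_delta (triv_map t (v q))).
  rewrite !triv_inv_sum// herm_sum_l; apply: eq_bigr => i _.
  by rewrite herm_sum_r.
apply: msmooth_sum => // i; apply: msmoothM => //; first exact: su.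
apply: msmooth_sum => // j; apply: msmoothM => //; last exact: herm_smooth.
by apply: msmooth_conj => //; exact: sv.
Qed.

Lemma hnorm2_continuous u : smooth_section u -> continuous (fun p => hnorm2 h (u p)).
Proof.
by move=> su p; have [] := msmooth_continuous openT (I : setT p) (msmooth_herm su su).
Qed.

End herm_smooth.

(** * The measure of the manifold read in a chart *)

Section patch_measure.
Context {R : realType} {n : nat} {M : manifold R n} {k : nat} {S : vbundle M k}.
Context {mu : {measure set (borel M) -> \bar R}} (P : patch S mu).
Local Notation c := (patch_chart P).
Local Notation x0 := (patch_center P).
Local Notation r := (patch_radius P).
Local Notation L := (patch_bound P).
Local Notation leb := (@lebesgue_rV R n).
Implicit Types (p : M) (x : 'rV[R]_n).

Lemma open_chart_preimage (U : set 'rV[R]_n) (d : chart R n M) : open U ->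
  open (chart_dom d `&` chart_map d @^-1` U).
Proof.
move=> oU; rewrite openE => p [dp Up].
have n1 : \forall q \near p, chart_dom d q.
  by have := chart_dom_open d; rewrite openE => /(_ _ dp).
have n2 : \forall q \near p, U (chart_map d q).
  by apply: (chart_map_continuous dp); move: oU; rewrite openE => /(_ _ Up).
exact: filterS2 n1 n2.
Qed.

Let dom_measurable : measurable (chart_dom c : set (borel M)).
Proof. by apply: measurable_open; exact: chart_dom_open. Qed.

Let img_measurable : measurable (chart_img c : set (borel 'rV[R]_n)).
Proof. by apply: measurable_open; exact: chart_img_open. Qed.

(* [chart_map] need not be measurable off its domain. *)
Let e (p : borel M) : borel 'rV[R]_n := if `[< chart_dom c p >] then chart_map c p else 0.

Let measurable_e : measurable_fun setT e.
Proof.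
have := @measurability _ _ (borel M) (borel 'rV[R]_n) setT e (@open 'rV[R]_n) erefl; apply.
move=> _ [U oU <-]; rewrite setTI.
have mU : measurable (chart_dom c `&` chart_map c @^-1` U : set (borel M)).
  by apply: measurable_open; exact: open_chart_preimage.
have [U0|U0] := pselect (U 0).
  rewrite (_ : e @^-1` U = (chart_dom c `&` chart_map c @^-1` U) `|` ~` chart_dom c).
    by apply: measurableU => //; exact: measurableC.
  apply/seteqP; split=> p; rewrite /e /=; case: asboolP => cp.
  - by left.
  - by right.
  - by case=> [[_]|].
  - by case=> // -[].
rewrite (_ : e @^-1` U = chart_dom c `&` chart_map c @^-1` U)//.
by apply/seteqP; split=> p; rewrite /e /=; case: asboolP => cp //; case.
Qed.

(** The chart's share of [mu] as a measure on the whole coordinate space, concentrated on the chart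
    image. *)
Let nu := image_measure (mrestr mu dom_measurable) measurable_e.

Let nuE (A : set (borel 'rV[R]_n)) :
  nu A = mu (chart_dom c `&` chart_map c @^-1` (A `&` chart_img c)).
Proof.
rewrite /nu /= /pushforward /mrestr; congr (mu _); apply/seteqP; split=> p /=.
  by rewrite /e => -[]; case: asboolP => // cp Ap _; split=> //; split=> //; exists p.
by move=> [cp [Ap _]]; rewrite /e asboolT.
Qed.

Let integral_nu (g : 'rV[R]_n -> R) : continuous g -> (forall x, 0 <= g x) ->
  (\int[nu]_x (g x)%:E = \int[mu]_(p in chart_dom c) (g (chart_map c p))%:E)%E.
Proof.
move=> cg g0.
have mg : measurable_fun setT (EFin \o g : borel 'rV[R]_n -> \bar R).
  by apply/measurable_EFinP; exact: measurable_continuous.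
have mge : measurable_fun setT (fun p : borel M => (g (e p))%:E : \bar R).
  exact: (measurableT_comp mg measurable_e).
rewrite (@ge0_integral_image _ _ _ _ _ (mrestr mu dom_measurable) _ measurable_e (EFin \o g))//.
transitivity (\int[mrestr mu dom_measurable]_(p in chart_dom c) (g (e p))%:E)%E.
  rewrite -(setUv (chart_dom c)) ge0_integral_setU//.
  - rewrite [X in (_ + X)%E]null_set_integral ?adde0//.
    + exact: measurableC.
    + exact: measurable_funTS.
    + by rewrite /= /mrestr setICl measure0.
  - exact: measurableC.
  - by rewrite setUv.
  - by move=> p _; rewrite lee_fin.
  - by apply/disj_setPS; rewrite setICr.
transitivity (\int[mu]_(p in chart_dom c) (g (e p))%:E)%E.
  apply: eq_measure_integral => A mA AD.
  by rewrite /= /mrestr setIidl.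
by apply: eq_integral => p; rewrite inE => cp; rewrite /e asboolT.
Qed.

(** The comparison of measures holds on every measurable set, so it passes to integrals of
    nonnegative functions; [L'] recasts the bound as a scaling of Lebesgue measure. *)
Lemma patch_integral_le (g : 'rV[R]_n -> R) : continuous g -> (forall x, 0 <= g x) ->
  (\int[mu]_(p in chart_dom c) (g (chart_map c p))%:E <= L%:E * \int[leb]_x (g x)%:E)%E.
Proof.
move=> cg g0; rewrite -integral_nu//.
have mg : measurable_fun setT (EFin \o g : borel 'rV[R]_n -> \bar R).
  by apply/measurable_EFinP; exact: measurable_continuous.
pose L' := NngNum (patch_bound_ge0 P).
rewrite -[L]/(L'%:num) -ge0_integral_mscale//; last by move=> x _; rewrite lee_fin.
apply: ge0_le_measure_integral => // A mA.
rewrite [leLHS]nuE; have mAi : measurable (A `&` chart_img c) by exact: measurableI.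
have [h _] := patch_measure mAi (@subIsetr _ A (chart_img c)).
apply: le_trans h _; rewrite /mscale /=; apply: lee_wpmul2l.
  by rewrite lee_fin; exact: patch_bound_ge0.
have := le_measure leb (x := A `&` chart_img c) (y := A).
by rewrite !inE; apply=> //; exact: subIsetl.
Qed.

Lemma patch_integral_ge (g : 'rV[R]_n -> R) : continuous g -> (forall x, 0 <= g x) ->
  (\int[leb]_(x in chart_img c) (g x)%:E <=
   L%:E * \int[mu]_(p in chart_dom c) (g (chart_map c p))%:E)%E.
Proof.
move=> cg g0; rewrite -integral_nu//.
have mg : measurable_fun setT (EFin \o g : borel 'rV[R]_n -> \bar R).
  by apply/measurable_EFinP; exact: measurable_continuous.
pose L' := NngNum (patch_bound_ge0 P).
rewrite -[L]/(L'%:num) -ge0_integral_mscale//; last by move=> x _; rewrite lee_fin.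
apply: le_trans (_ : \int[mrestr leb img_measurable]_(x in chart_img c) (g x)%:E <= _)%E.
  rewrite le_eqVlt; apply/orP; left; apply/eqP.
  by apply: eq_measure_integral => A mA AD; rewrite /= /mrestr setIidl.
apply: le_trans (_ : \int[mrestr leb img_measurable]_x (g x)%:E <= _)%E.
  by apply: ge0_subset_integral => // x _; rewrite lee_fin.
apply: ge0_le_measure_integral => // A mA.
suff : (leb (A `&` chart_img c) <= L%:E * nu A)%E by [].
rewrite nuE; have mAi : measurable (A `&` chart_img c) by exact: measurableI.
by have [_] := patch_measure mAi (@subIsetr _ A (chart_img c)).
Qed.

End patch_measure.

Section patch_existence.
Context {R : realType} {n : nat} {M : manifold R n} {k : nat} (S : vbundle M k).
Context (mu : {measure set (borel M) -> \bar R}).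
Local Notation leb := (@lebesgue_rV R n).

Lemma measurable_continuous_on (T : ptopologicalType) (V : set T) (f : T -> R) : open V ->
  (forall x, V x -> {for x, continuous f}) ->
  measurable_fun (V : set (borel T)) (f : borel T -> measurableTypeR R).
Proof.
move=> oV cf; apply: (measurability _ (RGenOInfty.measurableE R)) => //.
move=> _ [_ [a ->] <-]; apply: measurable_open.
rewrite openE => x [Vx ax].
have n1 : \forall y \near x, V y by move: oV; rewrite openE => /(_ _ Vx).
have n2 : \forall y \near x, `]a, +oo[%classic (f y).
  apply: (cf x Vx); have := @interval_open R (BRight a) +oo%O.
  by rewrite openE => /(_ isT isT) /(_ _ ax).
exact: filterS2 n1 n2.
Qed.

(** The first half integrates [f <= L]; the second integrates [1 <= L * f], which is the bound on
    the inverse of the density. *)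
Lemma density_measure_le (c : chart R n M) (f : 'rV[R]_n -> R) (L : R)
    (A : set (borel 'rV[R]_n)) :
  is_smooth_density mu c f ->
  (forall x, chart_img c x -> `|f x| <= L /\ `|(f x)^-1| <= L) ->
  0 <= L -> measurable A -> A `<=` chart_img c ->
  (mu (chart_dom c `&` chart_map c @^-1` A) <= L%:E * leb A /\
   leb A <= L%:E * mu (chart_dom c `&` chart_map c @^-1` A))%E.
Proof.
move=> [sf f0 df] fL L0 mA Ac; rewrite df//.
have mf : measurable_fun A (EFin \o f : borel 'rV[R]_n -> \bar R).
  apply/measurable_EFinP; apply: measurable_funS Ac _ => //.
    by apply: measurable_open; exact: chart_img_open.
  apply: measurable_continuous_on; first exact: chart_img_open.
  by move=> x cx; exact: (smooth_continuous sf cx).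
have f0' x : A x -> (0 <= (f x)%:E)%E by move=> /Ac/f0/ltW; rewrite lee_fin.
split.
  rewrite -integral_cst//; apply: ge0_le_integral => //.
  move=> x /Ac cx; rewrite lee_fin; have [h _] := fL x cx.
  exact: le_trans (ler_norm _) h.
have L0' : (0 <= L%:E)%E by rewrite lee_fin.
rewrite -(ge0_integralZl leb mA mf f0' L0').
rewrite -[leLHS]mul1e -integral_cst//; apply: ge0_le_integral => //.
- exact: measurable_funeM.
- move=> x /Ac cx; rewrite -EFinM lee_fin; have [_ h] := fL x cx.
  by rewrite -ler_pdivrMr ?f0// div1r; apply: le_trans (ler_norm _) h.
Qed.

Lemma exists_patch : uniformly_bounded_densities mu -> forall p : M, exists P : patch S mu,
  chart_dom (patch_chart P) p /\ patch_center P = chart_map (patch_chart P) p.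
Proof.
move=> [B [L [[Bc Bcov] BL]]] p.
have [c Bcc cp] := Bcov p; have [f df fL] := BL c Bcc.
have [t Bt tp] := vb_atlas_cover S p.
pose c' := chart_restr c (triv_dom_open t).
pose t' := triv_restr t (chart_dom_open c).
have L0 : 0 <= L.
  have [h _] := fL (chart_map c p) (ex_intro2 _ _ p cp erefl).
  exact: le_trans (normr_ge0 _) h.
have ip : chart_img c' (chart_map c p) by exists p.
have : \forall x \near chart_map c p, chart_img c' x.
  by have := chart_img_open (c := c'); rewrite openE => /(_ _ ip).
move=> /nbhs_normP[d /= d0 dP].
(* With radius [d / 8] the cube of radius [4 r] is the one of radius [d / 2], strictly inside the
   ball on which the chart image is known. *)
have r0 : 0 < d / 8 by rewrite divr_gt0.
have ball x : `|x - chart_map c p| <= 4 * (d / 8) -> chart_img c' x.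
  move=> xr; apply: dP; rewrite /ball_/= distrC; apply: le_lt_trans xr _; lra.
have meas (A : set (borel 'rV[R]_n)) : measurable A -> A `<=` chart_img c' ->
    (mu (chart_dom c' `&` chart_map c' @^-1` A) <= L%:E * leb A /\
     leb A <= L%:E * mu (chart_dom c' `&` chart_map c' @^-1` A))%E.
  move=> mA Ac'.
  have Ac : A `<=` chart_img c by move=> x /Ac'[q [cq _] <-]; exists q.
  have -> : chart_dom c' `&` chart_map c' @^-1` A = chart_dom c `&` chart_map c @^-1` A.
    apply/seteqP; split=> q /=; first by move=> [[cq _] Aq].
    move=> [cq Aq]; split=> //; split=> //; have [s [cs ts] e] := Ac' _ Aq.
    by rewrite -(chart_mapK cq) -e (chart_mapK cs).
  exact: (density_measure_le df fL L0 mA Ac).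
exists (@Patch R n M k S mu c' t' (chart_map c p) (d / 8) L
  (is_chart_restr _ (Bc c Bcc)) (is_triv_restr _ (atlas_is_triv Bt)) (setIC _ _) r0 ball L0 meas).
by [].
Qed.

Definition patch_core (P : patch S mu) : set M := chart_dom (patch_chart P) `&`
  chart_map (patch_chart P) @^-1` [set x | `|x - patch_center P| < patch_radius P].

Lemma open_norm_ball (x0 : 'rV[R]_n) (r : R) : open [set x | `|x - x0| < r].
Proof.
rewrite openE => x /= xr; suff : \forall y \near x, `|y - x0| < r by [].
apply/nbhs_normP; exists (r - `|x - x0|) => /= [|y]; first by rewrite subr_gt0.
rewrite /ball_/= distrC ltrBrDr => xy; apply: le_lt_trans xy.
by rewrite -[y in leLHS](subrK x) -addrA; exact: ler_normD.
Qed.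

Lemma open_patch_core P : open (patch_core P).
Proof. by apply: open_chart_preimage; exact: open_norm_ball. Qed.

Lemma compact_patches : uniformly_bounded_densities mu -> forall K : set M, compact K ->
  exists (P : M -> patch S mu) (s : seq M), K `<=` [set p | exists2 q, q \in s & patch_core (P q) p].
Proof.
move=> ub K cK.
have /choice[P PP] := exists_patch ub.
rewrite compact_cover in cK.
have [i _|p Kp|D _ DK] := cK M setT (fun p => patch_core (P p)).
- exact: open_patch_core.
- exists p => //; have [Pp e] := PP p.
  by split=> //=; rewrite e subrr normr0 patch_radius_gt0.
by exists P, (finmap.enum_fset D) => p /DK[q qD Pq]; exists q.
Qed.

End patch_existence.

Section complex_test_functions.
Context {R : realType} {n : nat}.
Local Notation rV := ('rV[R]_n).
Local Notation Re := complex.Re.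
Local Notation Im := complex.Im.
Implicit Types (f g : rV -> R[i]) (psi : rV -> R) (x : rV).

Definition ctf f := tf (fun x => Re (f x)) /\ tf (fun x => Im (f x)).

Definition cLeb2 f : R := Leb (fun x => csq (f x)).

Lemma ctf_csq f : ctf f -> tf (fun x => csq (f x)).
Proof. by move=> [rf jf]; apply: tfD; apply: tfM => //; [exact: rf.1|exact: jf.1]. Qed.

Lemma cLeb2E f : ctf f -> cLeb2 f = Leb (fun x => Re (f x) ^+ 2) + Leb (fun x => Im (f x) ^+ 2).
Proof. by move=> [rf jf]; rewrite /cLeb2 LebD//; apply: cc_sqr; exact: tf_cc. Qed.

Lemma csqD (a b : R[i]) : csq (a + b) <= 2 * csq a + 2 * csq b.
Proof.
rewrite /csq Re_add Im_add; have := sqr_ge0 (Re a - Re b); have := sqr_ge0 (Im a - Im b).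
rewrite !sqrrB !sqrrD; lra.
Qed.

Lemma ctfD f g : ctf f -> ctf g -> ctf (fun x => f x + g x).
Proof.
move=> [rf jf] [rg jg]; split.
  rewrite (_ : (fun x => Re _) = fun x => Re (f x) + Re (g x)); first exact: tfD.
  by apply/funext => x; exact: Re_add.
rewrite (_ : (fun x => Im _) = fun x => Im (f x) + Im (g x)); first exact: tfD.
by apply/funext => x; exact: Im_add.
Qed.

Lemma ctfM f g : ctf f -> csmooth_on setT g -> ctf (fun x => g x * f x).
Proof.
move=> [rf jf] [rg jg]; split.
  rewrite (_ : (fun x => Re _) = fun x => Re (g x) * Re (f x) - Im (g x) * Im (f x)).
    by apply: tfB; exact: tfMl.
  by apply/funext => x; exact: Re_mul.
rewrite (_ : (fun x => Im _) = fun x => Re (g x) * Im (f x) + Im (g x) * Re (f x)).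
  by apply: tfD; exact: tfMl.
by apply/funext => x; exact: Im_mul.
Qed.

Lemma ctf0 : ctf (fun=> 0).
Proof. by split; exact: tf0. Qed.

Lemma ctf_csmooth f : ctf f -> csmooth_on setT f.
Proof. by move=> [rf jf]; split; [exact: rf.1|exact: jf.1]. Qed.

Lemma csq_supp f (C : set rV) : (forall x, f x != 0 -> C x) -> forall x, csq (f x) != 0 -> C x.
Proof.
by move=> fC x cx; apply: fC; apply: contraNneq cx => ->; rewrite /csq /= expr0n addr0.
Qed.

Lemma ctf_sum (I : Type) (s : seq I) (F : I -> rV -> R[i]) :
  (forall i, ctf (F i)) -> ctf (fun x => \sum_(i <- s) F i x).
Proof.
move=> cF; elim: s => [|i s IH].
  rewrite (_ : (fun x => _) = fun=> 0); first exact: ctf0.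
  by apply/funext => x; rewrite big_nil.
rewrite (_ : (fun x => _) = fun x => F i x + \sum_(i <- s) F i x); first exact: ctfD.
by apply/funext => x; rewrite big_cons.
Qed.

Lemma cLeb2D f g : ctf f -> ctf g -> cLeb2 (fun x => f x + g x) <= 2 * cLeb2 f + 2 * cLeb2 g.
Proof.
move=> cf cg; have c1 := tf_cc (ctf_csq cf); have c2 := tf_cc (ctf_csq cg).
rewrite /cLeb2 -LebZ// -LebZ// -LebD; [|exact: ccZ|exact: ccZ].
apply: le_Leb; [exact: tf_cc (ctf_csq (ctfD cf cg))|by apply: ccD; exact: ccZ|].
by move=> x; exact: csqD.
Qed.

Lemma cLeb2_bounded f g (B : R) : ctf f -> ctf g -> (forall x, csq (g x) <= B * csq (f x)) ->
  cLeb2 g <= B * cLeb2 f.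
Proof.
move=> cf cg fg; have c1 := tf_cc (ctf_csq cf).
by rewrite /cLeb2 -LebZ//; apply: le_Leb => //; [exact: tf_cc (ctf_csq cg)|exact: ccZ].
Qed.

(** The product is smooth on [V] and zero off the closed ball; since the ball lies in [V], these two
    open sets cover the space. Values of [f] outside [V] are thus harmless. *)
Lemma tf_mul_local psi (f : rV -> R) (V : set rV) x0 (r : R) : tf psi -> open V ->
  (forall x, psi x != 0 -> `|x - x0| <= r) -> (forall x, `|x - x0| <= r -> V x) ->
  smooth_on V f -> tf (fun x => psi x * f x).
Proof.
move=> [sp [s ps]] oV pr rV sf; split; last first.
  by exists s => x; rewrite mulf_eq0 negb_or => /andP[/ps].
move=> m; apply: Ck_local => x _.
have [Vx|nVx] := pselect (V x).
  by exists V => //; apply: (CkM oV _ (sf m)); apply: Ck_sub (sp m).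
have oC : open (~` [set y | `|y - x0| <= r]) by apply: closed_openC; exact: closed_norm_ball.
exists (~` [set y | `|y - x0| <= r]); first by move=> /rV.
apply: (@Ck_ext _ _ _ m _ (cst 0) _ oC) (Ck_cst m _ 0) => y yr.
by rewrite (_ : psi y = 0) ?mul0r//; apply/eqP/negPn/negP => /pr.
Qed.

Lemma ctf_mul_local psi f (V : set rV) x0 (r : R) : tf psi -> open V ->
  (forall x, psi x != 0 -> `|x - x0| <= r) -> (forall x, `|x - x0| <= r -> V x) ->
  csmooth_on V f -> ctf (fun x => (psi x)%:C%C * f x).
Proof.
move=> tp oV pr rV [rf jf]; split.
  rewrite (_ : (fun x => Re _) = fun x => psi x * Re (f x)); first exact: (tf_mul_local tp oV pr rV rf).
  by apply/funext => x; rewrite Re_mul /= mul0r subr0.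
rewrite (_ : (fun x => Im _) = fun x => psi x * Im (f x)); first exact: (tf_mul_local tp oV pr rV jf).
by apply/funext => x; rewrite Im_mul /= mul0r addr0.
Qed.

Lemma Leb_gt0 (g : rV -> R) x : cc g -> (forall x, 0 <= g x) -> 0 < g x -> 0 < Leb g.
Proof.
move=> cg g0 gx; have g2 : 0 < g x / 2 by rewrite divr_gt0.
have : \forall y \near x, g x / 2 < g y.
  by have := cg.1 x; move=> /cvgrPdist_lt/(_ _ g2); apply: filterS => y; rewrite ltr_norml => /andP[_]; lra.
move=> /nbhs_normP[d /= d0 dP].
apply: lt_le_trans (@Leb_ge_ball _ _ g x (d / 2) (g x / 2) cg _ _ g0 _).
- by rewrite mulr_gt0// exprn_gt0// pmulrn_lgt0// divr_gt0.
- by rewrite divr_ge0// ltW.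
- exact: ltW.
- move=> y yd; apply/ltW/dP; rewrite /ball_/= distrC; apply: le_lt_trans yd _.
  by rewrite ltr_pdivrMr// mulr2n mulrDr mulr1 ltrDl.
Qed.

End complex_test_functions.

Section energy.
Context {R : realType} {n : nat} {M : manifold R n} {k : nat} {S : vbundle M k}.
Context (h : hermitian_metric S) (mu : {measure set (borel M) -> \bar R}).
Hypothesis ub : uniformly_bounded_densities mu.
Local Notation leb := (@lebesgue_rV R n).
Implicit Types (u v : section_of S).

Lemma mu_core_lty (P : patch S mu) : (mu (patch_core P) < +oo)%E.
Proof.
have r0 := ltW (patch_radius_gt0 P).
set B := [set x : 'rV[R]_n | `|x - patch_center P| < patch_radius P].
have Bi : B `<=` chart_img (patch_chart P).
  by move=> x /ltW xr; apply: patch_img; apply: le_trans xr _; rewrite ler_peMl// ler1n.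
have mB : measurable (B : set (borel 'rV[R]_n)).
  by apply: measurable_open; exact: open_norm_ball.
have [h1 _] := patch_measure mB Bi; apply: le_lt_trans h1 _.
pose B' := [set x : 'rV[R]_n | `|x - patch_center P| <= patch_radius P].
have BB' : (leb B <= leb B')%E.
  have := le_measure leb (x := B) (y := B').
  rewrite !inE; apply => //; first exact: measurable_closed_ball.
  by move=> x /ltW.
apply: le_lt_trans (lee_wpmul2l _ BB') _; first by rewrite lee_fin; exact: patch_bound_ge0.
by rewrite lebesgue_closed_ball// -EFinM ltry.
Qed.

(** Finitely many open coordinate cubes cover [K], and each has finite measure by comparison with
    Lebesgue measure. *)
Lemma mu_compact_lty (K : set M) : compact K -> (mu (K : set (borel M)) < +oo)%E.
Proof.
move=> cK; have [P [s Ks]] := compact_patches S ub cK.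
have mK : measurable (K : set (borel M)).
  by apply: measurable_closed; apply: compact_closed cK; exact: mfd_hausdorff.
have [ms fs] : measurable ([set p | exists2 q, q \in s & patch_core (P q) p] : set (borel M)) /\
    (mu ([set p | exists2 q, q \in s & patch_core (P q) p] : set (borel M)) < +oo)%E.
  elim: s {Ks} => [|q s [ms fs]].
    rewrite (_ : [set p | _] = set0); first by rewrite measure0.
    by apply/seteqP; split=> p // -[].
  rewrite (_ : [set p | _] = patch_core (P q) `|` [set p | exists2 q, q \in s & patch_core (P q) p]).
    have mc : measurable (patch_core (P q) : set (borel M)).
      by apply: measurable_open; exact: open_patch_core.
    split; first exact: measurableU.
    apply: le_lt_trans (measureU2 _ _ _) _ => //.
    by rewrite lte_add_pinfty// mu_core_lty.
  apply/seteqP; split=> p /=.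
    by move=> [q']; rewrite inE => /predU1P[->|q's] pq; [left|right; exists q'].
  move=> [pq|[q' q's pq]]; first by exists q; rewrite ?mem_head.
  by exists q' => //; rewrite inE q's orbT.
apply: le_lt_trans fs; apply: le_measure; rewrite ?inE//.
Qed.

(** The squared norm as a real number. [fine] would send an infinite integral to 0; for smooth
    sections of compact support the integral is shown finite next. *)
Definition nrm2 u : R := fine (\int[mu]_p (hnorm2 h (u p))%:E)%E.

Lemma measurable_hnorm2 u : smooth_section u ->
  measurable_fun setT (fun p : borel M => (hnorm2 h (u p))%:E : \bar R).
Proof.
by move=> su; apply/measurable_EFinP; apply: measurable_continuous; exact: hnorm2_continuous.
Qed.

Lemma energyE u : smooth_cpt u -> (\int[mu]_p (hnorm2 h (u p))%:E = (nrm2 u)%:E)%E.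
Proof.
move=> [su cu]; rewrite /nrm2 fineK// ge0_fin_numE; last first.
  by apply: integral_ge0 => p _; rewrite lee_fin hnorm2_ge0.
have cs := @hnorm2_continuous _ _ _ _ _ h u su.
have := compact_bounded (continuous_compact (continuous_subspaceT cs) cu).
move=> [B [Br BP]]; pose C := `|B| + 1.
have hC p : supp u p -> hnorm2 h (u p) <= C.
  move=> up; apply: le_trans (ler_norm _) _.
  by apply: BP; [rewrite /C (le_lt_trans (ler_norm _))// ltrDl|exists p].
have ms : measurable (supp u : set (borel M)) by apply: measurable_closed; exact: closed_closure.
rewrite (_ : (fun p => (hnorm2 h (u p))%:E) = (fun p => (hnorm2 h (u p))%:E) \_ (supp u)); last first.
  apply/funext => p; rewrite patchE; case: ifPn => // /negP ps.
  have -> : u p = 0 by apply: contrapT => /suppP up; apply: ps; rewrite inE.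
  by rewrite /hnorm2 herm0l.
rewrite -integral_mkcond.
have h1 : (\int[mu]_(p in supp u) (hnorm2 h (u p))%:E <= C%:E * mu (supp u : set (borel M)))%E.
  rewrite -integral_cst//; apply: ge0_le_integral => //.
  - by move=> p _; rewrite lee_fin hnorm2_ge0.
  - by apply: measurable_funTS; exact: measurable_hnorm2.
apply: le_lt_trans h1 _.
have := mu_compact_lty cu; rewrite -ge0_fin_numE// => /fineK <-.
by rewrite -EFinM ltry.
Qed.

Lemma nrm2_ge0 u : 0 <= nrm2 u.
Proof. by apply: fine_ge0; apply: integral_ge0 => p _; rewrite lee_fin hnorm2_ge0. Qed.

Section one_patch.
Variable P : patch S mu.
Local Notation c := (patch_chart P).
Local Notation t := (patch_triv P).
Local Notation x0 := (patch_center P).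
Local Notation r := (patch_radius P).

Lemma vtf_ctf W l : vtf P W -> ctf (fun x => W x l 0).
Proof.
move=> [sW W0]; have [rf jf] := sW l.
have b : forall x, W x l 0 != 0 -> `|x| <= 3 * r + `|x0|.
  move=> x Wx; have : W x != 0 by apply: contraNneq Wx => ->; rewrite mxE.
  move=> /W0 xr; rewrite -[x](subrK x0); apply: le_trans (ler_normD _ _) _.
  by rewrite lerD2r.
by split; split=> //; exists (3 * r + `|x0|) => x Wx; apply: b; apply: contraNneq Wx => ->.
Qed.

(** Combines the upper bound of the fibre norm with that of the measure; with [cLeb2_loc] in the
    opposite direction it transfers estimates between coordinates and sections. *)
Lemma nrm2_lift : exists2 C : R, 0 <= C & forall W, vtf P W ->
  nrm2 (patch_lift P W) <= C * \sum_l cLeb2 (fun x => W x l 0).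
Proof.
have [C C0 hC] := hnorm2_upper h P.
exists (patch_bound P * C) => [|W vW]; first by rewrite mulr_ge0 ?patch_bound_ge0.
have mD : measurable (chart_dom c : set (borel M)).
  by apply: measurable_open; exact: chart_dom_open.
pose g x := C * \sum_l csq (W x l 0).
have g0 x : 0 <= g x by rewrite mulr_ge0// sumr_ge0// => l _; exact: csq_ge0.
have tg : tf g by apply: tfZ; apply: tf_sum => l; apply: ctf_csq; exact: vtf_ctf.
have sl := smooth_patch_lift vW.
rewrite -lee_fin -energyE//.
rewrite (_ : (fun p => _) = (fun p => (hnorm2 h (patch_lift P W p))%:E) \_ (chart_dom c)); last first.
  apply/funext => p; rewrite patchE; case: ifPn => // /negP cp.
  rewrite /patch_lift asboolF ?/hnorm2 ?herm0l// => cp'; apply: cp; by rewrite inE.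
rewrite -integral_mkcond.
apply: le_trans (_ : \int[mu]_(p in chart_dom c) (g (chart_map c p))%:E <= _)%E.
  apply: ge0_le_integral => //.
  - by move=> p _; rewrite lee_fin hnorm2_ge0.
  - by apply: measurable_funTS; apply: measurable_hnorm2; exact: sl.1.
  - apply/measurable_EFinP; apply: measurable_continuous_on; first exact: chart_dom_open.
    move=> p cp; apply: (continuous_comp (chart_map_continuous cp)).
    exact: (tf_cc tg).1.
  - move=> p cp; rewrite lee_fin /patch_lift asboolT//.
    have [Wp|Wp] := eqVneq (W (chart_map c p)) 0.
      by rewrite Wp triv_inv0 -?patch_dom// /hnorm2 herm0l.
    by have := hC _ (W (chart_map c p)) (vW.2 _ Wp); rewrite chart_mapK.
apply: le_trans (patch_integral_le P (tf_cc tg).1 g0) _.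
rewrite LebE; last exact: tf_cc.
rewrite -EFinM lee_fin -mulrA; apply: ler_wpM2l; first exact: patch_bound_ge0.
rewrite LebZ; last by apply: tf_cc; apply: tf_sum => l; apply: ctf_csq; exact: vtf_ctf.
apply: ler_wpM2l => //; rewrite /cLeb2.
elim: (index_enum _) => [|l s IH].
  rewrite big_nil (_ : (fun x => _) = fun=> 0) ?Leb0//.
  by apply/funext => x; rewrite big_nil.
rewrite big_cons (_ : (fun x => _) = fun x => csq (W x l 0) + \sum_(l <- s) csq (W x l 0)); last first.
  by apply/funext => x; rewrite big_cons.
rewrite LebD; first by rewrite lerD2l.
  by apply: tf_cc; apply: ctf_csq; exact: vtf_ctf.
by apply: tf_cc; apply: tf_sum => j; apply: ctf_csq; exact: vtf_ctf.
Qed.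

Lemma ctf_loc psi u l : tf psi -> (forall x, psi x != 0 -> `|x - x0| <= 3 * r) ->
  smooth_section u -> ctf (fun x => (psi x)%:C%C * patch_loc P u x l 0).
Proof.
move=> tp ps su; apply: (ctf_mul_local tp (chart_img_open (c := c)) ps).
  by move=> x; exact: patch_img.
exact: patch_loc_smooth.
Qed.

Lemma cLeb2_loc psi : tf psi -> (forall x, psi x != 0 -> `|x - x0| <= 3 * r) ->
  exists2 C : R, 0 <= C & forall u l, smooth_cpt u ->
  cLeb2 (fun x => (psi x)%:C%C * patch_loc P u x l 0) <= C * nrm2 u.
Proof.
move=> tp ps; have [C C0 hC] := hnorm2_lower h P.
have [B B0 psB] := cc_bound (tf_cc tp).
exists (patch_bound P * (B ^+ 2 * C)) => [|u l su].
  by rewrite mulr_ge0 ?patch_bound_ge0// mulr_ge0// sqr_ge0.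
have mD : measurable (chart_dom c : set (borel M)).
  by apply: measurable_open; exact: chart_dom_open.
have mI : measurable (chart_img c : set (borel 'rV[R]_n)).
  by apply: measurable_open; exact: chart_img_open.
set f := fun x => _; have cf : ctf f := ctf_loc l tp ps su.1.
have tg := ctf_csq cf; have g0 x : 0 <= csq (f x) by exact: csq_ge0.
have gs x : csq (f x) != 0 -> `|x - x0| <= 3 * r.
  apply: (csq_supp (f := f) (C := fun x => `|x - x0| <= 3 * r)) => {}x fx.
  by apply: ps; apply: contraNneq fx => p0; rewrite /f p0 mul0r.
rewrite -lee_fin /cLeb2 -LebE; last exact: tf_cc.
rewrite (_ : (fun x => _) = (fun x => (csq (f x))%:E) \_ (chart_img c)); last first.
  apply/funext => x; rewrite patchE; case: ifPn => // /negP cx.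
  have [->//|/gs/patch_img ix] := eqVneq (csq (f x)) 0; case: cx; by rewrite inE.
rewrite -integral_mkcond.
apply: le_trans (patch_integral_ge P (tf_cc tg).1 g0) _.
rewrite -mulrA [leRHS]EFinM; apply: lee_wpmul2l.
  by rewrite lee_fin; exact: patch_bound_ge0.
have mh := measurable_hnorm2 su.1.
rewrite EFinM -energyE// -ge0_integralZl//; last 2 first.
- by move=> p _; rewrite lee_fin hnorm2_ge0.
- by rewrite lee_fin mulr_ge0// sqr_ge0.
have nn p : (0 <= (B ^+ 2 * C)%:E * (hnorm2 h (u p))%:E)%E.
  by rewrite -EFinM lee_fin mulr_ge0 ?hnorm2_ge0// mulr_ge0// sqr_ge0.
apply: le_trans (_ : \int[mu]_(p in chart_dom c) ((B ^+ 2 * C)%:E * (hnorm2 h (u p))%:E) <= _)%E.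
  apply: ge0_le_integral => //.
  - by move=> p _; rewrite lee_fin csq_ge0.
  - apply/measurable_EFinP; apply: measurable_continuous_on; first exact: chart_dom_open.
    move=> p cp; apply: (continuous_comp (g := fun x => csq (f x)) (chart_map_continuous cp)).
    exact: (tf_cc tg).1.
  - by apply: measurable_funTS; exact: measurable_funeM.
  - move=> p cp; rewrite -EFinM lee_fin /f csqM.
    have [->|/ps pr] := eqVneq (psi (chart_map c p)) 0.
      rewrite [csq 0%:C%C](_ : _ = 0) ?mul0r; last by rewrite /csq /= expr0n addr0.
      by have := nn p; rewrite -EFinM lee_fin.
    rewrite -mulrA; apply: ler_pM; [exact: csq_ge0|exact: csq_ge0| |].
      rewrite /csq /= expr0n addr0 -(real_normK (num_real (psi _))).
      by apply: lerXn2r; rewrite ?nnegrE//; exact: psB.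
    have := hC _ (patch_loc P u (chart_map c p)) l pr.
    by rewrite /patch_loc chart_mapK// triv_mapK// -patch_dom.
by apply: ge0_subset_integral => //; exact: measurable_funeM.
Qed.

End one_patch.

(** Identifies smooth representatives of elements of the completion. A nonzero value at [p] gives a
    nonzero coordinate in a patch centred there; the cut-off coordinate has a positive square
    integral, which the energy must dominate. *)
Lemma nrm2_eq0 u : smooth_cpt u -> nrm2 u = 0 -> forall p, u p = 0.
Proof.
move=> su u0 p; apply: contrapT => up.
have [P [cp e]] := exists_patch S ub p.
have r0 := patch_radius_gt0 P.
pose psi := bumpf (patch_center P) (patch_radius P) (2 * patch_radius P).
have rr : 0 <= patch_radius P < 2 * patch_radius P by apply/andP; split; lra.
have ps x : psi x != 0 -> `|x - patch_center P| <= 3 * patch_radius P.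
  move=> /(bumpf_supp rr) /ltW xr; apply: le_trans xr _; rewrite ler_pM2r// ler_nat//.
have tp : tf psi.
  split; first exact: smooth_bumpf.
  exists (3 * patch_radius P + `|patch_center P|) => x /ps xr.
  rewrite -[x](subrK (patch_center P)); apply: le_trans (ler_normD _ _) _.
  by rewrite lerD2r.
have [C C0 hC] := cLeb2_loc tp ps.
have [l lp] : exists l, patch_loc P u (chart_map (patch_chart P) p) l 0 != 0.
  apply: contrapT => nl; apply: up.
  have : triv_map (patch_triv P) (u p) = 0.
    apply/colP => l; rewrite mxE; apply: contrapT => ul; apply: nl; exists l.
    by apply/eqP; rewrite /patch_loc chart_mapK.
  move=> /(congr1 (@triv_inv _ _ _ _ (patch_triv P) p)).
  by rewrite triv_mapK ?triv_inv0 -?patch_dom.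
have cf := ctf_loc l tp ps su.1.
have := hC u l su; rewrite u0 mulr0 leNgt => /negP; apply.
apply: (@Leb_gt0 _ _ _ (chart_map (patch_chart P) p)).
- exact: tf_cc (ctf_csq cf).
- by move=> x; exact: csq_ge0.
rewrite -e {1}/psi bumpf_eq1//; last by rewrite subrr normr0 ltW.
rewrite mul1r lt_def csq_ge0 andbT; rewrite e.
apply: contra lp; rewrite /csq paddr_eq0 ?sqr_ge0// !sqrf_eq0 => /andP[a b].
by rewrite eq_complex a b.
Qed.

End energy.

(** * Mollified sections in a patch *)

Section smoothing_limit.
Context {R : realType} {n : nat}.
Local Notation rV := ('rV[R]_n).
Implicit Types (f g w k : rV -> R) (x y : rV).

Lemma convD k a f g x : tf k -> cc f -> cc g ->
  conv k (fun y => a * f y + g y) x = a * conv k f x + conv k g x.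
Proof.
move=> tk tff tfg; have c1 := conv_cc x tk tff.1; have c2 := conv_cc x tk tfg.1.
rewrite /conv -LebZ// -LebD//; last exact: ccZ.
by apply: eq_Leb => y; ring.
Qed.

Lemma norm_le_sqr (a e : R) : 0 <= e -> a ^+ 2 <= e ^+ 2 -> `|a| <= e.
Proof. by move=> e0; rewrite -(real_normK (num_real a)) ler_pXn2r// nnegrE. Qed.

Lemma cauchy_limn (u : nat -> R) :
  (forall e, 0 < e -> exists N, forall m m', (N <= m)%N -> (N <= m')%N -> `|u m - u m'| <= e) ->
  u @ \oo --> limn u.
Proof.
move=> uc; apply/cauchy_cvgP/cauchy_exP => e e0.
have [N NP] := uc _ (divr_gt0 e0 (@ltr0Sn R 1)).
exists (u N), N => // m /= Nm; rewrite /ball/=.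
by apply: le_lt_trans (NP _ _ _ _) _ => //; rewrite ltr_pdivrMr// ltr_pMr// ltr1n.
Qed.

Lemma cvg_tail_le (u : nat -> R) (l e : R) N : u @ \oo --> l ->
  (forall m m', (N <= m)%N -> (N <= m')%N -> `|u m - u m'| <= e) ->
  forall m, (N <= m)%N -> `|u m - l| <= e.
Proof.
move=> ul ue m Nm; apply/ler_addgt0Pr => d d0.
move: ul => /cvgrPdist_lt/(_ _ d0)[N' _ N'P].
have h1 := ue m (maxn N N') Nm (leq_maxl _ _).
have /= h2 := N'P (maxn N N') (leq_maxr _ _).
rewrite -(subrK (u (maxn N N')) (u m)) -addrA; apply: le_trans (ler_normD _ _) _.
by apply: lerD => //; rewrite distrC ltW.
Qed.

Section limit.
Variables (k : rV -> R) (w : nat -> rV -> R) (x0 : rV) (r : R).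
Hypothesis tk : tf k.
Hypothesis tw : forall m, tf (w m).
Hypothesis r0 : 0 <= r.
Hypothesis wr : forall m x, w m x != 0 -> `|x - x0| <= r.
Hypothesis wc : forall e, 0 < e -> exists N, forall m m', (N <= m)%N -> (N <= m')%N ->
  Leb (fun x => (w m x - w m' x) ^+ 2) <= e.

(** Stands in for integration against the limit of [w m], which exists only as an abstract limit. *)
Definition limit_pairing f : R := limn (fun m => Leb (fun y => f y * w m y)).

Lemma limit_pairing_cvg f : tf f ->
  Leb (fun y => f y * w m y) @[m --> \oo] --> limit_pairing f.
Proof.
move=> tff; apply: cauchy_limn => e e0.
set B := Leb (fun x => f x ^+ 2) + 1.
have B0 : 0 < B by rewrite ltr_wpDl// Leb_ge0// => x; exact: sqr_ge0.
have e2 : 0 < e ^+ 2 / B by rewrite divr_gt0// exprn_gt0.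
have [N NP] := wc e2; exists N => m m' Nm Nm'.
have tww := tfB (tw m) (tw m').
have c i : cc (fun y => f y * w i y) := ccM (tf_cc tff) (tf_cc (tw i)).1.
rewrite -LebB//; apply: norm_le_sqr; first exact: ltW.
rewrite (_ : (fun x => _) = fun x => f x * (w m x - w m' x)); last first.
  by apply/funext => x; rewrite mulrBr.
apply: le_trans (Leb_CS (tf_cc tff) (tf_cc tww)) _.
apply: le_trans (_ : B * (e ^+ 2 / B) <= _).
  by apply: ler_pM; [by apply: Leb_ge0 => x; exact: sqr_ge0|by apply: Leb_ge0 => x; exact: sqr_ge0|
    by rewrite /B lerDl|exact: NP].
by rewrite mulrC divfK// gt_eqF.
Qed.

(** On the common bounded support [|a| <= 1 + a ^+ 2], with the constant replaced by a bump to
    remain integrable. The square of [w m] is controlled by that of [w N] and by the Cauchy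
    condition with [e = 1]. *)
Lemma tf_L1_bound : exists2 C : R, 0 <= C &
  exists N, forall m, (N <= m)%N -> Leb (fun y => `|w m y|) <= C.
Proof.
have [N NP] := wc ltr01.
have rr : 0 <= r < r + 1 by rewrite r0 ltrDl/=.
pose b := @bumpf R n x0 r (r + 1).
have tb : tf b.
  split; first exact: smooth_bumpf.
  exists (r + 1 + `|x0|) => x /(bumpf_supp rr) /ltW xr; rewrite -[x](subrK x0).
  by apply: le_trans (ler_normD _ _) _; rewrite lerD2r.
have cb := tf_cc tb.
have c2 m := cc_sqr (tf_cc (tw m)).
have cm m := cc_sqr (tf_cc (tfB (tw m) (tw N))).
exists (Leb b + (2 * 1 + 2 * Leb (fun y => w N y ^+ 2))).
  by rewrite addr_ge0 ?Leb_ge0//; [move=> y; exact: bumpf_ge0|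
    rewrite addr_ge0// mulr_ge0// Leb_ge0// => y; exact: sqr_ge0].
exists N => m Nm.
apply: le_trans (_ : Leb (fun y => b y + (2 * (w m y - w N y) ^+ 2 + 2 * w N y ^+ 2)) <= _).
  apply: le_Leb.
  - exact: cc_norm (tf_cc (tw m)).
  - by apply: ccD => //; apply: ccD; exact: ccZ.
  move=> y; have [->|wy] := eqVneq (w m y) 0.
    rewrite normr0 addr_ge0 ?bumpf_ge0// addr_ge0// mulr_ge0// sqr_ge0//.
  have -> : b y = 1 by apply: bumpf_eq1 => //; exact: wr wy.
  have := sqr_ge0 (w m y - w N y - w N y); have := sqr_ge0 (`|w m y| - 1).
  rewrite sqrrB real_normK ?num_real// -[in w m y ^+ 2](subrK (w N y) (w m y)) !sqrrB sqrrD.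
  by have := normr_ge0 (w m y); rewrite expr1n mulr1; nra.
rewrite LebD//; last by apply: ccD; exact: ccZ.
rewrite LebD; [|exact: ccZ|exact: ccZ]; rewrite !LebZ// lerD2l lerD2r ler_pM2l//.
exact: NP.
Qed.

Lemma limit_pairing_bounded : exists B, bounded_functional limit_pairing B.
Proof.
have [C C0 [N NP]] := tf_L1_bound; exists C; split=> //.
  move=> a f g tff tfg.
  have tfs : tf (fun y => a * f y + g y) by apply: tfD => //; exact: tfZ.
  have h1 := limit_pairing_cvg tff; have h2 := limit_pairing_cvg tfg.
  have h3 := limit_pairing_cvg tfs.
  have h4 := cvgD (cvgM (cvg_cst a) h1) h2.
  apply: (cvg_unique _ h3) => //.
  rewrite (_ : (fun m => _) = (fun m => a * Leb (fun y => f y * w m y) + Leb (fun y => g y * w m y))); first exact: h4.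
  apply/funext => m.
  have c1 := ccM (tf_cc tff) (tf_cc (tw m)).1; have c2 := ccM (tf_cc tfg) (tf_cc (tw m)).1.
  rewrite -LebZ// -LebD//; last exact: ccZ.
  by apply: eq_Leb => y; ring.
move=> f s tff fs; apply/ler_addgt0Pr => e e0.
have := limit_pairing_cvg tff => /cvgrPdist_lt/(_ _ e0)[N' _ N'P].
have /= h2 := N'P (maxn N N') (leq_maxr _ _); set m := maxn N N' in h2 *.
have c1 := ccM (tf_cc tff) (tf_cc (tw m)).1.
rewrite -[limit_pairing f](subrK (Leb (fun y => f y * w m y))) addrC.
apply: le_trans (ler_normD _ _) _; apply: lerD; last exact: ltW.
apply: le_trans (Leb_norm c1) _.
have s0 : 0 <= s by exact: le_trans (normr_ge0 _) (fs 0).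
have cn := cc_norm (tf_cc (tw m)).
apply: le_trans (_ : Leb (fun y => s * `|w m y|) <= _).
  by apply: le_Leb; [exact: cc_norm|exact: ccZ|move=> y; rewrite normrM ler_wpM2r].
by rewrite LebZ// mulrC ler_wpM2r//; apply: NP; exact: leq_maxl.
Qed.

(** [W] is the limit functional applied to translates of the kernel, hence smooth; the sup bound for
    convolutions makes the convergence uniform. *)
Lemma smoothing_limit : exists W : rV -> R, [/\ smooth_on setT W,
  forall x, W x != 0 -> exists m, conv k (w m) x != 0 &
  forall e, 0 < e -> exists N, forall m x, (N <= m)%N -> `|conv k (w m) x - W x| <= e].
Proof.
have [B LB] := limit_pairing_bounded.
pose W x := limit_pairing (fun y => k (y - x)); exists W.
have cW x : conv k (w m) x @[m --> \oo] --> W x.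
  exact: (limit_pairing_cvg (tf_shift (- x) tk)).
split; first exact: (smooth_pairing LB tk).
  move=> x; apply: contra_neqP => nx; apply: (cvg_unique _ (cW x)) => //.
  rewrite (_ : (fun m => _) = fun=> 0); first exact: cvg_cst.
  by apply/funext => m; apply: contrapT => cm; apply: nx; exists m; apply/eqP.
move=> e e0; set D := Leb (fun x => k x ^+ 2) + 1.
have D0 : 0 < D by rewrite ltr_wpDl// Leb_ge0// => x; exact: sqr_ge0.
have e2 : 0 < e ^+ 2 / D by rewrite divr_gt0// exprn_gt0.
have [N NP] := wc e2; exists N => m x Nm.
apply: (cvg_tail_le (N := N) (cW x)) => // i j Ni Nj; apply: norm_le_sqr; first exact: ltW.
have tww := tfB (tw i) (tw j).
have ci := conv_cc x tk (tf_cc (tw i)).1; have cj := conv_cc x tk (tf_cc (tw j)).1.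
have -> : conv k (w i) x - conv k (w j) x = conv k (fun y => w i y - w j y) x.
  by rewrite /conv -LebB//; apply: eq_Leb => y; rewrite mulrBr.
apply: le_trans (conv_sup_bound x tk tww) _.
apply: le_trans (_ : D * (e ^+ 2 / D) <= _).
  by apply: ler_pM; [by apply: Leb_ge0 => z; exact: sqr_ge0|by apply: Leb_ge0 => z; exact: sqr_ge0|
    by rewrite /D lerDl|exact: NP].
by rewrite mulrC divfK// gt_eqF.
Qed.

End limit.
End smoothing_limit.

(** * Complex-valued mollification by a real kernel *)

Section complex_convolution.
Context {R : realType} {n : nat}.
Local Notation rV := ('rV[R]_n).
Local Notation Re := complex.Re.
Local Notation Im := complex.Im.
Implicit Types (f g : rV -> R[i]) (k : rV -> R) (x : rV).

Lemma Im_opp (z : R[i]) : Im (- z) = - Im z. Proof. by case: z. Qed.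

Definition cconv k f x : R[i] :=
  (conv k (fun y => Re (f y)) x +i* conv k (fun y => Im (f y)) x)%C.

Lemma ctf_cconv k f : tf k -> ctf f -> ctf (cconv k f).
Proof. by move=> tk [rf jf]; split; apply: tf_conv => //; exact: tf_cc. Qed.

Lemma cconv_lin k (a : R[i]) f g x : tf k -> ctf f -> ctf g ->
  cconv k (fun y => a * f y + g y) x = a * cconv k f x + cconv k g x.
Proof.
move=> tk [/tf_cc rf /tf_cc jf] [/tf_cc rg /tf_cc jg].
apply/eqP; rewrite eq_complex; apply/andP; split; apply/eqP.
  rewrite Re_add Re_mul /= (_ : (fun y => Re _) =
    fun y => Re a * Re (f y) + (- Im a * Im (f y) + Re (g y))); last first.
    by apply/funext => y; rewrite Re_add Re_mul mulNr addrA.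
  rewrite (convD (Re a) (g := fun y => - Im a * Im (f y) + Re (g y)))//; last by apply: ccD => //; exact: ccZ.
  by rewrite (convD (- Im a) (f := fun y => Im (f y)))// mulNr addrA.
rewrite Im_add Im_mul /= (_ : (fun y => Im _) =
  fun y => Re a * Im (f y) + (Im a * Re (f y) + Im (g y))); last first.
  by apply/funext => y; rewrite Im_add Im_mul addrA.
rewrite (convD (Re a) (g := fun y => Im a * Re (f y) + Im (g y)))//; last by apply: ccD => //; exact: ccZ.
by rewrite (convD (Im a) (f := fun y => Re (f y)))// addrA.
Qed.

Lemma cconv0 k x : tf k -> cconv k (fun=> 0) x = 0.
Proof.
move=> tk; have := cconv_lin 1 x tk ctf0 ctf0.
rewrite (_ : (fun=> 1 * 0 + 0) = fun=> 0); last by apply/funext => y; rewrite mulr0 addr0.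
rewrite mul1r.
by move=> /(congr1 (fun z => z - cconv k (fun=> 0) x)); rewrite subrr addrK => /esym.
Qed.

Lemma cconv_sum k (I : Type) (s : seq I) (F : I -> rV -> R[i]) x : tf k ->
  (forall i, ctf (F i)) ->
  cconv k (fun y => \sum_(i <- s) F i y) x = \sum_(i <- s) cconv k (F i) x.
Proof.
move=> tk cF; elim: s => [|i s IH].
  rewrite big_nil (_ : (fun y => _) = fun=> 0) ?cconv0//.
  by apply/funext => y; rewrite big_nil.
rewrite big_cons -IH -[in RHS](mul1r (cconv k (F i) x)) -cconv_lin//; last exact: ctf_sum.
by congr (cconv k _ x); apply/funext => y; rewrite big_cons mul1r.
Qed.

Lemma cconv_supp k f (x0 : rV) (r t : R) x : (forall z, k z != 0 -> `|z| <= t) ->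
  (forall y, f y != 0 -> `|y - x0| <= r) -> cconv k f x != 0 -> `|x - x0| <= r + t.
Proof.
move=> kt fr cx.
have fr1 y : Re (f y) != 0 -> `|y - x0| <= r.
  by move=> fy; apply: fr; apply: contraNneq fy => ->.
have fr2 y : Im (f y) != 0 -> `|y - x0| <= r.
  by move=> fy; apply: fr; apply: contraNneq fy => ->.
have [c1|] := eqVneq (conv k (fun y => Re (f y)) x) 0; last exact: conv_supp.
have [c2|] := eqVneq (conv k (fun y => Im (f y)) x) 0; last exact: conv_supp.
by move: cx; rewrite /cconv c1 c2 eqxx.
Qed.

Lemma cLeb2_cconv t f : 0 < t -> ctf f ->
  cLeb2 (cconv (moll t) f) <= (4 ^+ n) ^+ 2 * cLeb2 f.
Proof.
move=> t0 cf; have tm := @tf_moll R n t t0.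
rewrite !cLeb2E//; last exact: ctf_cconv.
rewrite mulrDr; apply: lerD; apply: conv_moll_bound => //; [exact: cf.1|exact: cf.2].
Qed.

Lemma cconv_approx f : ctf f -> exists2 C : R, 0 <= C & forall t x, 0 < t ->
  csq (cconv (moll t) f x - f x) <= C * t ^+ 2.
Proof.
move=> [rf jf]; have [C1 C10 h1] := conv_moll_approx rf.
have [C2 C20 h2] := conv_moll_approx jf.
exists (C1 ^+ 2 + C2 ^+ 2) => [|t x t0]; first by rewrite addr_ge0// sqr_ge0.
rewrite /csq Re_add Im_add Re_opp Im_opp mulrDl -!exprMn.
rewrite -(real_normK (num_real (Re _ - _))) -(real_normK (num_real (Im _ - _))).
have Ct1 : 0 <= C1 * t by rewrite mulr_ge0// ltW.
have Ct2 : 0 <= C2 * t by rewrite mulr_ge0// ltW.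
by apply: lerD; rewrite ler_pXn2r// ?nnegrE//; [exact: h1|exact: h2].
Qed.

(** The kernel is real, so real and imaginary parts of the commutator are combinations of four real
    commutators; the factor 2 comes from squaring sums of two terms. *)
Lemma cconv_commutator a j : ctf a -> exists2 C : R, 0 <= C & forall t f, 0 < t -> ctf f ->
  cLeb2 (fun x => a x * cpartial j (cconv (moll t) f) x -
                  cconv (moll t) (fun y => a y * cpartial j f y) x)
  <= C * cLeb2 f.
Proof.
move=> [ra ja]; have [C1 C10 h1] := commutator_bound j ra.
have [C2 C20 h2] := commutator_bound j ja.
exists (2 * (C1 + C2)) => [|t f t0 cf]; first by rewrite mulr_ge0// addr_ge0.
have tm := @tf_moll R n t t0; have [rf jf] := cf.
pose X (b w : rV -> R) x := b x * partial j (conv (moll t) w) x -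
  conv (moll t) (fun y => b y * partial j w y) x.
have tX (b w : rV -> R) : tf b -> tf w -> tf (X b w).
  move=> tb tg; have tp := tf_partial j tg.
  apply: tfB; first by apply: tfM => //; apply: smooth_partial; exact: smooth_conv (tf_cc tg).
  by apply: tf_conv => //; apply: tf_cc; apply: tfM => //; exact: tp.1.
have cb (b w : rV -> R) : tf b -> tf w -> cc (fun y => b y * partial j w y).
  by move=> tb tg; apply: tf_cc; apply: tfM => //; exact: (tf_partial j tg).1.
rewrite /cLeb2.
rewrite [X in Leb X <= _](_ : _ = fun x =>
    (X (fun y => Re (a y)) (fun y => Re (f y)) x - X (fun y => Im (a y)) (fun y => Im (f y)) x) ^+ 2 +
    (X (fun y => Re (a y)) (fun y => Im (f y)) x + X (fun y => Im (a y)) (fun y => Re (f y)) x) ^+ 2); last first.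
  apply/funext => x; rewrite /csq Re_add Im_add Re_opp Im_opp Re_mul Im_mul /cconv /cpartial /X /=.
  rewrite (_ : (fun y => Re (a y * _)) = fun y => -1 * (Im (a y) * partial j (fun y => Im (f y)) y) +
    Re (a y) * partial j (fun y => Re (f y)) y); last first.
    by apply/funext => y; rewrite Re_mul /= addrC mulN1r.
  rewrite (_ : (fun y => Im (a y * _)) = fun y => 1 * (Im (a y) * partial j (fun y => Re (f y)) y) +
    Re (a y) * partial j (fun y => Im (f y)) y); last first.
    by apply/funext => y; rewrite Im_mul /= addrC mul1r.
  rewrite convD//; [|exact: cb|exact: cb]; rewrite convD//; [|exact: cb|exact: cb].
  by congr (_ ^+ 2 + _ ^+ 2); ring.
set X1 := X _ _; set X2 := X _ _; set X3 := X _ _; set X4 := X _ _.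
have t1 : tf X1 by exact: tX. have t2 : tf X2 by exact: tX.
have t3 : tf X3 by exact: tX. have t4 : tf X4 by exact: tX.
have c1 := cc_sqr (tf_cc t1); have c2 := cc_sqr (tf_cc t2).
have c3 := cc_sqr (tf_cc t3); have c4 := cc_sqr (tf_cc t4).
have c12 := ccD c1 c2; have c34 := ccD c3 c4.
apply: le_trans (_ : Leb (fun x => 2 * ((X1 x ^+ 2 + X2 x ^+ 2) + (X3 x ^+ 2 + X4 x ^+ 2))) <= _).
  apply: le_Leb.
  - by apply: ccD; apply: cc_sqr; apply: tf_cc; [exact: tfB|exact: tfD].
  - by apply: ccZ; exact: ccD.
  move=> x; have := sqr_ge0 (X1 x + X2 x); have := sqr_ge0 (X3 x - X4 x); nra.
rewrite LebZ; last exact: ccD.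
rewrite LebD// LebD// LebD//.
have b1 : Leb (fun x => X1 x ^+ 2) <= C1 * Leb (fun x => Re (f x) ^+ 2) by exact: h1.
have b2 : Leb (fun x => X2 x ^+ 2) <= C2 * Leb (fun x => Im (f x) ^+ 2) by exact: h2.
have b3 : Leb (fun x => X3 x ^+ 2) <= C1 * Leb (fun x => Im (f x) ^+ 2) by exact: h1.
have b4 : Leb (fun x => X4 x ^+ 2) <= C2 * Leb (fun x => Re (f x) ^+ 2) by exact: h2.
rewrite -[Leb (fun x => csq _)]/(cLeb2 f) cLeb2E// -mulrA ler_pM2l//.
move: b1 b2 b3 b4; set A := Leb _; set A1 := Leb _; set B := Leb _; set B1 := Leb _.
by set D := Leb _; set D1 := Leb _; move=> *; lra.
Qed.

Lemma csmoothing_limit k (f : nat -> rV -> R[i]) (x0 : rV) (r : R) : tf k ->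
  (forall m, ctf (f m)) -> 0 <= r -> (forall m x, f m x != 0 -> `|x - x0| <= r) ->
  (forall e, 0 < e -> exists N, forall m m', (N <= m)%N -> (N <= m')%N ->
    cLeb2 (fun x => f m x - f m' x) <= e) ->
  exists W : rV -> R[i], [/\ csmooth_on setT W,
    forall x, W x != 0 -> exists m, cconv k (f m) x != 0 &
    forall e, 0 < e -> exists N, forall m x, (N <= m)%N -> csq (cconv k (f m) x - W x) <= e].
Proof.
move=> tk cf r0 fr fc.
have cfB m m' : ctf (fun x => f m x - f m' x).
  rewrite (_ : (fun x => _) = fun x => f m x + (-1) * f m' x); last first.
    by apply/funext => x; rewrite mulN1r.
  by apply: ctfD => //; apply: ctfM => //; exact: csmooth_cst.
have fc1 e : 0 < e -> exists N, forall m m', (N <= m)%N -> (N <= m')%N ->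
    Leb (fun x => (Re (f m x) - Re (f m' x)) ^+ 2) <= e.
  move=> e0; have [N NP] := fc _ e0; exists N => m m' Nm Nm'.
  apply: le_trans (NP _ _ Nm Nm'); rewrite cLeb2E// ler_wpDr//.
    by apply: Leb_ge0 => x; exact: sqr_ge0.
  by rewrite (eq_Leb (g := fun x => Re (f m x - f m' x) ^+ 2))// => x; rewrite Re_add Re_opp.
have fc2 e : 0 < e -> exists N, forall m m', (N <= m)%N -> (N <= m')%N ->
    Leb (fun x => (Im (f m x) - Im (f m' x)) ^+ 2) <= e.
  move=> e0; have [N NP] := fc _ e0; exists N => m m' Nm Nm'.
  apply: le_trans (NP _ _ Nm Nm'); rewrite cLeb2E// ler_wpDl//.
    by apply: Leb_ge0 => x; exact: sqr_ge0.
  by rewrite (eq_Leb (g := fun x => Im (f m x - f m' x) ^+ 2))// => x; rewrite Im_add Im_opp.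
have fr1 m y : Re (f m y) != 0 -> `|y - x0| <= r.
  by move=> fy; apply: (fr m); apply: contraNneq fy => ->.
have fr2 m y : Im (f m y) != 0 -> `|y - x0| <= r.
  by move=> fy; apply: (fr m); apply: contraNneq fy => ->.
have [W1 [s1 w1 l1]] := smoothing_limit tk (fun m => (cf m).1) r0 fr1 fc1.
have [W2 [s2 w2 l2]] := smoothing_limit tk (fun m => (cf m).2) r0 fr2 fc2.
exists (fun x => (W1 x +i* W2 x)%C); split=> //.
- move=> x; rewrite eq_complex /= negb_and => /orP[/w1|/w2] [m mx]; exists m;
    by rewrite eq_complex /= negb_and mx ?orbT.
- move=> e e0; pose d := Num.sqrt (e / 2).
  have d0 : 0 < d by rewrite sqrtr_gt0 divr_gt0.
  have [N1 N1P] := l1 _ d0; have [N2 N2P] := l2 _ d0.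
  exists (maxn N1 N2) => m x; rewrite geq_max => /andP[Nm1 Nm2].
  rewrite /csq /= [leRHS](splitr e) -(@sqr_sqrtr _ (e / 2)); last by rewrite divr_ge0// ltW.
  rewrite -(real_normK (num_real (_ - W1 x))) -(real_normK (num_real (_ - W2 x))).
  by apply: lerD; rewrite ler_pXn2r// ?nnegrE ?(ltW d0)//; [exact: N1P|exact: N2P].
Qed.

End complex_convolution.

Section complex_partial.
Context {R : realType} {n : nat}.
Local Notation rV := ('rV[R]_n).
Local Notation Re := complex.Re.
Local Notation Im := complex.Im.
Implicit Types (f g : rV -> R[i]) (psi : rV -> R) (x : rV) (V C : set rV).

Lemma cpartial_ext V f g j x : open V -> (forall y, V y -> f y = g y) -> V x ->
  cpartial j f x = cpartial j g x.
Proof.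
move=> oV fg Vx; rewrite /cpartial.
by congr (_ +i* _)%C; apply: (partial_ext _ oV) => // y Vy; rewrite fg.
Qed.

Lemma cpartial_cst0 j x : cpartial j (fun=> 0) x = 0.
Proof. by rewrite /cpartial /partial !derive_cst. Qed.

Lemma cpartial_supp C f j x : closed C -> (forall y, f y != 0 -> C y) ->
  cpartial j f x != 0 -> C x.
Proof.
move=> cC fC; apply: contra_neqP => Cx.
rewrite (cpartial_ext (g := fun=> 0) j (closed_openC cC) _ Cx) ?cpartial_cst0//.
by move=> y Cy; apply/eqP/negPn/negP => /fC.
Qed.

Lemma csmooth_cpartial V f j : csmooth_on V f -> csmooth_on V (cpartial j f).
Proof. by move=> [rf jf]; split; exact: smooth_partial. Qed.

Lemma ctf_cpartial f j : ctf f -> ctf (cpartial j f).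
Proof. by move=> [rf jf]; split; exact: tf_partial. Qed.

Lemma cpartial_scale V psi f j x : V x -> smooth_on setT psi -> csmooth_on V f ->
  cpartial j (fun y => (psi y)%:C%C * f y) x =
  (psi x)%:C%C * cpartial j f x + (partial j psi x)%:C%C * f x.
Proof.
move=> Vx sp [rf jf].
have E (g : rV -> R) : smooth_on V g -> partial j (fun y => psi y * g y) x =
    psi x * partial j g x + partial j psi x * g x.
  move=> sg; rewrite /partial deriveM; [|exact: (smooth_derivable sp I)|exact: (smooth_derivable sg Vx)].
  by congr (_ + _); exact: mulrC.
apply: eq_complexP; rewrite ?Re_add ?Im_add ?Re_mul ?Im_mul /=.
  rewrite (_ : (fun y => Re _) = fun y => psi y * Re (f y)); last first.
    by apply/funext => y; rewrite Re_mul /= mul0r subr0.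
  by rewrite E// !mul0r !subr0.
rewrite (_ : (fun y => Im _) = fun y => psi y * Im (f y)); last first.
  by apply/funext => y; rewrite Im_mul /= mul0r addr0.
by rewrite E// !mul0r !addr0.
Qed.

Lemma tf_ball psi (x0 : rV) (r : R) : smooth_on setT psi ->
  (forall x, psi x != 0 -> `|x - x0| <= r) -> tf psi.
Proof.
move=> sp pr; split=> //; exists (r + `|x0|) => x /pr xr; rewrite -[x](subrK x0).
by apply: le_trans (ler_normD _ _) _; rewrite lerD2r.
Qed.

Lemma cLeb2_le_ball f (x0 : rV) (r e : R) : ctf f -> 0 <= r ->
  (forall x, csq (f x) <= e) -> (forall x, f x != 0 -> `|x - x0| <= r) ->
  cLeb2 f <= e * (r *+ 2) ^+ n.
Proof.
move=> cf r0 fe fr; apply: (@Leb_le_ball _ _ _ x0 r e) => //.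
- exact: tf_cc (ctf_csq cf).
- by move=> y; rewrite csq_ge0 fe.
- by apply: csq_supp => x; exact: fr.
Qed.

Lemma csq_ctf_bound f : ctf f -> exists2 B : R, 0 <= B & forall x, csq (f x) <= B.
Proof.
move=> cf; have [B B0 fB] := cc_bound (tf_cc (ctf_csq cf)); exists B => // x.
exact: le_trans (ler_norm _) (fB x).
Qed.

End complex_partial.

Section patch_symbol.
Context {R : realType} {n : nat} {M : manifold R n} {k : nat} {S : vbundle M k}.
Context {mu : {measure set (borel M) -> \bar R}} (P : patch S mu).
Local Notation rV := ('rV[R]_n).
Local Notation c := (patch_chart P).
Local Notation t := (patch_triv P).
Local Notation x0 := (patch_center P).
Local Notation r := (patch_radius P).
Implicit Types (u v : section_of S) (p q : M) (W : rV -> 'cV[R[i]]_k) (x : rV).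

Lemma patch_bump : exists2 psi : rV -> R, tf psi /\ (forall x, psi x != 0 -> `|x - x0| <= 4 * r) &
  forall x, `|x - x0| <= 3 * r -> psi x = 1.
Proof.
have r0 := patch_radius_gt0 P.
have rr : 0 <= 3 * r < 4 * r by apply/andP; split; lra.
have s x : bumpf x0 (3 * r) (4 * r) x != 0 -> `|x - x0| <= 4 * r.
  by move=> /(bumpf_supp rr)/ltW.
exists (bumpf x0 (3 * r) (4 * r)) => [|x xr]; last exact: bumpf_eq1.
by split=> //; apply: tf_ball s; exact: smooth_bumpf.
Qed.

(** The full coordinate expression of a first order operator, zero-order part included. *)
Definition symbol (a : 'I_n -> 'I_k -> 'I_k -> rV -> R[i]) (b : 'I_k -> 'I_k -> rV -> R[i])
    (g : 'I_k -> rV -> R[i]) (i : 'I_k) x : R[i] :=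
  \sum_j \sum_l a j i l x * cpartial j (g l) x + \sum_l b i l x * g l x.

(** Friedrichs' estimate wants coefficients that are test functions. Multiplying them by a bump that
    is 1 on the cube of radius [3 r] changes nothing where mollified sections live. *)
Lemma patch_diffop (D : diffop S) : exists a b,
  [/\ forall j i l, ctf (a j i l), forall i l, ctf (b i l) &
      forall u i x, smooth_section u -> `|x - x0| <= 3 * r ->
        patch_loc P (D u) x i 0 = symbol a b (fun l y => patch_loc P u y l 0) i x].
Proof.
have [A [B [sA sB DE]]] := diffop_first_order D (patch_is_chart P) (patch_is_triv P) (patch_dom P).
have [psi [tp ps] p1] := patch_bump.
have cut (f : M -> R[i]) : msmooth_on (chart_dom c) f ->
    ctf (fun x => (psi x)%:C%C * f (chart_inv c x)).
  move=> sf; apply: (ctf_mul_local tp (chart_img_open (c := c)) ps).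
    by move=> x; exact: patch_ball.
  by have := sf _ (patch_is_chart P); rewrite setIid.
exists (fun j i l x => (psi x)%:C%C * A j (chart_inv c x) i l),
       (fun i l x => (psi x)%:C%C * B (chart_inv c x) i l); split.
- by move=> j i l; exact: (cut (fun p => A j p i l)).
- by move=> i l; exact: (cut (fun p => B p i l)).
move=> u i x su xr; have /chart_imgK[cp xE] := patch_img xr.
have tp' : triv_dom t (chart_inv c x) by rewrite -patch_dom.
rewrite {1}/patch_loc DE// /symbol p1//.
rewrite (_ : \sum_j _ + _ = \sum_j 1 *: triv_inv t (chart_inv c x)
   (A j (chart_inv c x) *m vpartial j (fun y => triv_map t (u (chart_inv c y))) (chart_map c (chart_inv c x)))
   + triv_inv t (chart_inv c x) (B (chart_inv c x) *m triv_map t (u (chart_inv c x)))); last first.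
  by congr (_ + _); apply: eq_bigr => j _; rewrite scale1r.
rewrite -triv_inv_sum// -[in X in _ + X](scale1r (triv_inv _ _ _)) addrC -triv_inv_linear//.
rewrite scale1r triv_invK// !mxE summxE addrC; congr (_ + _).
  apply: eq_bigr => j _; rewrite scale1r !mxE; apply: eq_bigr => l _.
  by rewrite mxE xE mul1r.
by apply: eq_bigr => l _; rewrite mul1r.
Qed.

Lemma vtf_lin (a : R[i]) W1 W2 : vtf P W1 -> vtf P W2 -> vtf P (fun x => a *: W1 x + W2 x).
Proof.
move=> [s1 w1] [s2 w2]; split=> [i|x].
  rewrite (_ : (fun x => _) = fun x => a * W1 x i 0 + W2 x i 0); last first.
    by apply/funext => x; rewrite !mxE.
  by apply: (csmoothD openT) => //; apply: (csmoothM openT) => //; exact: csmooth_cst.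
have [->|/w1//] := eqVneq (W1 x) 0; have [->|/w2//] := eqVneq (W2 x) 0.
by rewrite scaler0 addr0 eqxx.
Qed.

Lemma vtf_col (g : 'I_k -> rV -> R[i]) : (forall l, csmooth_on setT (g l)) ->
  (forall l x, g l x != 0 -> `|x - x0| <= 3 * r) -> vtf P (fun x => \col_l g l x).
Proof.
move=> sg gr; split=> [i|x gx].
  by rewrite (_ : (fun x => _) = g i)//; apply/funext => x; rewrite mxE.
apply: contrapT => xr; move: gx; rewrite (_ : (\col_l g l x) = 0) ?eqxx//.
by apply/colP => l; rewrite !mxE; apply/eqP/negPn/negP => /gr.
Qed.

Lemma symbol_supp a b g i x : (forall l y, g l y != 0 -> `|y - x0| <= 3 * r) ->
  symbol a b g i x != 0 -> `|x - x0| <= 3 * r.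
Proof.
move=> gr sx; apply: contrapT => xr; move/negP: sx; apply; apply/eqP.
have g0 l : g l x = 0 by apply/eqP/negPn/negP => /gr.
have d0 j l : cpartial j (g l) x = 0.
  apply/eqP/negPn/negP => gx; apply: xr.
  exact: (cpartial_supp (@closed_norm_ball _ _ x0 (3 * r)) (gr l) gx).
rewrite /symbol !big1 ?addr0// => l _; rewrite ?g0 ?mulr0//.
by rewrite big1// => m _; rewrite d0 mulr0.
Qed.

Lemma vtf_symbol a b g : (forall j i l, ctf (a j i l)) -> (forall i l, ctf (b i l)) ->
  (forall l, csmooth_on setT (g l)) -> (forall l y, g l y != 0 -> `|y - x0| <= 3 * r) ->
  vtf P (fun x => \col_i symbol a b g i x).
Proof.
move=> ca cb sg gr; apply: vtf_col => [i|i x]; last exact: symbol_supp.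
apply: (csmoothD openT).
  apply: (csmooth_sum _ openT) => j; apply: (csmooth_sum _ openT) => l.
  by apply: (csmoothM openT); [exact: ctf_csmooth|exact: csmooth_cpartial].
apply: (csmooth_sum _ openT) => l.
by apply: (csmoothM openT) => //; exact: ctf_csmooth.
Qed.

(** Inside the cube this is the coordinate formula; outside it both sides vanish, on the left by
    locality of [D]. *)
Lemma diffop_lift (D : diffop S) a b (g : 'I_k -> rV -> R[i]) p :
  (forall j i l, ctf (a j i l)) -> (forall i l, ctf (b i l)) ->
  (forall u i x, smooth_section u -> `|x - x0| <= 3 * r ->
     patch_loc P (D u) x i 0 = symbol a b (fun l y => patch_loc P u y l 0) i x) ->
  (forall l, csmooth_on setT (g l)) -> (forall l y, g l y != 0 -> `|y - x0| <= 3 * r) ->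
  D (patch_lift P (fun x => \col_l g l x)) p = patch_lift P (fun x => \col_i symbol a b g i x) p.
Proof.
move=> ca cb DE sg gr; have vg := vtf_col sg gr; have vs := vtf_symbol ca cb sg gr.
have sl := smooth_patch_lift vg.
have [[x /= xr <-]|np] := pselect (patch_cube P p); last first.
  transitivity (0 : S p).
    apply: contrapT => /(diffop_supp sl.1 (@closed_patch_cube _ _ _ _ _ _ P)) h.
    by apply: np; apply: h => q; exact: patch_lift_supp.
  by apply: contrapT => /nesym /(patch_lift_supp vs).
have ix := patch_img xr; have [cp xE] := chart_imgK ix.
have tp : triv_dom t (chart_inv c x) by rewrite -patch_dom.
apply: (can_inj (triv_mapK tp)); apply/colP => i.
have := DE _ i x sl.1 xr; rewrite {1}/patch_loc => ->.
have := patch_loc_lift (fun x => \col_i symbol a b g i x) ix; rewrite /patch_loc => ->.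
rewrite mxE /symbol; congr (_ + _).
  apply: eq_bigr => j _; apply: eq_bigr => l _; congr (_ * _).
  apply: (cpartial_ext _ (chart_img_open (c := c))) => // y iy.
  by have := patch_loc_lift (fun x => \col_l g l x) iy; rewrite /patch_loc => ->; rewrite mxE.
apply: eq_bigr => l _; congr (_ * _).
by have := patch_loc_lift (fun x => \col_l g l x) ix; rewrite /patch_loc => ->; rewrite mxE.
Qed.

End patch_symbol.

Section mollifiers.
Context {R : realType} {n : nat} {M : manifold R n} {k : nat} {S : vbundle M k}.
Context (h : hermitian_metric S) (mu : {measure set (borel M) -> \bar R}).
Implicit Types (u v : section_of S) (chi : M -> R).

Lemma smooth_cptB u v : smooth_cpt u -> smooth_cpt v -> smooth_cpt (fun p => u p - v p).
Proof.
move=> su sv; rewrite (_ : (fun p => _) = fun p => -1 *: v p + u p); first exact: smooth_cpt_lin.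
by apply: functional_extensionality_dep => p; rewrite scaleN1r addrC.
Qed.

(** The target of approximation is multiplication by [chi] and not the identity, so that the
    property is additive in [chi]. The clause on sequences is what later yields smooth values on
    elements of the completion. *)
Definition mollifies chi (eps : R) (E : R -> section_of S -> section_of S) : Prop :=
  [/\ (forall t (a : R[i]) u v, 0 < t < eps -> smooth_cpt u -> smooth_cpt v ->
         forall p, E t (fun q => a *: u q + v q) p = a *: E t u p + E t v p),
      (forall t u, 0 < t < eps -> smooth_cpt u -> smooth_cpt (E t u)),
      (exists2 C : R, 0 <= C & forall t u, 0 < t < eps -> smooth_cpt u ->
         nrm2 h mu (E t u) <= C * nrm2 h mu u),
      (forall u, smooth_cpt u -> exists2 C : R, 0 <= C & forall t, 0 < t < eps ->
         nrm2 h mu (fun p => E t u p - (chi p)%:C%C *: u p) <= C * t ^+ 2)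
    & (forall t (u : nat -> section_of S), 0 < t < eps -> (forall m, smooth_cpt (u m)) ->
         (forall e, 0 < e -> exists N, forall m m', (N <= m)%N -> (N <= m')%N ->
            nrm2 h mu (fun p => u m p - u m' p) <= e) ->
         exists2 v, smooth_cpt v & forall e, 0 < e -> exists N, forall m, (N <= m)%N ->
            nrm2 h mu (fun p => E t (u m) p - v p) <= e) /\
      (forall D : diffop S, exists2 C : R, 0 <= C & forall t u, 0 < t < eps -> smooth_cpt u ->
         nrm2 h mu (fun p => D (E t u) p - E t (D u) p) <= C * nrm2 h mu u)].

End mollifiers.

(** * The mollification operator of one patch *)

Section patch_operator.
Context {R : realType} {n : nat} {M : manifold R n} {k : nat} {S : vbundle M k}.
Context (h : hermitian_metric S) {mu : {measure set (borel M) -> \bar R}}.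
Hypothesis ub : uniformly_bounded_densities mu.
Variables (P : patch S mu) (chi : M -> R).
Local Notation rV := ('rV[R]_n).
Local Notation c := (patch_chart P).
Local Notation T := (patch_triv P).
Local Notation x0 := (patch_center P).
Local Notation r := (patch_radius P).
Hypothesis schi : msmooth_on setT (fun p => (chi p)%:C%C).
Hypothesis chi_supp : forall p, chi p != 0 -> chart_dom c p /\ `|chart_map c p - x0| <= 2 * r.
Implicit Types (u v : section_of S) (p q : M) (x : rV) (t : R).

Let r0 : 0 < r. Proof. exact: patch_radius_gt0. Qed.

(** [chart_inv] is arbitrary off the chart image; the bump removes those points and is 1 wherever
    [chi] is nonzero in the chart. *)
Definition patch_cutoff x : R := bumpf x0 (2 * r) (3 * r) x * chi (chart_inv c x).
Local Notation rho := patch_cutoff.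

Let rr : 0 <= 2 * r < 3 * r. Proof. by apply/andP; split; have := r0; lra. Qed.

Lemma patch_cutoff_supp x : rho x != 0 -> `|x - x0| <= 2 * r.
Proof.
rewrite mulf_eq0 negb_or => /andP[/(bumpf_supp rr)/ltW/patch_img/chart_imgK[_ xE]].
by move=> /chi_supp[_]; rewrite xE.
Qed.

Lemma patch_cutoff_supp3 x : rho x != 0 -> `|x - x0| <= 3 * r.
Proof. by move=> /patch_cutoff_supp/le_trans; apply; rewrite ler_pM2r// ler_nat. Qed.

Lemma patch_cutoffE p : chart_dom c p -> rho (chart_map c p) = chi p.
Proof.
move=> cp; rewrite /rho chart_mapK//; have [->|cn] := eqVneq (chi p) 0; first by rewrite mulr0.
by rewrite bumpf_eq1 ?mul1r//; have [] := chi_supp cn.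
Qed.

Lemma tf_patch_cutoff : tf rho.
Proof.
have bs x : bumpf x0 (2 * r) (3 * r) x != 0 -> `|x - x0| <= 3 * r by move=> /(bumpf_supp rr)/ltW.
apply: (tf_mul_local _ (chart_img_open (c := c)) bs).
- by apply: tf_ball bs; exact: smooth_bumpf.
- by move=> x; exact: patch_img.
by have [] := schi (patch_is_chart P); rewrite setIT.
Qed.

Definition cloc u (l : 'I_k) x : R[i] := (rho x)%:C%C * patch_loc P u x l 0.

Lemma ctf_cloc u l : smooth_cpt u -> ctf (cloc u l).
Proof. by move=> [su _]; exact: (ctf_loc l tf_patch_cutoff patch_cutoff_supp3 su). Qed.

Lemma cloc_supp u l x : cloc u l x != 0 -> `|x - x0| <= 2 * r.
Proof.
by move=> ux; apply: patch_cutoff_supp; apply: contraNneq ux => r1; rewrite /cloc r1 mul0r.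
Qed.

Lemma cloc_lin (a : R[i]) u v l x :
  cloc (fun q => a *: u q + v q) l x = a * cloc u l x + cloc v l x.
Proof.
rewrite /cloc; have [->|/patch_cutoff_supp3/patch_img ix] := eqVneq (rho x) 0.
  by rewrite !mul0r mulr0 addr0.
by rewrite patch_loc_lin// !mxE mulrDr mulrCA.
Qed.

Definition patch_mollify t u : section_of S :=
  patch_lift P (fun x => \col_l cconv (moll t) (cloc u l) x).

(** This is where [t < r] is used: mollifying enlarges the support from radius [2 r] to
    [2 r + t]. *)
Lemma cconv_cloc_supp t u l x : 0 < t < r -> cconv (moll t) (cloc u l) x != 0 ->
  `|x - x0| <= 3 * r.
Proof.
move=> /andP[t0 tr] cx.
have := cconv_supp (fun z => @moll_supp R n t z t0) (fun y => @cloc_supp u l y) cx.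
by move=> /le_trans; apply; move: tr; lra.
Qed.

Lemma ctf_cconv_cloc t u l : 0 < t < r -> smooth_cpt u -> ctf (cconv (moll t) (cloc u l)).
Proof. by move=> /andP[t0 _] su; apply: ctf_cconv; [exact: tf_moll|exact: ctf_cloc]. Qed.

Lemma vtf_mollify t u : 0 < t < r -> smooth_cpt u ->
  vtf P (fun x => \col_l cconv (moll t) (cloc u l) x).
Proof.
move=> tr su; apply: vtf_col => [l|l x]; last exact: cconv_cloc_supp.
exact: ctf_csmooth (ctf_cconv_cloc l tr su).
Qed.

Lemma patch_mollify_lin t (a : R[i]) u v p : 0 < t < r -> smooth_cpt u -> smooth_cpt v ->
  patch_mollify t (fun q => a *: u q + v q) p = a *: patch_mollify t u p + patch_mollify t v p.
Proof.
move=> /andP[t0 tr] su sv; rewrite /patch_mollify -patch_lift_lin.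
congr (patch_lift P _ p); apply/funext => x; apply/colP => l; rewrite !mxE.
rewrite -cconv_lin; [|exact: tf_moll|exact: ctf_cloc|exact: ctf_cloc].
by congr (cconv _ _ x); apply/funext => y; exact: cloc_lin.
Qed.

(** Coordinate expressions controlled by the energy of [u], uniformly in [t]. Stability under sums,
    multiplication by coefficients and mollification lets a commutator be bounded term by term. *)
Definition bounded_family (G : R -> section_of S -> rV -> R[i]) :=
  exists2 C : R, 0 <= C & forall t u, 0 < t < r -> smooth_cpt u ->
    ctf (G t u) /\ cLeb2 (G t u) <= C * nrm2 h mu u.

Lemma bounded_familyD G1 G2 : bounded_family G1 -> bounded_family G2 ->
  bounded_family (fun t u x => G1 t u x + G2 t u x).
Proof.
move=> [C1 C10 h1] [C2 C20 h2]; exists (2 * C1 + 2 * C2).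
  by rewrite addr_ge0// mulr_ge0.
move=> t u tr su; have [c1 b1] := h1 t u tr su; have [c2 b2] := h2 t u tr su.
split; first exact: ctfD.
apply: le_trans (cLeb2D c1 c2) _; nra.
Qed.

Lemma bounded_family_sum (I : Type) (s : seq I) (G : I -> R -> section_of S -> rV -> R[i]) :
  (forall i, bounded_family (G i)) -> bounded_family (fun t u x => \sum_(i <- s) G i t u x).
Proof.
move=> bG; elim: s => [|i s IH].
  exists 0 => // t u tr su.
  rewrite (_ : (fun x => _) = fun=> 0); last by apply/funext => x; rewrite big_nil.
  split; first exact: ctf0.
  by rewrite mul0r /cLeb2 (_ : (fun x => _) = fun=> 0) ?Leb0//; apply/funext => x; rewrite /csq /= expr0n addr0.
rewrite (_ : (fun t u x => _) = fun t u x => G i t u x + \sum_(i <- s) G i t u x).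
  exact: bounded_familyD.
by apply/funext => t; apply/funext => u; apply/funext => x; rewrite big_cons.
Qed.

Lemma bounded_family_mul (a : rV -> R[i]) (B : R) G : csmooth_on setT a -> 0 <= B ->
  (forall x, csq (a x) <= B) -> bounded_family G -> bounded_family (fun t u x => a x * G t u x).
Proof.
move=> sa B0 aB [C C0 hG]; exists (B * C) => [|t u tr su]; first by rewrite mulr_ge0.
have [cG bG] := hG t u tr su; have cm := ctfM cG sa; split=> //.
apply: (@le_trans _ _ (B * cLeb2 (G t u))); last by rewrite -mulrA ler_wpM2l.
by apply: cLeb2_bounded => // x; rewrite csqM ler_wpM2r// csq_ge0.
Qed.

Lemma bounded_family_ctf (a : rV -> R[i]) G : ctf a -> bounded_family G ->
  bounded_family (fun t u x => a x * G t u x).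
Proof.
move=> ca bG; have [B B0 aB] := csq_ctf_bound ca.
exact: bounded_family_mul (ctf_csmooth ca) B0 aB bG.
Qed.

Lemma bounded_familyB G1 G2 : bounded_family G1 -> bounded_family G2 ->
  bounded_family (fun t u x => G1 t u x - G2 t u x).
Proof.
move=> b1 b2; rewrite (_ : (fun t u x => _) = fun t u x => G1 t u x + (fun=> -1) x * G2 t u x).
  apply: bounded_familyD => //; apply: (@bounded_family_mul (fun=> -1) 1) => //.
    exact: csmooth_cst.
  by move=> _; rewrite /csq /= oppr0 expr0n addr0 sqrrN expr1n.
by apply/funext => t; apply/funext => u; apply/funext => x; rewrite mulN1r.
Qed.

Lemma bounded_family_conv G : bounded_family G ->
  bounded_family (fun t u => cconv (moll t) (G t u)).
Proof.
move=> [C C0 hG]; exists ((4 ^+ n) ^+ 2 * C) => [|t u tr su].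
  by rewrite mulr_ge0// exprn_ge0// exprn_ge0.
have [cG bG] := hG t u tr su; have /andP[t0 _] := tr.
split; first by apply: ctf_cconv => //; exact: tf_moll.
by apply: le_trans (cLeb2_cconv t0 cG) _; rewrite -mulrA ler_wpM2l.
Qed.

Lemma bounded_family_loc psi l : tf psi -> (forall x, psi x != 0 -> `|x - x0| <= 3 * r) ->
  bounded_family (fun _ u x => (psi x)%:C%C * patch_loc P u x l 0).
Proof.
move=> tp ps; have [C C0 hC] := cLeb2_loc h ub tp ps.
exists C => // t u tr su; split; last exact: hC.
by apply: ctf_loc => //; exact: su.1.
Qed.

Lemma bounded_family_cloc l : bounded_family (fun _ u => cloc u l).
Proof. exact: (bounded_family_loc l tf_patch_cutoff patch_cutoff_supp3). Qed.

Lemma bounded_family_lift (G : 'I_k -> R -> section_of S -> rV -> R[i]) :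
  (forall i, bounded_family (G i)) ->
  exists2 C : R, 0 <= C & forall t u, 0 < t < r -> smooth_cpt u ->
    vtf P (fun x => \col_i G i t u x) ->
    nrm2 h mu (patch_lift P (fun x => \col_i G i t u x)) <= C * nrm2 h mu u.
Proof.
move=> bG; have [C C0 hC] := nrm2_lift h ub P.
have /choice[B BP] : forall i, exists B : R, 0 <= B /\ forall t u, 0 < t < r -> smooth_cpt u ->
    cLeb2 (G i t u) <= B * nrm2 h mu u.
  by move=> i; have [B B0 hB] := bG i; exists B; split=> // t u tr su; have [] := hB t u tr su.
exists (C * \sum_i B i) => [|t u tr su vW].
  by rewrite mulr_ge0// sumr_ge0// => i _; have [] := BP i.
apply: le_trans (hC _ vW) _; rewrite -mulrA ler_wpM2l// mulr_suml; apply: ler_sum => i _.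
rewrite (_ : (fun x => _) = G i t u); last by apply/funext => x; rewrite mxE.
by have [_] := BP i; apply.
Qed.

(** Uniform smallness gives small energy because the supports share a cube of finite volume; the
    factor [k] counts the components. *)
Lemma nrm2_lift_sup : exists2 C : R, 0 <= C & forall (W : 'I_k -> rV -> R[i]) (e : R),
  vtf P (fun x => \col_l W l x) -> 0 <= e -> (forall l x, csq (W l x) <= e) ->
  nrm2 h mu (patch_lift P (fun x => \col_l W l x)) <= C * e.
Proof.
have [C C0 hC] := nrm2_lift h ub P.
exists (C * (k%:R * ((3 * r) *+ 2) ^+ n)) => [|W e vW e0 We].
  by rewrite mulr_ge0// mulr_ge0// exprn_ge0// mulrn_wge0// mulr_ge0// ltW.
apply: le_trans (hC _ vW) _; rewrite -mulrA ler_wpM2l//.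
rewrite -mulrA mulr_natl -[k in _ *+ k]card_ord -sumr_const; apply: ler_sum => l _.
rewrite (_ : (fun x => _) = W l); last by apply/funext => x; rewrite mxE.
rewrite mulrC; apply: (@cLeb2_le_ball _ _ _ x0) => //.
- by have := vtf_ctf l vW; rewrite (_ : (fun x => _) = W l)//; apply/funext => x; rewrite mxE.
- by rewrite mulr_ge0// ltW.
move=> x Wx; apply: vW.2; apply: contraNneq Wx => /colP/(_ l); by rewrite !mxE => ->.
Qed.

Lemma patch_liftB W1 W2 p : patch_lift P (fun x => W1 x - W2 x) p =
  patch_lift P W1 p - patch_lift P W2 p.
Proof.
rewrite -[in RHS]scaleN1r addrC -patch_lift_lin; congr (patch_lift P _ p).
by apply/funext => x; rewrite scaleN1r addrC.
Qed.

Lemma colB (f g : 'I_k -> rV -> R[i]) :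
  (fun x => \col_l f l x - \col_l g l x) = fun x => \col_l (f l x - g l x) :> 'cV[R[i]]_k.
Proof. by apply/funext => x; apply/colP => l; rewrite !mxE. Qed.

Lemma vtfB (f g : 'I_k -> rV -> R[i]) : vtf P (fun x => \col_l f l x) ->
  vtf P (fun x => \col_l g l x) -> vtf P (fun x => \col_l (f l x - g l x)).
Proof.
move=> vf vg; rewrite -colB.
rewrite (_ : (fun x => _) = fun x => -1 *: \col_l g l x + \col_l f l x); first exact: vtf_lin.
by apply/funext => x; rewrite scaleN1r addrC.
Qed.

Lemma vtf_cloc u : smooth_cpt u -> vtf P (fun x => \col_l cloc u l x).
Proof.
move=> su; apply: vtf_col => [l|l x]; first exact/ctf_csmooth/ctf_cloc.
by move=> /cloc_supp/le_trans; apply; rewrite ler_pM2r// ler_nat.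
Qed.

(** Localizing and lifting back without mollification is multiplication by [chi], hence the limit as
    [t] tends to 0. *)
Lemma patch_lift_cloc u p : patch_lift P (fun x => \col_l cloc u l x) p = (chi p)%:C%C *: u p.
Proof.
rewrite /patch_lift; case: asboolP => cp; last first.
  have -> : chi p = 0 by apply/eqP/negPn/negP => /chi_supp[/cp].
  by rewrite scale0r.
have tp : triv_dom T p by rewrite -patch_dom.
rewrite (_ : (\col_l _) = (chi p)%:C%C *: triv_map T (u p) + 0).
  by rewrite triv_inv_linear// triv_mapK// triv_inv0// addr0.
by apply/colP => l; rewrite !mxE addr0 /cloc patch_cutoffE// /patch_loc chart_mapK.
Qed.

End patch_operator.

Section patch_mollifies.
Context {R : realType} {n : nat} {M : manifold R n} {k : nat} {S : vbundle M k}.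
Context (h : hermitian_metric S) {mu : {measure set (borel M) -> \bar R}}.
Hypothesis ub : uniformly_bounded_densities mu.
Variables (P : patch S mu) (chi : M -> R).
Local Notation rV := ('rV[R]_n).
Local Notation x0 := (patch_center P).
Local Notation r := (patch_radius P).
Local Notation rho := (patch_cutoff P chi).
Local Notation cloc := (cloc P chi).
Local Notation patch_mollify := (patch_mollify P chi).
Hypothesis schi : msmooth_on setT (fun p => (chi p)%:C%C).
Hypothesis chi_supp :
  forall p, chi p != 0 -> chart_dom (patch_chart P) p /\ `|chart_map (patch_chart P) p - x0| <= 2 * r.
Implicit Types (u v : section_of S) (p q : M) (x : rV) (t : R).

Lemma patch_mollify_bounded : exists2 C : R, 0 <= C & forall t u, 0 < t < r -> smooth_cpt u ->
  nrm2 h mu (patch_mollify t u) <= C * nrm2 h mu u.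
Proof.
have bf l : bounded_family h P (fun t u => cconv (moll t) (cloc u l)).
  apply: bounded_family_conv; exact: bounded_family_cloc.
have [C C0 hC] := bounded_family_lift ub bf; exists C => // t u tr su.
by apply: hC => //; exact: vtf_mollify.
Qed.

Lemma patch_mollify_approx u : smooth_cpt u -> exists2 C : R, 0 <= C & forall t, 0 < t < r ->
  nrm2 h mu (fun p => patch_mollify t u p - (chi p)%:C%C *: u p) <= C * t ^+ 2.
Proof.
move=> su; have [C C0 hC] := nrm2_lift_sup h ub P.
have /choice[B BP] : forall l, exists B : R, 0 <= B /\ forall t x, 0 < t ->
    csq (cconv (moll t) (cloc u l) x - cloc u l x) <= B * t ^+ 2.
  by move=> l; have [B B0 hB] := cconv_approx (ctf_cloc schi chi_supp l su); exists B.
have B0 l : 0 <= B l by have [] := BP l.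
exists (C * \sum_l B l) => [|t tr]; first by rewrite mulr_ge0// sumr_ge0.
have /andP[t0 _] := tr.
rewrite (_ : (fun p => _) = patch_lift P (fun x => \col_l (cconv (moll t) (cloc u l) x - cloc u l x))).
  rewrite -mulrA; apply: (hC (fun l x => cconv (moll t) (cloc u l) x - cloc u l x)).
  - apply: (vtfB (f := fun l => cconv (moll t) (cloc u l)) (g := fun l => cloc u l)).
      exact: vtf_mollify.
    exact: vtf_cloc.
  - by rewrite mulr_ge0 ?sqr_ge0// sumr_ge0.
  move=> l x; have [_ h1] := BP l; apply: le_trans (h1 _ _ t0) _.
  apply: ler_wpM2r; first exact: sqr_ge0.
  by rewrite (bigD1 l)//= lerDl sumr_ge0.
apply: functional_extensionality_dep => p.
rewrite -(colB (fun l => cconv (moll t) (cloc u l)) (fun l => cloc u l)) patch_liftB.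
by rewrite patch_lift_cloc.
Qed.

(** The cut-off coordinates form Cauchy sequences, so their mollifications converge uniformly to
    smooth functions. The limits inherit the common support, and their lift is the required
    section. *)
Lemma patch_mollify_smoothing t (u : nat -> section_of S) : 0 < t < r -> (forall m, smooth_cpt (u m)) ->
  (forall e, 0 < e -> exists N, forall m m', (N <= m)%N -> (N <= m')%N ->
     nrm2 h mu (fun p => u m p - u m' p) <= e) ->
  exists2 v, smooth_cpt v & forall e, 0 < e -> exists N, forall m, (N <= m)%N ->
    nrm2 h mu (fun p => patch_mollify t (u m) p - v p) <= e.
Proof.
move=> tr su uc; have /andP[t0 _] := tr; have r0 := patch_radius_gt0 P.
have tm := @tf_moll R n t t0.
have cc0 l m := ctf_cloc schi chi_supp l (su m).
have cs l m x : cloc (u m) l x != 0 -> `|x - x0| <= 3 * r.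
  by move=> /(cloc_supp chi_supp)/le_trans; apply; rewrite ler_pM2r// ler_nat.
have lc l e : 0 < e -> exists N, forall m m', (N <= m)%N -> (N <= m')%N ->
    cLeb2 (fun x => cloc (u m) l x - cloc (u m') l x) <= e.
  move=> e0; have [C C0 hC] := cLeb2_loc h ub (tf_patch_cutoff P schi) (patch_cutoff_supp3 chi_supp).
  have e1 : 0 < e / (C + 1) by rewrite divr_gt0// ltr_wpDl.
  have [N NP] := uc _ e1; exists N => m m' Nm Nm'.
  rewrite (_ : (fun x => _) = fun x => cloc (fun p => u m p - u m' p) l x); last first.
    apply/funext => x; rewrite (_ : (fun p => _) = fun p => -1 *: u m' p + u m p).
      by rewrite (cloc_lin chi_supp) mulN1r addrC.
    by apply: functional_extensionality_dep => p; rewrite scaleN1r addrC.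
  apply: le_trans (hC _ l (smooth_cptB (su m) (su m'))) _.
  apply: (@le_trans _ _ ((C + 1) * (e / (C + 1)))).
    by apply: ler_pM => //; [exact: nrm2_ge0|rewrite lerDl|exact: NP].
  by rewrite mulrC divfK// gt_eqF// ltr_wpDl.
have r3 : 0 <= 3 * r by rewrite mulr_ge0// ltW.
have /choice[W WP] l : exists W : rV -> R[i], [/\ csmooth_on setT W,
    forall x, W x != 0 -> exists m, cconv (moll t) (cloc (u m) l) x != 0 &
    forall e, 0 < e -> exists N, forall m x, (N <= m)%N ->
      csq (cconv (moll t) (cloc (u m) l) x - W x) <= e].
  exact: csmoothing_limit tm (cc0 l) r3 (cs l) (lc l).
have vW : vtf P (fun x => \col_l W l x).
  apply: vtf_col => [l|l x]; first by have [] := WP l.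
  have [_ h1 _] := WP l; move=> /h1[m]; exact: cconv_cloc_supp.
exists (patch_lift P (fun x => \col_l W l x)); first exact: smooth_patch_lift.
move=> e e0; have [C C0 hC] := nrm2_lift_sup h ub P.
have e1 : 0 < e / (C + 1) by rewrite divr_gt0// ltr_wpDl.
have /choice[N NP] l : exists N, forall m x, (N <= m)%N ->
    csq (cconv (moll t) (cloc (u m) l) x - W l x) <= e / (C + 1).
  by have [_ _] := WP l; apply.
exists (\max_l N l) => m Nm.
rewrite (_ : (fun p => _) = patch_lift P (fun x => \col_l (cconv (moll t) (cloc (u m) l) x - W l x))).
  apply: (@le_trans _ _ (C * (e / (C + 1)))).
    apply: (hC (fun l x => cconv (moll t) (cloc (u m) l) x - W l x)).
    - by apply: (vtfB (f := fun l => cconv (moll t) (cloc (u m) l)) (g := W)) => //; exact: vtf_mollify.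
    - exact: ltW.
    - by move=> l x; apply: NP; apply: leq_trans Nm; exact: leq_bigmax.
  apply: (@le_trans _ _ ((C + 1) * (e / (C + 1)))); first by apply: ler_wpM2r; [exact: ltW|rewrite lerDl].
  by rewrite mulrC divfK// gt_eqF// ltr_wpDl.
apply: functional_extensionality_dep => p.
by rewrite -(colB (fun l => cconv (moll t) (cloc (u m) l)) W) patch_liftB.
Qed.

(** The product rule moves the cutoff inside the derivative, at the price of a zero-order term with
    a derivative of [rho]. *)
Lemma cloc_diffop (D : diffop S) a b u i x :
  (forall u i x, smooth_section u -> `|x - x0| <= 3 * r ->
     patch_loc P (D u) x i 0 = symbol a b (fun l y => patch_loc P u y l 0) i x) ->
  smooth_section u ->
  cloc (D u) i x = \sum_j \sum_l (a j i l x * cpartial j (cloc u l) x -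
    a j i l x * ((partial j rho x)%:C%C * patch_loc P u x l 0)) + \sum_l b i l x * cloc u l x.
Proof.
move=> DE su; have [xr|xr] := pselect (`|x - x0| <= 3 * r).
  rewrite {1}/cloc DE// /symbol mulrDr; congr (_ + _).
    rewrite mulr_sumr; apply: eq_bigr => j _; rewrite mulr_sumr; apply: eq_bigr => l _.
    rewrite (cpartial_scale j (patch_img xr) (tf_patch_cutoff P schi).1 (patch_loc_smooth P l su)).
    by rewrite mulrDr addrK mulrCA.
  by rewrite mulr_sumr; apply: eq_bigr => l _; rewrite mulrCA.
have r1 : rho x = 0 by apply/eqP/negPn/negP => /(patch_cutoff_supp3 chi_supp).
have d0 j : partial j rho x = 0.
  apply/eqP/negPn/negP => gx; apply: xr.
  exact: (partial_supp (@closed_norm_ball _ _ x0 (3 * r)) (patch_cutoff_supp3 chi_supp) gx).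
have c0 l : cloc u l x = 0 by rewrite /cloc r1 mul0r.
have cd0 j l : cpartial j (cloc u l) x = 0.
  apply/eqP/negPn/negP => gx; apply: xr.
  apply: (cpartial_supp (@closed_norm_ball _ _ x0 (3 * r)) _ gx) => y yu.
  by apply: (patch_cutoff_supp3 chi_supp); apply: contraNneq yu => ry; rewrite /cloc ry mul0r.
have -> : cloc (D u) i x = 0 by rewrite /cloc r1 mul0r.
rewrite !big1 ?addr0// => l _; first by rewrite c0 mulr0.
by rewrite big1// => m _; rewrite cd0 d0 mul0r !mulr0 subrr.
Qed.

Lemma patch_mollify_commutator (D : diffop S) : exists2 C : R, 0 <= C &
  forall t u, 0 < t < r -> smooth_cpt u ->
  nrm2 h mu (fun p => D (patch_mollify t u) p - patch_mollify t (D u) p) <= C * nrm2 h mu u.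
Proof.
have [a [b [ca cb DE]]] := patch_diffop P D; have r0 := patch_radius_gt0 P.
pose L i t u x := symbol a b (fun l => cconv (moll t) (cloc u l)) i x - cconv (moll t) (cloc (D u) i) x.
pose d j l u x := (partial j rho x)%:C%C * patch_loc P u x l 0.
have dsupp j x : partial j rho x != 0 -> `|x - x0| <= 3 * r.
  exact: (partial_supp (@closed_norm_ball _ _ x0 (3 * r)) (patch_cutoff_supp3 chi_supp)).
have tr := tf_patch_cutoff P schi.
have bd j l : bounded_family h P (fun _ u => d j l u).
  exact: (bounded_family_loc h ub l (tf_partial j tr) (@dsupp j)).
have bc l : bounded_family h P (fun _ u => cloc u l) by exact: bounded_family_cloc.
(* The principal part of the commutator, the only one in which a derivative survives; Friedrichs'
   estimate bounds it. *)
pose G1 j i l t u x := a j i l x * cpartial j (cconv (moll t) (cloc u l)) x -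
  cconv (moll t) (fun y => a j i l y * cpartial j (cloc u l) y) x.
have bG1 j i l : bounded_family h P (G1 j i l).
  have [C1 C10 h1] := cconv_commutator j (ca j i l); have [C2 C20 h2] := bc l.
  exists (C1 * C2) => [|t u tt su]; first by rewrite mulr_ge0.
  have [cl bl] := h2 t u tt su; have /andP[t0 _] := tt; have tm := @tf_moll R n t t0.
  have c1 : ctf (fun x => a j i l x * cpartial j (cconv (moll t) (cloc u l)) x).
    by apply: ctfM; [exact/ctf_cpartial/ctf_cconv|exact: ctf_csmooth].
  have c2 : ctf (cconv (moll t) (fun y => a j i l y * cpartial j (cloc u l) y)).
    by apply: ctf_cconv => //; apply: ctfM; [exact: ctf_cpartial|exact: ctf_csmooth].
  split.
    rewrite (_ : G1 j i l t u = fun x => a j i l x * cpartial j (cconv (moll t) (cloc u l)) x +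
      -1 * cconv (moll t) (fun y => a j i l y * cpartial j (cloc u l) y) x).
      by apply: ctfD => //; apply: ctfM => //; exact: csmooth_cst.
    by apply/funext => x; rewrite mulN1r.
  by apply: le_trans (h1 t _ t0 cl) _; rewrite -mulrA ler_wpM2l.
(* The term produced by differentiating the cutoff contains no derivative of [u]. *)
have bG2 j i l : bounded_family h P (fun t u => cconv (moll t) (fun y => a j i l y * d j l u y)).
  exact: bounded_family_conv (bounded_family_ctf (ca j i l) (bd j l)).
(* For the zero-order part both products are bounded separately. *)
have bG3 i l : bounded_family h P (fun t u x => b i l x * cconv (moll t) (cloc u l) x -
    cconv (moll t) (fun y => b i l y * cloc u l y) x).
  apply: (bounded_familyB (G1 := fun t u x => b i l x * cconv (moll t) (cloc u l) x)
    (G2 := fun t u => cconv (moll t) (fun y => b i l y * cloc u l y))).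
    exact: bounded_family_ctf (cb i l) (bounded_family_conv (bc l)).
  exact: bounded_family_conv (bounded_family_ctf (cb i l) (bc l)).
have LE i t u x : 0 < t < r -> smooth_cpt u -> L i t u x =
    \sum_j \sum_l (G1 j i l t u x + cconv (moll t) (fun y => a j i l y * d j l u y) x) +
    \sum_l (b i l x * cconv (moll t) (cloc u l) x - cconv (moll t) (fun y => b i l y * cloc u l y) x).
  move=> tt su; have /andP[t0 _] := tt; have tm := @tf_moll R n t t0.
  have cu l : ctf (cloc u l) by exact: ctf_cloc.
  have c1 j l : ctf (fun y => a j i l y * cpartial j (cloc u l) y).
    by apply: ctfM; [exact: ctf_cpartial|exact: ctf_csmooth].
  have c2 j l : ctf (fun y => a j i l y * d j l u y).
    by apply: ctfM; [exact: (ctf_loc l (tf_partial j tr) (@dsupp j) su.1)|exact: ctf_csmooth].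
  have c12 j l : ctf (fun y => a j i l y * cpartial j (cloc u l) y - a j i l y * d j l u y).
    rewrite (_ : (fun y => _) = fun y => a j i l y * cpartial j (cloc u l) y + -1 * (a j i l y * d j l u y)).
      by apply: ctfD => //; apply: ctfM => //; exact: csmooth_cst.
    by apply/funext => y; rewrite mulN1r.
  have c3 l : ctf (fun y => b i l y * cloc u l y) by apply: ctfM => //; exact: ctf_csmooth.
  rewrite /L (_ : cloc (D u) i = fun y => 1 * (\sum_j \sum_l (a j i l y * cpartial j (cloc u l) y -
    a j i l y * d j l u y)) + \sum_l b i l y * cloc u l y); last first.
    by apply/funext => y; rewrite mul1r (cloc_diffop i y DE su.1).
  rewrite cconv_lin//; last 2 first.
  - by apply: ctf_sum => j; apply: ctf_sum.
  - exact: ctf_sum.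
  rewrite mul1r cconv_sum//; last by move=> j; apply: ctf_sum.
  rewrite (cconv_sum _ _ tm c3) /symbol opprD addrACA -!sumrB; congr (_ + _).
  apply: eq_bigr => j _; rewrite (cconv_sum _ _ tm (c12 j)) -sumrB; apply: eq_bigr => l _.
  rewrite (_ : (fun y => _ - _) = fun y => -1 * (a j i l y * d j l u y) + a j i l y * cpartial j (cloc u l) y).
    by rewrite cconv_lin// mulN1r opprD opprK /G1 addrCA addrC.
  by apply/funext => y; rewrite mulN1r addrC.
have bL i : bounded_family h P (L i).
  have [C C0 hC] := bounded_familyD
    (bounded_family_sum (index_enum _) (fun j => bounded_family_sum (index_enum _)
      (fun l => bounded_familyD (bG1 j i l) (bG2 j i l))))
    (bounded_family_sum (index_enum _) (bG3 i)).
  exists C => // t u tt su.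
  have -> : L i t u = fun x => \sum_j \sum_l (G1 j i l t u x + cconv (moll t) (fun y => a j i l y * d j l u y) x) +
    \sum_l (b i l x * cconv (moll t) (cloc u l) x - cconv (moll t) (fun y => b i l y * cloc u l y) x).
    by apply/funext => x; exact: LE.
  exact: hC.
have [C C0 hC] := bounded_family_lift ub bL; exists C => // t u tt su.
have v1 : vtf P (fun x => \col_i symbol a b (fun l => cconv (moll t) (cloc u l)) i x).
  apply: vtf_symbol => // [l|l y]; last exact: cconv_cloc_supp.
  exact: ctf_csmooth (ctf_cconv_cloc schi chi_supp l tt su).
have sD : smooth_cpt (D u) by exact: diffop_smooth_cpt.
have v2 : vtf P (fun x => \col_i cconv (moll t) (cloc (D u) i) x) by exact: vtf_mollify.
rewrite (_ : (fun p => _) = patch_lift P (fun x => \col_i L i t u x)).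
  by apply: hC => //; exact: (vtfB (f := fun i => symbol a b (fun l => cconv (moll t) (cloc u l)) i) (g := fun i => cconv (moll t) (cloc (D u) i)) v1 v2).
apply: functional_extensionality_dep => p.
rewrite /L -(colB (fun i => symbol a b (fun l => cconv (moll t) (cloc u l)) i)
  (fun i => cconv (moll t) (cloc (D u) i))) patch_liftB; congr (_ - _).
apply: diffop_lift => // [l|l y]; last exact: cconv_cloc_supp.
exact: ctf_csmooth (ctf_cconv_cloc schi chi_supp l tt su).
Qed.

Lemma patch_mollifies : mollifies h mu chi r patch_mollify.
Proof.
split.
- by move=> t a u v tr su sv p; exact: patch_mollify_lin.
- by move=> t u tr su; apply: smooth_patch_lift; exact: vtf_mollify.
- exact: patch_mollify_bounded.
- exact: patch_mollify_approx.
- by split; [exact: patch_mollify_smoothing|exact: patch_mollify_commutator].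
Qed.

End patch_mollifies.

(** * Gluing patches *)

Section mollifier_sums.
Context {R : realType} {n : nat} {M : manifold R n} {k : nat} {S : vbundle M k}.
Context (h : hermitian_metric S) {mu : {measure set (borel M) -> \bar R}}.
Hypothesis ub : uniformly_bounded_densities mu.
Implicit Types (u v : section_of S) (chi : M -> R).

Lemma nrm2D u v : smooth_cpt u -> smooth_cpt v ->
  nrm2 h mu (fun p => u p + v p) <= 2 * nrm2 h mu u + 2 * nrm2 h mu v.
Proof.
move=> su sv; have suv : smooth_cpt (fun p => u p + v p).
  rewrite (_ : (fun p => _) = fun p => 1 *: u p + v p); first exact: smooth_cpt_lin.
  by apply: functional_extensionality_dep => p; rewrite scale1r.
have mu1 := measurable_hnorm2 h su.1; have mv1 := measurable_hnorm2 h sv.1.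
have n0 w p : (0 <= (hnorm2 h (w p : S p))%:E)%E by rewrite lee_fin hnorm2_ge0.
rewrite -lee_fin EFinD !EFinM -!energyE// -!ge0_integralZl//.
have m1 : measurable_fun setT (fun p : borel M => (2%:E * (hnorm2 h (u p))%:E)%E : \bar R).
  exact: measurable_funeM.
have m2 : measurable_fun setT (fun p : borel M => (2%:E * (hnorm2 h (v p))%:E)%E : \bar R).
  exact: measurable_funeM.
have p1 w p : (0 <= 2%:E * (hnorm2 h (w p : S p))%:E)%E by rewrite mule_ge0.
rewrite -ge0_integralD//.
apply: ge0_le_integral => //.
- by move=> p _; exact: (n0 (fun p => u p + v p)).
- exact: (measurable_hnorm2 h suv.1).
- by apply: emeasurable_funD.
by move=> p _; rewrite -!EFinM -EFinD lee_fin hnorm2D.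
Qed.

Lemma nrm2_0 : nrm2 h mu (fun p => 0 : S p) = 0.
Proof. by rewrite /nrm2 (integral0_eq)//= => p _; rewrite /hnorm2 herm0l. Qed.

Lemma mollifies0 : mollifies h mu (fun=> 0) 1 (fun _ _ p => 0 : S p).
Proof.
split.
- by move=> *; rewrite scaler0 addr0.
- by move=> *; exact: smooth_cpt0.
- by exists 0 => // *; rewrite nrm2_0 mul0r.
- move=> u su; exists 0 => // t _; rewrite (_ : (fun p => _) = fun p => 0 : S p).
    by rewrite nrm2_0 mul0r.
  by apply: functional_extensionality_dep => p; rewrite scale0r subr0.
split=> [t u _ su _|D].
  exists (fun p => 0 : S p); first exact: smooth_cpt0.
  move=> e e0; exists 0 => m _; rewrite (_ : (fun p => _) = fun p => 0 : S p).
    by rewrite nrm2_0 ltW.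
  by apply: functional_extensionality_dep => p; rewrite subr0.
exists 0 => // t u _ su; rewrite (_ : (fun p => _) = fun p => 0 : S p).
  by rewrite nrm2_0 mul0r.
by apply: functional_extensionality_dep => p; rewrite diffop0 subr0.
Qed.

(** The sum is written with a scalar 1 to match the form in which linearity of sections and
    operators is stated. *)
Lemma mollifiesD chi1 chi2 e1 e2 E1 E2 :
  msmooth_on setT (fun p => (chi1 p)%:C%C) -> msmooth_on setT (fun p => (chi2 p)%:C%C) ->
  mollifies h mu chi1 e1 E1 -> mollifies h mu chi2 e2 E2 ->
  mollifies h mu (fun p => chi1 p + chi2 p) (Num.min e1 e2)
    (fun t u p => 1 *: E1 t u p + E2 t u p).
Proof.
move=> s1 s2 [L1 S1 B1 A1 [Z1 K1]] [L2 S2 B2 A2 [Z2 K2]].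
have te t : 0 < t < Num.min e1 e2 -> 0 < t < e1 /\ 0 < t < e2.
  by rewrite lt_min => /andP[-> /andP[-> ->]].
split.
- move=> t a u v /te[t1 t2] su sv p; rewrite L1// L2// !scale1r scalerDr.
  by rewrite addrACA.
- by move=> t u /te[t1 t2] su; apply: smooth_cpt_lin; [exact: S1|exact: S2].
- have [C1 C10 h1] := B1; have [C2 C20 h2] := B2.
  exists (2 * C1 + 2 * C2) => [|t u /te[t1 t2] su]; first by rewrite addr_ge0// mulr_ge0.
  rewrite (_ : (fun p => _) = fun p => E1 t u p + E2 t u p); last first.
    by apply: functional_extensionality_dep => p; rewrite scale1r.
  apply: le_trans (nrm2D (S1 _ _ t1 su) (S2 _ _ t2 su)) _.
  by have := h1 _ _ t1 su; have := h2 _ _ t2 su; lra.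
- move=> u su; have [C1 C10 h1] := A1 u su; have [C2 C20 h2] := A2 u su.
  exists (2 * C1 + 2 * C2) => [|t /te[t1 t2]]; first by rewrite addr_ge0// mulr_ge0.
  rewrite (_ : (fun p => _) = fun p => (E1 t u p - (chi1 p)%:C%C *: u p) +
    (E2 t u p - (chi2 p)%:C%C *: u p)); last first.
    by apply: functional_extensionality_dep => p; rewrite scale1r rmorphD scalerDl opprD addrACA.
  apply: le_trans (nrm2D _ _) _.
  - by apply: smooth_cptB; [exact: S1|exact: smooth_cpt_scale].
  - by apply: smooth_cptB; [exact: S2|exact: smooth_cpt_scale].
  by have := h1 _ t1; have := h2 _ t2; lra.
split.
  move=> t u /te[t1 t2] su uc; have [v1 sv1 c1] := Z1 t u t1 su uc.
  have [v2 sv2 c2] := Z2 t u t2 su uc.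
  exists (fun p => 1 *: v1 p + v2 p); first exact: smooth_cpt_lin.
  move=> e e0; have e4 : 0 < e / 4 by rewrite divr_gt0.
  have [N1 h1] := c1 _ e4; have [N2 h2] := c2 _ e4.
  exists (maxn N1 N2) => m; rewrite geq_max => /andP[/h1 b1 /h2 b2].
  rewrite (_ : (fun p => _) = fun p => (E1 t (u m) p - v1 p) + (E2 t (u m) p - v2 p)); last first.
    by apply: functional_extensionality_dep => p; rewrite !scale1r opprD addrACA.
  apply: le_trans (nrm2D _ _) _; first by apply: smooth_cptB => //; exact: S1.
    by apply: smooth_cptB => //; exact: S2.
  by move: b1 b2; lra.
move=> D; have [C1 C10 h1] := K1 D; have [C2 C20 h2] := K2 D.
exists (2 * C1 + 2 * C2) => [|t u /te[t1 t2] su]; first by rewrite addr_ge0// mulr_ge0.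
have sE1 := S1 _ _ t1 su; have sE2 := S2 _ _ t2 su; have sD := diffop_smooth_cpt D su.
rewrite (_ : (fun p => _) = fun p => (D (E1 t u) p - E1 t (D u) p) + (D (E2 t u) p - E2 t (D u) p)); last first.
  apply: functional_extensionality_dep => p.
  by rewrite (diffop_linear D 1 sE1.1 sE2.1) !scale1r opprD addrACA.
apply: le_trans (nrm2D _ _) _.
- by apply: smooth_cptB; [exact: diffop_smooth_cpt|exact: S1].
- by apply: smooth_cptB; [exact: diffop_smooth_cpt|exact: S2].
by have := h1 _ _ t1 su; have := h2 _ _ t2 su; lra.
Qed.

Section patch_cover.
Variable P : patch S mu.
Local Notation c := (patch_chart P).
Local Notation x0 := (patch_center P).
Local Notation r := (patch_radius P).

Definition patch_chi (p : M) : R :=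
  if `[< chart_dom c p >] then bumpf x0 r (2 * r) (chart_map c p) else 0.

Lemma patch_chi_range : 0 <= r < 2 * r.
Proof. by have := patch_radius_gt0 P; move=> *; apply/andP; split; lra. Qed.

Lemma patch_chi_supp p : patch_chi p != 0 -> chart_dom c p /\ `|chart_map c p - x0| <= 2 * r.
Proof.
rewrite /patch_chi; case: asboolP => [cp|_]; last by rewrite eqxx.
by move=> /(bumpf_supp patch_chi_range)/ltW.
Qed.

Lemma patch_chi1 p : patch_core P p -> patch_chi p = 1.
Proof.
move=> [cp /= pr]; rewrite /patch_chi asboolT// bumpf_eq1//; first exact: patch_chi_range.
exact: ltW.
Qed.

Lemma patch_chi_smooth : msmooth_on setT (fun p => (patch_chi p)%:C%C).
Proof.
apply: msmooth_pt => p _; have [cp|ncp] := pselect (chart_dom c p).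
  exists (chart_dom c); split=> //; first exact: chart_dom_open.
  apply: msmooth_local => q cq; exists c, (chart_dom c); split=> //.
  - exact: patch_is_chart.
  - exact: chart_dom_open.
  rewrite setIid; apply: (@csmooth_ext _ _ _ (fun x => (bumpf x0 r (2 * r) x)%:C%C)).
  - exact: chart_img_open.
  - by move=> _ [s cs <-] /=; rewrite chart_mapK// /patch_chi asboolT.
  by apply: csmooth_sub (csmooth_real (smooth_bumpf _ _ _)).
exists (~` patch_cube P); split.
- by move=> [x /patch_img/chart_imgK[cx _] xp]; apply: ncp; rewrite -xp.
- exact/closed_openC/closed_patch_cube.
apply: (@msmooth_ext _ _ _ _ (fun=> 0)) (msmooth_cst _ _).
  exact/closed_openC/closed_patch_cube.
move=> q Cq; rewrite (_ : patch_chi q = 0)//; apply/eqP/negPn/negP => /patch_chi_supp[cq qr].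
apply: Cq; exists (chart_map c q); last by rewrite chart_mapK.
by apply: le_trans qr _; rewrite ler_pM2r ?patch_radius_gt0// ler_nat.
Qed.

End patch_cover.

Lemma compact_mollifies (K : set M) : compact K ->
  exists chi eps E, [/\ forall p, K p -> chi p = 1, 0 < eps & mollifies h mu chi eps E].
Proof.
move=> /(compact_patches S ub)[P [s Ks]].
(* The induction also carries smoothness of [chi], since the cutoff of the next patch is built from
   it. *)
suff [chi [eps [E [chi1 e0 _ mE]]]] : exists chi eps E,
    [/\ forall p, (exists2 q, q \in s & patch_core (P q) p) -> chi p = 1, 0 < eps,
      msmooth_on setT (fun p => (chi p)%:C%C) & mollifies h mu chi eps E].
  by exists chi, eps, E; split=> // p /Ks/chi1.
elim: s {Ks} => [|q s [chi [eps [E [chi1 e0 schi mE]]]]].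
  exists (fun=> 0), 1, (fun _ _ p => 0 : S p); split=> //.
  - by move=> p [].
  - exact: msmooth_cst.
  - exact: mollifies0.
pose chiq p := patch_chi (P q) p * (1 - chi p).
have sq : msmooth_on setT (fun p => (chiq p)%:C%C).
  rewrite (_ : (fun p => _) = fun p => (patch_chi (P q) p)%:C%C * (1 + -1 * (chi p)%:C%C)).
    apply: (msmoothM openT); first exact: patch_chi_smooth.
    apply: (msmoothD openT); first exact: msmooth_cst.
    by apply: (msmoothM openT) => //; exact: msmooth_cst.
  by apply/funext => p; rewrite mulN1r -rmorphN -(rmorph1 (real_complex R)) -rmorphD -rmorphM.
have cq p : chiq p != 0 -> chart_dom (patch_chart (P q)) p /\
    `|chart_map (patch_chart (P q)) p - patch_center (P q)| <= 2 * patch_radius (P q).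
  by rewrite mulf_eq0 negb_or => /andP[/patch_chi_supp].
have mq := patch_mollifies h ub sq cq.
exists (fun p => chiq p + chi p), (Num.min (patch_radius (P q)) eps).
exists (fun t u p => 1 *: patch_mollify (P q) chiq t u p + E t u p); split.
- move=> p [q']; rewrite inE => /predU1P[->|q's] pq; rewrite /chiq.
    by rewrite patch_chi1// mul1r subrK.
  by rewrite chi1 ?subrr ?mulr0 ?add0r//; exists q'.
- by rewrite lt_min patch_radius_gt0.
- rewrite (_ : (fun p => _) = fun p => (chiq p)%:C%C + (chi p)%:C%C).
    exact: (msmoothD openT).
  by apply/funext => p; rewrite rmorphD.
exact: mollifiesD.
Qed.

End mollifier_sums.

(** * Extension to the completion *)

Section L2_extension.
Context {R : realType} {n : nat} {M : manifold R n} {k : nat} {S : vbundle M k}.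
Context {h : hermitian_metric S} {mu : {measure set (borel M) -> \bar R}} (L2 : L2_space h mu).
Implicit Types (u v : section_of S) (x y : L2) (a : R[i]).

(** The norm of the completion takes values in [R[i]]; its real part allows estimates in the ordered
    field [R]. *)
Definition rnorm x : R := complex.Re `|x|.

Lemma real_ge0 (z : R[i]) : 0 <= z -> z = (complex.Re z)%:C%C.
Proof. by case: z => a b; rewrite lecE /= => /andP[/eqP -> _]. Qed.

Lemma normE x : `|x| = (rnorm x)%:C%C.
Proof. exact: real_ge0. Qed.

Lemma rnorm_ge0 x : 0 <= rnorm x.
Proof. by have := normr_ge0 x; rewrite normE lecR. Qed.

Lemma rnormD x y : rnorm (x + y) <= rnorm x + rnorm y.
Proof. by have := ler_normD x y; rewrite !normE -rmorphD lecR. Qed.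

Lemma rnormN x : rnorm (- x) = rnorm x.
Proof. by rewrite /rnorm normrN. Qed.

Lemma rnorm_dist x y : rnorm (x - y) = rnorm (y - x).
Proof. by rewrite -rnormN opprB. Qed.

Lemma rnorm_triangle y x z : rnorm (x - z) <= rnorm (x - y) + rnorm (y - z).
Proof. by have := rnormD (x - y) (y - z); rewrite subrKA. Qed.

Lemma rnormZ a x : rnorm (a *: x) = complex.Re `|a| * rnorm x.
Proof.
by rewrite /rnorm normrZ (real_ge0 (normr_ge0 a)) (real_ge0 (normr_ge0 x)) -rmorphM.
Qed.

Lemma rnorm_eq0 x : rnorm x = 0 -> x = 0.
Proof. by move=> x0; apply/eqP; rewrite -normr_eq0 normE x0. Qed.

Lemma rnorm_emb u : smooth_cpt u -> rnorm (L2_emb L2 u) ^+ 2 = nrm2 h mu u.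
Proof.
move=> su; have := L2_emb_isometry L2 su; rewrite normE -rmorphXn /= => /(congr1 (@complex.Re R)).
by [].
Qed.

Lemma L2_embB u v : smooth_cpt u -> smooth_cpt v ->
  L2_emb L2 (fun p => u p - v p) = L2_emb L2 u - L2_emb L2 v.
Proof.
move=> su sv; have := L2_emb_linear L2 (-1) sv su; rewrite scaleN1r addrC => <-.
by congr L2_emb; apply: functional_extensionality_dep => p; rewrite scaleN1r addrC.
Qed.

Lemma rnorm_embB u v : smooth_cpt u -> smooth_cpt v ->
  rnorm (L2_emb L2 u - L2_emb L2 v) ^+ 2 = nrm2 h mu (fun p => u p - v p).
Proof. by move=> su sv; rewrite -L2_embB// rnorm_emb//; exact: smooth_cptB. Qed.

Lemma nbhs_rnorm x (e : R) : 0 < e -> nbhs x [set y | rnorm (y - x) < e].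
Proof.
move=> e0; apply/nbhs_normP; exists e%:C%C; first by rewrite /= ltcR.
by move=> y /=; rewrite /ball_ /= normE ltcR rnorm_dist.
Qed.

Lemma closure_rnorm (A : set L2) x (e : R) : closure A x -> 0 < e ->
  exists2 y, A y & rnorm (y - x) < e.
Proof. by move=> cA e0; have [y [Ay yx]] := cA _ (nbhs_rnorm x e0); exists y. Qed.

Lemma L2_emb_approx x (e : R) : 0 < e -> exists2 u, smooth_cpt u & rnorm (L2_emb L2 u - x) < e.
Proof.
move=> e0; have cx : closure (L2_emb L2 @` (@smooth_cpt _ _ _ _ S)) x by rewrite L2_emb_dense.
by have [_ [u su <-] ux] := closure_rnorm cx e0; exists u.
Qed.

Lemma L2_emb_seq x : exists2 u : nat -> section_of S, forall m, smooth_cpt (u m) &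
  forall e, 0 < e -> exists N, forall m, (N <= m)%N -> rnorm (L2_emb L2 (u m) - x) <= e.
Proof.
have /choice[u uP] m : exists u, smooth_cpt u /\ rnorm (L2_emb L2 u - x) < m.+1%:R^-1.
  by have [|u su ux] := @L2_emb_approx x m.+1%:R^-1; [rewrite invr_gt0|exists u].
exists u => [m|e e0]; first by have [] := uP m.
have [N _ NP] := near_infty_natSinv_lt (PosNum e0).
by exists N => m Nm; have [_ /ltW/le_trans] := uP m; apply; apply/ltW/NP.
Qed.

Lemma L2_complete (y : nat -> L2) :
  (forall e, 0 < e -> exists N, forall m m', (N <= m)%N -> (N <= m')%N -> rnorm (y m - y m') <= e) ->
  exists l, forall e, 0 < e -> exists N, forall m, (N <= m)%N -> rnorm (y m - l) <= e.
Proof.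
move=> yc; have cy : y @ \oo --> lim (y @ \oo).
  apply/cauchy_cvgP/cauchy_exP => e e0; have eE := real_ge0 (ltW e0).
  have e1 : 0 < complex.Re e / 2 by rewrite divr_gt0//; move: e0; rewrite eE ltcR.
  have [N NP] := yc _ e1; exists (y N), N => // m /= Nm.
  rewrite -ball_normE /ball_/= eE normE ltcR; apply: le_lt_trans (NP _ _ _ Nm) _ => //.
  by rewrite ltr_pdivrMr// ltr_pMr ?ltr1n//; move: e0; rewrite eE ltcR.
exists (lim (y @ \oo)) => e e0.
have [N _ NP] := cy _ (nbhs_rnorm (lim (y @ \oo)) e0).
by exists N => m Nm; apply/ltW/NP.
Qed.

(** The value at [x] is a [y] with [rnorm (T0 u - y) <= C * rnorm (L2_emb L2 u - x)] for all smooth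
    [u]; density makes it unique, and linearity, boundedness and extension all follow from this
    inequality. *)
Lemma L2_extend (T0 : section_of S -> L2) (C : R) : 0 <= C ->
  (forall a u v, smooth_cpt u -> smooth_cpt v ->
     T0 (fun p => a *: u p + v p) = a *: T0 u + T0 v) ->
  (forall u, smooth_cpt u -> rnorm (T0 u) <= C * rnorm (L2_emb L2 u)) ->
  exists T : L2 -> L2, [/\ forall a x y, T (a *: x + y) = a *: T x + T y,
    forall x, rnorm (T x) <= C * rnorm x & forall u, smooth_cpt u -> T (L2_emb L2 u) = T0 u].
Proof.
move=> C0 T0l T0b.
have T0B u v : smooth_cpt u -> smooth_cpt v ->
    rnorm (T0 u - T0 v) <= C * rnorm (L2_emb L2 u - L2_emb L2 v).
  move=> su sv; rewrite -L2_embB//; apply: le_trans (T0b _ (smooth_cptB su sv)).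
  have := T0l (-1) _ _ sv su; rewrite scaleN1r addrC => <-.
  rewrite le_eqVlt (_ : T0 _ = T0 (fun p => u p - v p)) ?eqxx//; congr T0.
  by apply: functional_extensionality_dep => p; rewrite scaleN1r addrC.
have /choice[T TP] x : exists y, forall u, smooth_cpt u ->
    rnorm (T0 u - y) <= C * rnorm (L2_emb L2 u - x).
  have [u su ux] := L2_emb_seq x.
  (* The required [y] is the limit of [T0] along one sequence approximating [x]. *)
  have [e e0|l lP] := @L2_complete (T0 \o u).
    have e1 : 0 < e / (2 * (C + 1)) by rewrite divr_gt0// mulr_gt0// ltr_wpDl.
    have [N NP] := ux _ e1; exists N => m m' Nm Nm' /=.
    apply: le_trans (T0B _ _ (su m) (su m')) _.
    have := rnorm_triangle x (L2_emb L2 (u m)) (L2_emb L2 (u m')).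
    have := NP m Nm; have := NP m' Nm'; rewrite [in X in X -> _]rnorm_dist => h1 h2 h3.
    apply: (@le_trans _ _ ((C + 1) * (2 * (e / (2 * (C + 1)))))).
      by apply: ler_pM => //; [exact: rnorm_ge0|rewrite lerDl|lra].
    rewrite le_eqVlt; apply/orP; left; apply/eqP; field.
    by rewrite gt_eqF// ltr_wpDl.
  exists l => v sv; apply/ler_addgt0Pr => e e0.
  have e1 : 0 < e / (C + 1) by rewrite divr_gt0// ltr_wpDl.
  have [N1 h1] := lP _ e1; have [N2 h2] := ux _ e1; pose m := maxn N1 N2.
  have b1 := h1 m (leq_maxl _ _); have b2 := h2 m (leq_maxr _ _).
  apply: le_trans (rnorm_triangle (T0 (u m)) _ _) _.
  have b3 := T0B _ _ sv (su m).
  have b4 := rnorm_triangle x (L2_emb L2 v) (L2_emb L2 (u m)).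
  rewrite [X in _ <= _ + X]rnorm_dist in b4.
  have b5 : C * rnorm (L2_emb L2 v - L2_emb L2 (u m)) <= C * (rnorm (L2_emb L2 v - x) + e / (C + 1)).
    by apply: ler_wpM2l => //; apply: le_trans b4 _; rewrite lerD2l.
  have -> : e = C * (e / (C + 1)) + e / (C + 1) by field; rewrite gt_eqF// ltr_wpDl.
  rewrite addrA -mulrDr; apply: lerD => //; exact: le_trans b3 b5.
exists T; split=> [a x y|x|u su].
- apply/eqP; rewrite -subr_eq0; apply/eqP/rnorm_eq0/eqP; rewrite eq_le rnorm_ge0 andbT.
  apply/ler_addgt0Pr => e e0; rewrite add0r.
  set A := complex.Re `|a|; have A0 : 0 <= A by have := normr_ge0 a; rewrite (real_ge0 (normr_ge0 a)) lecR.
  (* Approximating [x] and [y] within [d] puts the linear combination within [(A + 1) * d]; applying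
     the bounds twice then costs at most [e]. *)
  set d := e / (2 * (C + 1) * (A + 1)).
  have AC : 0 < 2 * (C + 1) * (A + 1) by rewrite !mulr_gt0// ltr_wpDl.
  have d0 : 0 < d by rewrite divr_gt0.
  have [u su ux] := L2_emb_approx x d0; have [v sv vy] := L2_emb_approx y d0.
  have b0 := TP (a *: x + y) _ (smooth_cpt_lin a su sv).
  rewrite T0l// L2_emb_linear// in b0.
  have b1 := TP x u su; have b2 := TP y v sv.
  have dist (p q p' q' : L2) : rnorm (a *: p + q - (a *: p' + q')) <= A * rnorm (p - p') + rnorm (q - q').
    by rewrite opprD addrACA -scalerBr; apply: le_trans (rnormD _ _) _; rewrite rnormZ.
  have b3 := dist (T0 u) (T0 v) (T x) (T y).
  have b4 := dist (L2_emb L2 u) (L2_emb L2 v) x y.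
  apply: le_trans (rnorm_triangle (a *: T0 u + T0 v) _ _) _.
  rewrite [X in X + _]rnorm_dist.
  have b5 : A * rnorm (L2_emb L2 u - x) + rnorm (L2_emb L2 v - y) <= (A + 1) * d.
    by rewrite mulrDl mul1r; apply: lerD; [apply: ler_wpM2l => //|]; exact: ltW.
  have b6 : C * rnorm (a *: L2_emb L2 u + L2_emb L2 v - (a *: x + y)) <= C * ((A + 1) * d).
    by apply: ler_wpM2l => //; exact: le_trans b4 b5.
  have b7 : A * rnorm (T0 u - T x) + rnorm (T0 v - T y) <= C * ((A + 1) * d).
    apply: le_trans (_ : C * (A * rnorm (L2_emb L2 u - x) + rnorm (L2_emb L2 v - y)) <= _).
      by rewrite mulrDr mulrCA; apply: lerD => //; apply: ler_wpM2l.
    exact: ler_wpM2l.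
  have -> : e = (C + 1) * ((A + 1) * d) + (C + 1) * ((A + 1) * d).
    by rewrite /d; field; rewrite !gt_eqF// ltr_wpDl.
  have Ad : 0 <= (A + 1) * d by rewrite mulr_ge0 ?addr_ge0// ltW.
  by move: b0 b3 b6 b7; lra.
- apply/ler_addgt0Pr => e e0.
  have e1 : 0 < e / (2 * (C + 1)) by rewrite divr_gt0// mulr_gt0// ltr_wpDl.
  have [u su ux] := L2_emb_approx x e1; have b1 := TP x u su; have b2 := T0b u su.
  have b3 : rnorm (L2_emb L2 u) <= rnorm (L2_emb L2 u - x) + rnorm x.
    by have := rnormD (L2_emb L2 u - x) x; rewrite subrK.
  have b4 : rnorm (T x) <= rnorm (T0 u - T x) + rnorm (T0 u).
    by have := rnormD (T x - T0 u) (T0 u); rewrite subrK rnorm_dist.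
  have b5 : C * rnorm (L2_emb L2 u - x) <= C * (e / (2 * (C + 1))) by apply: ler_wpM2l => //; exact: ltW.
  have b6 : C * rnorm (L2_emb L2 u) <= C * (e / (2 * (C + 1)) + rnorm x).
    by apply: ler_wpM2l => //; apply: le_trans b3 _; rewrite lerD2r ltW.
  have -> : e = 2 * ((C + 1) * (e / (2 * (C + 1)))) by field; rewrite gt_eqF// ltr_wpDl.
  by move: e1 b1 b2 b4 b5 b6; move: (e / _) => d; lra.
have := TP (L2_emb L2 u) u su; rewrite subrr /rnorm normr0 mulr0 => b.
apply/esym/eqP; rewrite -subr_eq0; apply/eqP/rnorm_eq0/eqP.
by rewrite eq_le rnorm_ge0 andbT.
Qed.

End L2_extension.

Section L2_mollifiers.
Context {R : realType} {n : nat} {M : manifold R n} {k : nat} {S : vbundle M k}.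
Context {h : hermitian_metric S} {mu : {measure set (borel M) -> \bar R}} (L2 : L2_space h mu).
Implicit Types (u v : section_of S).

Lemma rnorm_emb_le u v (C : R) : smooth_cpt u -> smooth_cpt v -> 0 <= C ->
  nrm2 h mu u <= C * nrm2 h mu v -> rnorm (L2_emb L2 u) <= Num.sqrt C * rnorm (L2_emb L2 v).
Proof.
move=> su sv C0 uv; have p : 0 <= Num.sqrt C * rnorm (L2_emb L2 v).
  by rewrite mulr_ge0 ?sqrtr_ge0 ?rnorm_ge0.
by rewrite -(@ler_pXn2r _ 2)// ?nnegrE ?rnorm_ge0// exprMn sqr_sqrtr// !rnorm_emb.
Qed.

Lemma ltr_half_div (b x r : R) : 0 < b -> x < r / (2 * b) -> b * x < r / 2.
Proof.
move=> b0; rewrite -ltr_pdivlMl// (_ : r / (2 * b) = b^-1 * (r / 2))//.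
by field; rewrite gt_eqF.
Qed.

(** Brings convergence in the completion into the form of the Cauchy condition on energies; the
    square root converts squared norms to norms. *)
Lemma nrm2_cauchy (u : nat -> section_of S) (x : L2) : (forall m, smooth_cpt (u m)) ->
  (forall e, 0 < e -> exists N, forall m, (N <= m)%N -> rnorm (L2_emb L2 (u m) - x) <= e) ->
  forall e, 0 < e -> exists N, forall m m', (N <= m)%N -> (N <= m')%N ->
    nrm2 h mu (fun p => u m p - u m' p) <= e.
Proof.
move=> su ux e e0; have d0 : 0 < Num.sqrt e / 2 by rewrite divr_gt0// sqrtr_gt0.
have [N NP] := ux _ d0; exists N => m m' Nm Nm'.
rewrite -(rnorm_embB L2 (su m) (su m')) -(sqr_sqrtr (ltW e0)).
rewrite ler_pXn2r// ?nnegrE ?rnorm_ge0 ?sqrtr_ge0//.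
apply: le_trans (rnorm_triangle x _ _) _; rewrite [leRHS](splitr (Num.sqrt e)).
by apply: lerD; [exact: NP|rewrite rnorm_dist; exact: NP].
Qed.

End L2_mollifiers.

Theorem lemma5p4 (R : realType) (n k : nat) (M : manifold R n)
    (S : vbundle M k) (h : hermitian_metric S)
    (mu : {measure set (borel M) -> \bar R})
    (mu_smooth : nowhere_vanishing_smooth_measure mu)
    (mu_bounded : uniformly_bounded_densities mu)
    (L2 : L2_space h mu) (K : set M) (K_compact : compact K) :
  exists (eps : R) (F : R -> L2 -> L2),
  [/\ 0 < eps,
      (forall t, 0 < t < eps -> linear_on (L2_on L2 K) (F t)),
      (exists C : R, forall t, 0 < t < eps -> opnorm_le (L2_on L2 K) (F t) C),
      (forall u, L2_on L2 K u -> F t u @[t --> 0^'+] --> u)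
    & (forall t, 0 < t < eps -> forall u, L2_on L2 K u ->
        exists2 v, smooth_cpt v & F t u = L2_emb L2 v) /\
      (forall D : diffop S, exists C : R, forall t, 0 < t < eps ->
        exists T : L2 -> L2,
        [/\ linear_on (L2_on L2 K) T,
            opnorm_le (L2_on L2 K) T C
          & forall u v, smooth_supp_in K u -> smooth_cpt v ->
            F t (L2_emb L2 u) = L2_emb L2 v ->
            T (L2_emb L2 u) = L2_emb L2 (D v) - F t (L2_emb L2 (D u))])].
Proof.
have [chi [eps [E [chi1 eps0 [Elin Ecpt [C C0 Eb] Eapp [Esm Ecomm]]]]]] :=
  compact_mollifies h mu_bounded K_compact.
have sC : 0 <= Num.sqrt C by exact: sqrtr_ge0.
have opn (T : L2 -> L2) (B : R) (A : set L2) : 0 <= B -> (forall x, rnorm (T x) <= B * rnorm x) ->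
    opnorm_le A T B.
  by move=> B0 TB; split=> // x _; rewrite !normE -rmorphM lecR.
have /choice[F FP] t : exists T : L2 -> L2, 0 < t < eps ->
    [/\ forall a x y, T (a *: x + y) = a *: T x + T y,
      forall x, rnorm (T x) <= Num.sqrt C * rnorm x &
      forall u, smooth_cpt u -> T (L2_emb L2 u) = L2_emb L2 (E t u)].
  (* For [t] outside the interval the identity serves as a default value. *)
  have [tt|nt] := boolP (0 < t < eps); last by exists id.
  have [||T [T1 T2 T3]] := @L2_extend _ _ _ _ _ _ _ L2 (fun u => L2_emb L2 (E t u)) (Num.sqrt C) sC.
  - move=> a u v su sv; rewrite -L2_emb_linear; [|exact: Ecpt|exact: Ecpt].
    by congr L2_emb; apply: functional_extensionality_dep => p; exact: Elin.
  - by move=> u su; apply: rnorm_emb_le => //; [exact: Ecpt|exact: Eb].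
  by exists T.
exists eps, F; split=> //.
- by move=> t tt a x y _ _; have [-> _ _] := FP t tt.
- by exists (Num.sqrt C) => t tt; apply: opn => //; have [] := FP t tt.
- move=> x Kx; apply/cvgrPdist_lt => e e0; have eE := real_ge0 (ltW e0).
  have r0 : 0 < complex.Re e by move: e0; rewrite eE ltcR.
  set B := Num.sqrt C + 1; have B0 : 0 < B by rewrite ltr_wpDl.
  have d0 : 0 < complex.Re e / (2 * B) by rewrite divr_gt0// mulr_gt0.
  (* The error splits into three: replacing [x] by a smooth [v] supported in [K] before and after
     applying [F t], and the approximation error of [v]. The first two together cost
     [Num.sqrt C + 1] times the distance from [v] to [x]. *)
  have [_ [v [sv cv vK] <-] vx] := closure_rnorm Kx d0.
  have [C1 C10 hC1] := Eapp v (conj sv cv); set B1 := Num.sqrt C1 + 1.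
  have B10 : 0 < B1 by rewrite ltr_wpDl// sqrtr_ge0.
  (* Here the support condition enters: the operators approximate multiplication by [chi], which
     fixes sections supported in [K]. *)
  have chiv : forall p, (chi p)%:C%C *: v p = v p.
    move=> p; have [->|/eqP vp] := eqVneq (v p) 0; first by rewrite scaler0.
    by rewrite chi1 ?scale1r//; apply: vK; exact: subset_closure.
  near=> t.
  have t0 : 0 < t by near: t; exact: nbhs_right_gt.
  have te : t < eps by near: t; exact: nbhs_right_lt.
  have tt : 0 < t < eps by rewrite t0.
  have td : t < complex.Re e / (2 * B1) by near: t; apply: nbhs_right_lt; rewrite divr_gt0// mulr_gt0.
  have [F1 F2 F3] := FP t tt; rewrite eE normE ltcR rnorm_dist.
  have sE : smooth_cpt (E t v) by exact: Ecpt.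
  have b1 : rnorm (F t x - F t (L2_emb L2 v)) <= Num.sqrt C * rnorm (L2_emb L2 v - x).
    have -> : F t x - F t (L2_emb L2 v) = F t (-1 *: L2_emb L2 v + x).
      by rewrite F1 scaleN1r addrC.
    by rewrite [X in _ * X]rnorm_dist; have := F2 (-1 *: L2_emb L2 v + x); rewrite scaleN1r addrC.
  have b2 : rnorm (L2_emb L2 (E t v) - L2_emb L2 v) <= Num.sqrt C1 * t.
    apply: le_trans (ler_norm _) _; apply: norm_le_sqr; first by rewrite mulr_ge0 ?sqrtr_ge0// ltW.
    rewrite rnorm_embB// exprMn sqr_sqrtr//; apply: le_trans (hC1 t tt).
    rewrite le_eqVlt (_ : (fun p => E t v p - _) = fun p => E t v p - (chi p)%:C%C *: v p) ?eqxx//.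
    by apply: functional_extensionality_dep => p; rewrite chiv.
  have b3 := rnorm_triangle (F t (L2_emb L2 v)) (F t x) x.
  have b4 := rnorm_triangle (L2_emb L2 v) (F t (L2_emb L2 v)) x.
  rewrite F3// in b1 b3 b4.
  have b5 : B * rnorm (L2_emb L2 v - x) < complex.Re e / 2.
    exact: ltr_half_div.
  have b6 : B1 * t < complex.Re e / 2.
    exact: ltr_half_div.
  by move: b5 b6; rewrite /B /B1 !mulrDl !mul1r; lra.
split.
  move=> t tt x _; have [u su ux] := L2_emb_seq x; have [F1 F2 F3] := FP t tt.
  (* [E t (u m)] tends to the smooth section [v] in energy and to [F t x] by continuity of [F t], so
     the two limits agree. *)
  have [v sv vu] := Esm t u tt su (nrm2_cauchy su ux); exists v => //.
  apply/eqP; rewrite -subr_eq0; apply/eqP/rnorm_eq0/eqP; rewrite eq_le rnorm_ge0 andbT.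
  apply/ler_addgt0Pr => e e0; rewrite add0r.
  set B := Num.sqrt C + 1; have B0 : 0 < B by rewrite ltr_wpDl.
  have d0 : 0 < e / (2 * B) by rewrite divr_gt0// mulr_gt0.
  have [N1 h1] := ux _ d0; have [N2 h2] := vu _ (exprn_gt0 2 (divr_gt0 e0 (ltr0Sn R 1))).
  pose m := maxn N1 N2; have b1 := h1 m (leq_maxl _ _); have b2 := h2 m (leq_maxr _ _).
  have sE : smooth_cpt (E t (u m)) by exact: Ecpt.
  have e2 : 0 <= e / 2 by rewrite divr_ge0// ltW.
  rewrite -(rnorm_embB L2 sE sv) ler_pXn2r ?nnegrE ?rnorm_ge0// in b2.
  apply: le_trans (rnorm_triangle (L2_emb L2 (E t (u m))) _ _) _.
  have b3 : rnorm (F t x - L2_emb L2 (E t (u m))) <= Num.sqrt C * rnorm (L2_emb L2 (u m) - x).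
    have -> : F t x - L2_emb L2 (E t (u m)) = F t (-1 *: L2_emb L2 (u m) + x).
      by rewrite F1 F3// scaleN1r addrC.
    by rewrite [X in _ * X]rnorm_dist; have := F2 (-1 *: L2_emb L2 (u m) + x); rewrite scaleN1r addrC.
  rewrite [leRHS](splitr e); apply: lerD => //; apply: le_trans b3 _.
  apply: (@le_trans _ _ (B * (e / (2 * B)))).
    by apply: ler_pM => //; [exact: rnorm_ge0|rewrite lerDl].
  by rewrite le_eqVlt; apply/orP; left; apply/eqP; field; rewrite gt_eqF.
move=> D; have [C1 C10 h1] := Ecomm D; exists (Num.sqrt C1) => t tt; have [F1 F2 F3] := FP t tt.
have sD u : smooth_cpt u -> smooth_cpt (D u) by exact: diffop_smooth_cpt.
have sE u : smooth_cpt u -> smooth_cpt (E t u) by exact: Ecpt.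
have sW u : smooth_cpt u -> smooth_cpt (fun p => D (E t u) p - E t (D u) p).
  by move=> su; apply: smooth_cptB; [exact/sD/sE|exact/sE/sD].
(* The commutator on smooth sections is bounded in the norm of the completion, although neither of
   its two terms is estimated separately; it therefore extends as a single operator. *)
have [||T [T1 T2 T3]] := @L2_extend _ _ _ _ _ _ _ L2
  (fun u => L2_emb L2 (fun p => D (E t u) p - E t (D u) p)) (Num.sqrt C1) (sqrtr_ge0 _).
- move=> a u v su sv; rewrite -L2_emb_linear; [|exact: sW|exact: sW].
  congr L2_emb; apply: functional_extensionality_dep => p.
  have -> : E t (fun q => a *: u q + v q) = fun q => a *: E t u q + E t v q.
    by apply: functional_extensionality_dep => q; exact: Elin.
  have -> : D (fun q => a *: u q + v q) = fun q => a *: D u q + D v q.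
    by apply: functional_extensionality_dep => q; apply: diffop_linear; [exact: su.1|exact: sv.1].
  rewrite (diffop_linear D a (sE _ su).1 (sE _ sv).1) (Elin t a _ _ tt (sD _ su) (sD _ sv)).
  by rewrite scalerBr opprD addrACA.
- by move=> u su; apply: rnorm_emb_le => //; [exact: sW|exact: h1].
exists T; split; first by move=> a x y _ _; exact: T1.
  by apply: opn => //; exact: sqrtr_ge0.
move=> u v [su cu _] sv; have scu : smooth_cpt u by split.
rewrite F3// T3// F3; last exact: sD.
(* [v] and [E t u] have the same image in the completion, so their difference has zero energy and
   they coincide as sections; only then may [D v] be replaced by [D (E t u)]. *)
move=> Ev; have <- : E t u = v.
  apply: functional_extensionality_dep => p; apply/eqP; rewrite -subr_eq0; apply/eqP.
  apply: (nrm2_eq0 (h := h) mu_bounded (smooth_cptB (sE _ scu) sv)).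
  rewrite -(rnorm_embB L2 (sE _ scu) sv) Ev subrr.
  by rewrite /rnorm normr0 expr0n.
by rewrite L2_embB//; [exact/sD/sE|exact/sE/sD].
Unshelve. all: by end_near.
Qed.
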